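(* There exist absolute constants $c_1,c_2\in(0,\infty)$ such that the following holds. Let $1\le p<\infty$, let $n,N\in\mathbb N$ with $n\le N\le e^{\sqrt n}$, and let $X_1,\dots,X_N$ be independent random vectors distributed on the $\ell_p^n$-sphere $\{x\in\mathbb R^n:\|x\|_p=1\}$ according to the cone probability measure $\mathbf m_{\mathbb B_p^n}$. Then, for every integer $1\le\ell\le N$ and any real $q\ge1$, $$c_1\,n^{-1/p}\,\Phi(N,\ell,q)\;\le\;\mathbb E\, w\big(K_{N,\ell,q}\big)\;\le\; c_2\,n^{-1/p}\,\Phi(N,\ell,q),$$ where $$\Phi(N,\ell,q)=\min\left\{\max\left\{\sqrt q,\ \sqrt{\log(N/\ell)}\right\},\ \sqrt{\log N}\right\}.$$
   Context: $\log$ is the natural logarithm, $\langle\cdot,\cdot\rangle$ the standard inner product on $\mathbb R^n$, $\mathbb S^{n-1}$ the Euclidean unit sphere of $\mathbb R^n$, and $\sigma_{n-1}$ the rotationally invariant probability measure on $\mathbb S^{n-1}$. For $1\le p<\infty$, $\|x\|_p=(\sum_{i=1}^n|x_i|^p)^{1/p}$ and $\mathbb B_p^n=\{x\in\mathbb R^n:\|x\|_p\le1\}$. The cone probability measure on the boundary of $\mathbb B_p^n$ is $$\mathbf m_{\mathbb B_p^n}(B)=\frac{|\{rx:\ x\in B,\ 0\le r\le1\}|}{|\mathbb B_p^n|}$$ for Borel sets $B\subset\{x:\|x\|_p=1\}$, where $|\cdot|$ is Lebesgue measure on $\mathbb R^n$. For nonnegative numbers $a_1,\dots,a_N$ and $1\le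 k\le N$, $k\text{-}\max_{1\le i\le N} a_i$ denotes the $k$-th largest of the numbers $a_1,\dots,a_N$ (counted with multiplicity). For random vectors $X_1,\dots,X_N$ in $\mathbb R^n$ (defined on a common probability space), an integer $1\le \ell\le N$ and $1\le q<\infty$, $K_{N,\ell,q}$ is the random convex body in $\mathbb R^n$ with support function $$h_{K_{N,\ell,q}}(\theta)=\Big(\frac1\ell\sum_{k=1}^{\ell} k\text{-}\max_{1\le i\le N}|\langle X_i,\theta\rangle|^q\Big)^{1/q},\qquad \theta\in\mathbb S^{n-1}.$$ Its mean width is $w(K_{N,\ell,q})=\int_{\mathbb S^{n-1}}h_{K_{N,\ell,q}}(\theta)\,d\sigma_{n-1}(\theta)$. ''Absolute constant'' means a constant not depending on any of the parameters involved ($p,n,N,\ell,q$).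
   Formalization: The case n = N = 1 is excluded by assuming N ≥ 2: there X_1 = ±1, so the mean width is 1 while Φ(1,1,q) = 0 because log N = 0, and the upper bound fails for every c_2. *)

(* Defs.v *)
From HB Require Import structures.
From mathcomp Require Import all_boot all_order all_algebra.
From mathcomp Require Import all_classical all_reals all_analysis.

Set Implicit Arguments.
Unset Strict Implicit.
Unset Printing Implicit Defensive.
Import Order.TTheory GRing.Theory Num.Theory.
Import numFieldNormedType.Exports.

Local Open Scope classical_set_scope.
Local Open Scope ring_scope.

(* 'rV[R]_n with its Borel sigma-algebra. *)
Notation borel_rV R n := (g_sigma_algebraType (@open 'rV[R]_n)).

Definition dot (R : realType) (n : nat) (x y : 'rV[R]_n) : R :=
  \sum_(i < n) x ord0 i * y ord0 i.

Definition lpnorm (R : realType) (n : nat) (p : R) (x : 'rV[R]_n) : R :=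
  (\sum_(i < n) `|x ord0 i| `^ p) `^ p^-1.

Definition lpball (R : realType) (n : nat) (p : R) : set 'rV[R]_n :=
  [set x | lpnorm p x <= 1].

Definition lpsphere (R : realType) (n : nat) (p : R) : set 'rV[R]_n :=
  [set x | lpnorm p x = 1].

Definition unit_sphere (R : realType) (n : nat) : set 'rV[R]_n :=
  [set x | dot x x = 1].

(* n-dimensional Lebesgue measure, by integrating sections one coordinate at a
   time.  By Tonelli, this is the product measure on Borel sets; on other sets
   the value is not meaningful. *)
Fixpoint volume (R : realType) (n : nat) : set 'rV[R]_n -> \bar R :=
  match n return set 'rV[R]_n -> \bar R with
  | 0 => fun A => (\1_A (0 : 'rV[R]_0))%:E
  | m.+1 => fun A =>
      (\int[@lebesgue_measure R]_t
         volume [set y : 'rV[R]_m | A (row_mx (t%:M : 'rV[R]_1) y)])%E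
  end.

Definition cone_over (R : realType) (n : nat) (B : set 'rV[R]_n) :
    set 'rV[R]_n :=
  [set y | exists r x, [/\ 0 <= r <= 1, B x & y = r *: x]].

(* Only meaningful for Borel subsets B of lpsphere p. *)
Definition cone_measure (R : realType) (n : nat) (p : R) (B : set 'rV[R]_n) :
    \bar R :=
  (volume (cone_over B) / volume (@lpball R n p))%E.

Definition has_cone_law (R : realType) (d : measure_display)
    (Omega : measurableType d) (P : probability Omega R) (n : nat) (p : R)
    (X : {RV P >-> borel_rV R n}) : Prop :=
  forall B : set (borel_rV R n), measurable B -> B `<=` @lpsphere R n p ->
    distribution P X B = cone_measure p B.

Definition mutually_independent (R : realType) (d : measure_display)
    (Omega : measurableType d) (P : probability Omega R)
    (d' : measure_display) (T : measurableType d') (N : nat)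
    (X : 'I_N -> {RV P >-> T}) : Prop :=
  forall (J : {set 'I_N}) (A : 'I_N -> set T),
    (forall i, i \in J -> measurable (A i)) ->
    P (\bigcap_(i in [set i | i \in J]) (X i @^-1` A i)) =
    (\prod_(i in J) P (X i @^-1` A i))%E.

(* sigma is the rotationally invariant probability measure on the Euclidean
   unit sphere, seen as a measure on the whole space carried by the sphere. *)
Definition is_uniform_on_sphere (R : realType) (n : nat)
    (sigma : probability (borel_rV R n) R) : Prop :=
  sigma (@unit_sphere R n) = 1%E /\
  forall (U : 'M[R]_n), U *m U^T = 1%:M ->
  forall A : set (borel_rV R n), measurable A ->
    sigma [set x : borel_rV R n | A (x *m U)] = sigma A.

(* kmax k a is the k-th largest of a_1, ..., a_N, for 1 <= k <= N. *)
Definition kmax (R : realType) (N k : nat) (a : 'I_N -> R) : R :=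
  nth 0 (sort >=%R [seq a i | i : 'I_N]) k.-1.

(* Nonempty interior is not required. *)
Definition is_convex_body (R : realType) (n : nat) (K : set 'rV[R]_n) : Prop :=
  [/\ K !=set0, compact K & convex_set K].

Definition support_fun (R : realType) (n : nat) (K : set 'rV[R]_n)
    (theta : 'rV[R]_n) : R :=
  sup [set dot x theta | x in K].

Definition mean_width (R : realType) (n : nat)
    (sigma : probability (borel_rV R n) R) (K : set 'rV[R]_n) : R :=
  \int[sigma]_(theta in @unit_sphere R n) support_fun K theta.

Definition top_mean (R : realType) (n N l : nat) (q : R) (x : 'I_N -> 'rV[R]_n)
    (theta : 'rV[R]_n) : R :=
  (l%:R^-1 * \sum_(1 <= k < l.+1) kmax k (fun i => `|dot (x i) theta| `^ q))
    `^ q^-1.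

Definition is_body_KNlq (R : realType) (n N l : nat) (q : R)
    (x : 'I_N -> 'rV[R]_n) (K : set 'rV[R]_n) : Prop :=
  is_convex_body K /\
  forall theta, @unit_sphere R n theta ->
    support_fun K theta = top_mean l q x theta.

Definition Phi (R : realType) (N l : nat) (q : R) : R :=
  Num.min (Num.max (Num.sqrt q) (Num.sqrt (ln (N%:R / l%:R))))
          (Num.sqrt (ln N%:R)).

(* Main.v *)
(* Let Q be the cone measure and nu = n^(1/p).  Integrating in polar coordinates
   against the weight W(x) = exp(- sum_i |x_i|^p), a product of one-dimensional
   weights, turns moments of Q into moments of independent coordinates.  Two
   bounds come out, with absolute constants:
   (i)  E_Q |X|_2^(2k) <= (C n / nu^2)^k as long as k^2 <= 16 n;
   (ii) E_Q <X, theta>^(2k) >= (c k / nu^2)^k for a unit vector theta such that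
        (k - 1) max_i theta_i^2 is small, because the multilinear part of the
        expansion of <x, theta>^(2k) already dominates.
   Averaging over the sphere gives E_theta <x, theta>^(2k) <= (C k |x|^2 / n)^k,
   so (i) bounds the double average E_theta E_Q <X, theta>^(2k) by (C k / nu^2)^k.

   Let t = min (max (q, log (N / l)), log N); then Phi = sqrt t and t <= sqrt n.
   Upper bound: with k of order t and A of order sqrt k / nu, the l largest
   |<X_i, theta>|^q average to at most A^q (1 + (1 / l) sum_i (<X_i, theta> / A)^(2k)),
   whose correction term has bounded expectation.
   Lower bound: for at least half of the directions, theta is flat and its
   moments of order 4k are controlled, so that (ii) and the Paley-Zygmund inequality give
   P (|<X, theta>| >= c sqrt t / nu) >= c0 exp (- t).  A second use of
   Paley-Zygmund, with pairwise independence, shows that with probability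
   bounded below about N exp (- t) of the X_i satisfy this at once, and then the
   average of the l largest is at least of the order of (sqrt t / nu)^q exp (- q). *)

(* The hypothesis [N <= exp (sqrt n)] enters because only moments of order up to about [sqrt n]
   behave as Gaussian ones. For [p = 1] an unnormalised coordinate has [E x_1^(2k) = (2k)!], which
   stays below [(C n)^k] only when [k^2] is of order [n]; and the flatness available for most
   directions, [max_i theta_i^2 <= C / sqrt n], makes [(k - 1) max_i theta_i^2] small under the same
   restriction. The other concern is uniformity in [p]. Bound (i) is split at [p = 2]: above 2 it is
   a pointwise comparison of norms; below 2 a truncated exponential moment of order about [sqrt n]
   is used, and smaller orders are interpolated from it. Passing from [W] to [Q] divides by the
   [W]-moment of [|x|_p], so an upper estimate of that moment is needed for (ii) and, when [p <= 2],
   a lower one for (i). Both come from dilations, without Gamma functions: [W(x)] is compared with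
   [W(s x)], whose integral is [s^(-n)] times that of [W]. *)
Require Import Defs.
From HB Require Import structures.
From mathcomp Require Import all_boot all_order all_algebra.
From mathcomp Require Import all_classical all_reals all_analysis.
From mathcomp Require Import measurable_realfun ring lra zify.

Set Implicit Arguments.
Unset Strict Implicit.
Unset Printing Implicit Defensive.
Import Order.TTheory GRing.Theory Num.Theory.
Import numFieldNormedType.Exports.

Local Open Scope classical_set_scope.
Local Open Scope ring_scope.

(** * Lebesgue measure on row vectors *)

(** The boxes with rational centre and radius [1/(k+1)] form a countable family, and an open set is
    the union of those it contains; so measurable coordinates suffice, although the sigma-algebra is
    generated by open sets and not defined as a product. *)
Lemma measurable_rV d (T : measurableType d) (R : realType) n
    (f : T -> borel_rV R n) :
  (forall i, measurable_fun [set: T] (fun x => f x ord0 i)) ->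
  measurable_fun [set: T] f.
Proof.
move=> mf; apply: (@measurability _ _ _ (borel_rV R n) setT f (@open (matrix R 1 n))) => //.
move=> _ [U oU <-].
pose box (c : {ffun 'I_n -> rat} * nat) : set 'rV[R]_n :=
  [set y | forall i, `|ratr (c.1 i) - y ord0 i| < c.2.+1%:R^-1].
have mbox c : measurable (f @^-1` box c).
  rewrite (_ : f @^-1` box c = \bigcap_(i in [set: 'I_n])
      [set x | `|ratr (c.1 i) - f x ord0 i| < c.2.+1%:R^-1]); last first.
    by apply/seteqP; split=> x /= h i; [move=> _|]; exact: h.
  apply: fin_bigcap_measurable => // i _.
  rewrite -[X in measurable X]setTI.
  have -> : [set x | `|ratr (c.1 i) - f x ord0 i| < c.2.+1%:R^-1] =
      (fun x => `|ratr (c.1 i) - f x ord0 i|) @^-1` `]-oo, c.2.+1%:R^-1[%classic.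
    by apply/seteqP; split=> x /=; rewrite in_itv.
  have mg : measurable_fun [set: T] (fun x => `|ratr (c.1 i) - f x ord0 i|).
    by apply: measurableT_comp => //; exact: measurable_funB.
  exact: mg measurableT _ _.
rewrite setTI (_ : _ @^-1` _ = \bigcup_(c in [set: {ffun 'I_n -> rat} * nat])
    (if `[< box c `<=` U >] then f @^-1` box c else set0)); last first.
  apply/seteqP; split=> [x /= Ufx|x [c _]]; last first.
    by case: ifPn => // /asboolP bU /= /bU.
  have /nbhs_ballP[e /= e0 eU] : nbhs (f x) U by exact: open_nbhs_nbhs.
  have [k ke] : exists k : nat, k.+1%:R^-1 < e / 2.
    have h : 0 < e / 2 by rewrite divr_gt0.
    exists (Num.truncn (e / 2)^-1).
    by rewrite invf_plt ?posrE// truncnS_gt.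
  have hk (i : 'I_n) : f x ord0 i - k.+1%:R^-1 < f x ord0 i + k.+1%:R^-1.
    by rewrite ltrD2l -subr_gt0 opprK addr_gt0// invr_gt0.
  pose q := [ffun i : 'I_n => projT1 (cid (rat_in_itvoo (hk i)))].
  have hq i : `|ratr (q i) - f x ord0 i| < k.+1%:R^-1.
    rewrite /q ffunE; case: cid => /= r; rewrite in_itv/= => /andP[h1 h2].
    by rewrite distrC ltr_distl ltrBlDr h2 -ltrBlDr h1.
  exists (q, k) => //; rewrite ifT//; apply/asboolP => y /= hy; apply: eU.
  split=> // a i; rewrite ord1 /ball/= (le_lt_trans (ler_distD (ratr (q i)) _ _))//.
  rewrite [ltRHS]splitr ltrD//; first by rewrite distrC (lt_trans (hq i)).
  exact: lt_trans (hy i) ke.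
apply: countable_bigcupT_measurable => [|c]; first exact: countableP.
by case: ifP.
Qed.

Lemma continuous_measurable_rV (R : realType) n (f : 'rV[R]_n -> R) :
  continuous f -> measurable_fun [set: borel_rV R n] (f : borel_rV R n -> R).
Proof.
move=> /continuousP cf; apply: (measurability _ (RGenOpens.measurableE R)).
move=> _ [_ [a [b ->] <-]]; rewrite setTI; apply: sub_sigma_algebra.
exact/cf/interval_open.
Qed.

Lemma measurable_coord (R : realType) n (i : 'I_n) :
  measurable_fun [set: borel_rV R n] (fun x : borel_rV R n => x ord0 i).
Proof. by apply: continuous_measurable_rV; exact: coord_continuous. Qed.

Lemma measurable_dot (R : realType) d (T : measurableType d) n
    (f g : T -> borel_rV R n) :
  measurable_fun [set: T] f -> measurable_fun [set: T] g ->
  measurable_fun [set: T] (fun x => dot (f x) (g x)).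
Proof.
move=> mf mg; apply: measurable_sum => i; apply: measurable_funM.
  exact: (measurableT_comp (@measurable_coord R n i) mf).
exact: (measurableT_comp (@measurable_coord R n i) mg).
Qed.

Lemma row_mx_scalarE (R : realType) n (t : R) (y : 'rV[R]_n) (i : 'I_n.+1) :
  (row_mx (t%:M : 'rV_1) y : 'rV_n.+1) ord0 i =
  if unlift ord0 i is Some j then y ord0 j else t.
Proof.
case: (splitP (i : 'I_(1 + n))) => j ij.
  have -> : i = lshift n j :> 'I_(1 + n) by exact/val_inj.
  rewrite (row_mxEl (t%:M : 'rV_1) y) (ord1 j) mxE mulr1n.
  by rewrite (_ : lshift n 0 = ord0 :> 'I_(1 + n)) ?unlift_none//; exact/val_inj.
have -> : i = rshift 1 j :> 'I_(1 + n) by exact/val_inj.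
rewrite (row_mxEr (t%:M : 'rV_1) y).
by rewrite (_ : rshift 1 j = lift ord0 j) ?liftK//; exact/val_inj.
Qed.

Lemma measurable_row_mx (R : realType) n :
  measurable_fun [set: measurableTypeR R * borel_rV R n]
    (fun z => row_mx (z.1%:M : 'rV[R]_1) (z.2 : 'rV[R]_n) : borel_rV R n.+1).
Proof.
apply: measurable_rV => i; under eq_fun do rewrite row_mx_scalarE.
case: unlift => [j|]; last exact: measurable_fst.
exact: (measurableT_comp (@measurable_coord R n j) (@measurable_snd _ _ _ _)).
Qed.

Section row_measure.
Context (R : realType) (n : nat).
Variable mu : {sigma_finite_measure set (borel_rV R n) -> \bar R}.

Let rowf (z : measurableTypeR R * borel_rV R n) : borel_rV R n.+1 :=
  row_mx (z.1%:M : 'rV[R]_1) (z.2 : 'rV[R]_n).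

(** One step of the recursion behind [volume], written as the image of a product measure so that
    additivity and Tonelli are inherited from the product. *)
Definition row_measure : set (borel_rV R n.+1) -> \bar R :=
  pushforward (@lebesgue_measure R \x mu)%E rowf.

Let mrowf : measurable_fun [set: measurableTypeR R * borel_rV R n] rowf.
Proof. exact: measurable_row_mx. Qed.

Let row_measure0 : row_measure set0 = 0%E.
Proof. by rewrite /row_measure /pushforward preimage_set0 measure0. Qed.

Let row_measure_ge0 A : (0 <= row_measure A)%E.
Proof. exact: measure_ge0. Qed.

Let row_measure_sigma_additive : semi_sigma_additive row_measure.
Proof.
move=> F mF tF mUF; rewrite /row_measure /pushforward preimage_bigcup.
apply: measure_semi_sigma_additive.
- by move=> k; rewrite -[X in measurable X]setTI; exact: mrowf.
- apply/trivIsetP => /= i j _ _ ij; rewrite -preimage_setI.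
  by move/trivIsetP : tF => /(_ _ _ _ _ ij) ->//; rewrite preimage_set0.
- by rewrite -preimage_bigcup -[X in measurable X]setTI; exact: mrowf.
Qed.

HB.instance Definition _ := isMeasure.Build _ _ _ row_measure
  row_measure0 row_measure_ge0 row_measure_sigma_additive.

(** The next step of [rV_measure] forms a product with this measure, and Tonelli there requires
    sigma-finiteness. Products of two increasing exhausting sequences exhaust the space. *)
Let row_measure_sigma_finite : sigma_finite [set: borel_rV R n.+1] row_measure.
Proof.
have /sigma_finiteP[F [TF ndF Foo]] := sigma_finiteT (@lebesgue_measure R).
have /sigma_finiteP[G [TG ndG Goo]] := sigma_finiteT mu.
pose hd (x : borel_rV R n.+1) : R := x ord0 ord0.
pose tl (x : borel_rV R n.+1) : borel_rV R n := \row_j x ord0 (lift ord0 j).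
have mhd : measurable_fun [set: borel_rV R n.+1] hd by exact: measurable_coord.
have mtl : measurable_fun [set: borel_rV R n.+1] tl.
  by apply: measurable_rV => i; under eq_fun do rewrite mxE; exact: measurable_coord.
exists (fun k => hd @^-1` F k `&` tl @^-1` G k).
  apply/esym; rewrite -subTset => x _.
  have [i _ Fi] : (\bigcup_k F k) (hd x) by rewrite -TF.
  have [j _ Gj] : (\bigcup_k G k) (tl x) by rewrite -TG.
  exists (maxn i j) => //; split.
    by have /subsetPset := ndF _ _ (leq_maxl i j); apply.
  by have /subsetPset := ndG _ _ (leq_maxr i j); apply.
move=> k; have [mF Fk] := Foo k; have [mG Gk] := Goo k; split.
  apply: measurableI.
    by rewrite -[X in measurable X]setTI; exact: mhd.
  by rewrite -[X in measurable X]setTI; exact: mtl.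
rewrite /row_measure /pushforward [X in (_ X < _)%E](_ : _ = F k `*` G k).
  by rewrite product_measure1E// lte_mul_pinfty// ge0_fin_numE.
apply/seteqP; split=> -[t y] /=; rewrite /hd /tl /rowf /= row_mx_scalarE unlift_none.
  move=> [h1 h2]; split => //; suff -> : y = \row_j row_mx t%:M y ord0 (lift ord0 j) by [].
  by apply/rowP => j; rewrite mxE row_mx_scalarE liftK.
move=> [h1 h2]; split => //; suff <- : y = \row_j row_mx t%:M y ord0 (lift ord0 j) by [].
by apply/rowP => j; rewrite mxE row_mx_scalarE liftK.
Qed.

HB.instance Definition _ := Measure_isSigmaFinite.Build _ _ _ row_measure
  row_measure_sigma_finite.

Lemma ge0_integral_row_measure (f : borel_rV R n.+1 -> \bar R) :
  measurable_fun [set: borel_rV R n.+1] f -> (forall x, 0 <= f x)%E ->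
  (\int[row_measure]_x f x =
   \int[@lebesgue_measure R]_t \int[mu]_y f (row_mx (t%:M : 'rV[R]_1) (y : 'rV[R]_n)))%E.
Proof.
move=> mf f0; rewrite /row_measure ge0_integral_pushforward//.
rewrite preimage_setT fubini_tonelli1//; first exact: measurableT_comp.
by move=> z; exact: f0.
Qed.

End row_measure.

(* [volume] is a bare set function; this is the measure it agrees with on Borel sets. *)
Fixpoint rV_measure (R : realType) (n : nat) :
    {sigma_finite_measure set (borel_rV R n) -> \bar R} :=
  match n with
  | 0 => \d_(0 : borel_rV R 0)
  | m.+1 => row_measure (rV_measure R m)
  end.

Lemma volumeE (R : realType) n (A : set (borel_rV R n)) :
  measurable A -> volume A = rV_measure R n A.
Proof.
elim: n A => [|n IHn] A mA //=.
rewrite /row_measure /pushforward /product_measure1; apply: eq_integral => t _ /=.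
rewrite IHn.
  by congr (rV_measure R n _); apply/seteqP; split=> y; rewrite /xsection/= inE.
rewrite -[X in measurable X]setTI.
exact: (measurableT_comp (@measurable_row_mx R n) (pair1_measurable t)).
Qed.

Lemma integral_rV_measureS (R : realType) n (f : borel_rV R n.+1 -> \bar R) :
  measurable_fun [set: borel_rV R n.+1] f -> (forall x, 0 <= f x)%E ->
  (\int[rV_measure R n.+1]_x f x = \int[@lebesgue_measure R]_t
     \int[rV_measure R n]_y f (row_mx (t%:M : 'rV[R]_1) (y : 'rV[R]_n)))%E.
Proof. exact: ge0_integral_row_measure. Qed.

(** The image of Lebesgue measure under multiplication by [c], times [c], gives each interval []a,
    b]] its length, hence is Lebesgue measure. *)
Lemma ge0_integral_lebesgueZ (R : realType) (c : R) (f : R -> \bar R) :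
  0 < c -> measurable_fun [set: R] f -> (forall t, 0 <= f t)%E ->
  (c%:E * \int[lebesgue_measure]_t f (c * t)%R = \int[lebesgue_measure]_t f t)%E.
Proof.
move=> c0 mf f0.
have mc : measurable_fun [set: measurableTypeR R] ( *%R c : R -> measurableTypeR R).
  exact: mulrl_measurable.
pose c' := NngNum (ltW c0).
have -> : (\int[lebesgue_measure]_t f (c * t)%R)%E =
    (\int[pushforward (@lebesgue_measure R) ( *%R c : R -> measurableTypeR R)]_t f t)%E.
  by rewrite ge0_integral_pushforward.
pose nu : {measure set (measurableTypeR R) -> \bar R} :=
  measure_function_pushforward__canonical__measure_function_Measure (@lebesgue_measure R) mc.
rewrite -(ge0_integral_mscale nu measurableT c')//.
apply: eq_measure_integral => A mA _; apply/esym.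
apply: lebesgue_measure_unique => // _ [[a b]] _ <-.
rewrite [RHS](_ : _ = c%:E * lebesgue_measure ( *%R c @^-1` `]a, b]%classic))%E//.
have -> : *%R c @^-1` `]a, b]%classic = `](a / c), (b / c)]%classic.
  apply/seteqP; split=> t /=; rewrite !in_itv/= ltr_pdivrMr// ler_pdivlMr//;
  by rewrite (mulrC t).
rewrite !lebesgue_measure_itv/= !lte_fin ltr_pM2r ?invr_gt0//.
case: ifPn => ab; last by rewrite mule0.
by rewrite -!EFinD -EFinM mulrBr !(mulrC c) !divfK ?gt_eqF.
Qed.

Lemma ge0_integral_lebesgueN (R : realType) (f : R -> \bar R) :
  measurable_fun [set: R] f -> (forall t, 0 <= f t)%E ->
  (\int[lebesgue_measure]_t f (- t)%R = \int[lebesgue_measure]_t f t)%E.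
Proof.
move=> mf f0.
have -> : (\int[lebesgue_measure]_t f (- t)%R)%E =
    (\int[pushforward (@lebesgue_measure R) (-%R : R -> measurableTypeR R)]_t f t)%E.
  by rewrite ge0_integral_pushforward.
by apply: eq_measure_integral => A mA _; exact: lebesgue_measureN.
Qed.

Lemma measurable_integral_row (R : realType) n (f : borel_rV R n.+1 -> \bar R) :
  measurable_fun [set: borel_rV R n.+1] f -> (forall x, 0 <= f x)%E ->
  measurable_fun [set: R] (fun t =>
    \int[rV_measure R n]_y f (row_mx (t%:M : 'rV[R]_1) (y : 'rV[R]_n)))%E.
Proof.
move=> mf f0.
apply: (measurable_fun_fubini_tonelli_F
  (fun z : R * borel_rV R n => f (row_mx (z.1%:M : 'rV[R]_1) (z.2 : 'rV[R]_n)))).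
  exact: (measurableT_comp mf (@measurable_row_mx R n)).
by move=> z; exact: f0.
Qed.

Lemma measurable_row_section (R : realType) n (t : R) :
  measurable_fun [set: borel_rV R n]
    (fun y : borel_rV R n => row_mx (t%:M : 'rV[R]_1) (y : 'rV[R]_n) : borel_rV R n.+1).
Proof. exact: (measurableT_comp (@measurable_row_mx R n) (pair1_measurable t)). Qed.

Lemma measurable_rV_scale (R : realType) n (s : R) :
  measurable_fun [set: borel_rV R n] (fun x : borel_rV R n => s *: (x : 'rV[R]_n) : borel_rV R n).
Proof.
apply: measurable_rV => i; under eq_fun do rewrite mxE.
by apply: measurable_funM => //; exact: measurable_coord.
Qed.

Lemma ge0_integral_rV_measureZ (R : realType) n (s : R) (f : borel_rV R n -> \bar R) :
  0 < s -> measurable_fun [set: borel_rV R n] f -> (forall x, 0 <= f x)%E ->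
  ((s ^+ n)%:E * \int[rV_measure R n]_x f (s *: (x : 'rV[R]_n)) =
   \int[rV_measure R n]_x f x)%E.
Proof.
move=> s0; elim: n f => [|n IHn] f mf f0.
  rewrite expr0 mul1e; apply: eq_integral => x _; congr f.
  by apply/rowP => -[].
have mfs : measurable_fun [set: borel_rV R n.+1] (fun x => f (s *: (x : 'rV[R]_n.+1))).
  exact: (measurableT_comp mf (@measurable_rV_scale R n.+1 s)).
rewrite !integral_rV_measureS// exprS EFinM -muleA.
rewrite -ge0_integralZl//; last 3 first.
- exact: (measurable_integral_row mfs).
- by move=> t _; exact: integral_ge0.
- by rewrite lee_fin exprn_ge0// ltW.
rewrite -[RHS](ge0_integral_lebesgueZ s0); last 2 first.
- exact: measurable_integral_row.
- by move=> t; exact: integral_ge0.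
congr *%E; apply: eq_integral => t _.
rewrite -(IHn (fun y => f (row_mx (s * t)%:M (y : 'rV[R]_n)))); last 2 first.
- exact: (measurableT_comp mf (@measurable_row_section R n _)).
- by move=> y; exact: f0.
congr *%E; apply: eq_integral => y _; congr f.
apply/rowP => i; rewrite [RHS]row_mx_scalarE mxE row_mx_scalarE.
by case: unlift => // j; rewrite mxE.
Qed.

Lemma ge0_integral_rV_measure_prod (R : realType) n (f : 'I_n -> R -> R) :
  (forall i, measurable_fun [set: R] (f i)) -> (forall i t, 0 <= f i t) ->
  (\int[rV_measure R n]_x (\prod_(i < n) f i ((x : 'rV[R]_n) ord0 i))%:E =
   \prod_(i < n) \int[lebesgue_measure]_t (f i t)%:E)%E.
Proof.
have mp m (g : 'I_m -> R -> R) : (forall i, measurable_fun [set: R] (g i)) ->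
    measurable_fun [set: borel_rV R m] (fun x : borel_rV R m =>
      \prod_(i < m) g i ((x : 'rV[R]_m) ord0 i)).
  move=> mg; apply: measurable_prod => i _.
  exact: (measurableT_comp (mg i) (@measurable_coord R m i)).
elim: n f => [|n IHn] f mf f0.
  rewrite big_ord0; under eq_integral do rewrite big_ord0.
  by rewrite /= integral_dirac// diracT mul1e.
rewrite integral_rV_measureS; last 2 first.
- by apply/measurable_EFinP; exact: (mp _ f mf).
- by move=> x; rewrite lee_fin prodr_ge0.
rewrite big_ord_recl -(IHn (fun i => f (lift ord0 i)))//.
rewrite -ge0_integralZr//; last 3 first.
- by apply/measurable_EFinP; exact: mf.
- by move=> t _; rewrite lee_fin.
- by apply: integral_ge0 => y _; rewrite lee_fin prodr_ge0.
apply: eq_integral => t _; rewrite -ge0_integralZl//; last 3 first.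
- by apply/measurable_EFinP; exact: (mp _ (fun i => f (lift ord0 i))).
- by move=> y _; rewrite lee_fin prodr_ge0.
- by rewrite lee_fin.
apply: eq_integral => y _; rewrite big_ord_recl row_mx_scalarE unlift_none.
rewrite EFinM; congr (_ * _%:E)%E; apply: eq_bigr => i _.
by rewrite row_mx_scalarE liftK.
Qed.

(** * Polar coordinates for the p-norm *)

Definition psum (R : realType) (n : nat) (p : R) (x : 'rV[R]_n) : R :=
  \sum_(i < n) `|x ord0 i| `^ p.

(** Since the inverse of 0 is 0, the origin is sent to itself, off the sphere. It is a null set for
    [n > 0] and is discarded where this matters. *)
Definition normalize (R : realType) (n : nat) (p : R) (x : 'rV[R]_n) : 'rV[R]_n :=
  (lpnorm p x)^-1 *: x.

Lemma ge0_integral_le_add d (T : measurableType d) (R : realType)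
    (mu : {measure set T -> \bar R}) (f g h : T -> R) (a c : R) :
  measurable_fun setT f -> measurable_fun setT g -> measurable_fun setT h ->
  (forall x, 0 <= f x) -> (forall x, 0 <= g x) -> (forall x, 0 <= h x) ->
  0 <= a -> 0 <= c -> (forall x, a * g x <= f x + c * h x) ->
  (a%:E * \int[mu]_x (g x)%:E <=
   \int[mu]_x (f x)%:E + c%:E * \int[mu]_x (h x)%:E)%E.
Proof.
move=> mf mg mh f0 g0 h0 a0 c0 le.
have mfE : measurable_fun setT (EFin \o f) by apply/measurable_EFinP.
have mgE : measurable_fun setT (EFin \o g) by apply/measurable_EFinP.
have mhE : measurable_fun setT (EFin \o h) by apply/measurable_EFinP.
rewrite -!ge0_integralZl ?lee_fin//; try by move=> x _; rewrite lee_fin.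
have p1 (x : T) : setT x -> (0 <= (f x)%:E)%E by rewrite lee_fin.
have p2 (x : T) : setT x -> (0 <= c%:E * (h x)%:E)%E.
  by move=> _; rewrite -EFinM lee_fin mulr_ge0.
have mch : measurable_fun setT (fun x => c%:E * (h x)%:E)%E by exact: measurable_funeM.
rewrite -(ge0_integralD mu measurableT p1 mfE p2 mch).
apply: ge0_le_integral => //.
- by move=> x _; rewrite -EFinM lee_fin mulr_ge0.
- exact: measurable_funeM.
- exact: emeasurable_funD.
- by move=> x _; rewrite -!EFinM -EFinD lee_fin.
Qed.

Lemma measurable_fun_powR d (T : measurableType d) (R : realType) (D : set T)
    (f : T -> R) (q : R) :
  measurable_fun D f -> measurable_fun D (fun x => f x `^ q).
Proof. by move=> mf; exact: (measurableT_comp (measurable_powR q) mf). Qed.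

Section lpnorm_theory.
Context (R : realType) (n : nat) (p : R).
Hypothesis p1 : 1 <= p.
Implicit Types (x : 'rV[R]_n).

Let p0 : 0 < p. Proof. exact: lt_le_trans p1. Qed.

Let p1E q : 1 `^ q = 1 :> R. Proof. by rewrite powR1. Qed.

Lemma psum_ge0 x : 0 <= psum p x.
Proof. by apply: sumr_ge0 => i _; exact: powR_ge0. Qed.

Lemma lpnorm_ge0 x : 0 <= lpnorm p x.
Proof. exact: powR_ge0. Qed.

Lemma lpnormXp x : lpnorm p x `^ p = psum p x.
Proof. by rewrite /lpnorm -powRrM mulVf ?gt_eqF// powRr1// psum_ge0. Qed.

Lemma psumZ s x : 0 <= s -> psum p (s *: x) = s `^ p * psum p x.
Proof.
move=> s0; rewrite /psum mulr_sumr; apply: eq_bigr => i _.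
by rewrite mxE normrM ger0_norm// powRM.
Qed.

Lemma lpnormZ s x : 0 <= s -> lpnorm p (s *: x) = s * lpnorm p x.
Proof.
move=> s0; rewrite /lpnorm -!/(psum p _) psumZ// powRM ?powR_ge0 ?psum_ge0//.
by rewrite -powRrM mulfV ?gt_eqF// powRr1.
Qed.

Lemma psum_eq0 x : (psum p x == 0) = (x == 0).
Proof.
apply/eqP/eqP => [/eqP|->]; last first.
  rewrite /psum big1// => i _.
  by rewrite mxE normr0 powR0 ?gt_eqF.
rewrite psumr_eq0 => [/allP h|i _]; last exact: powR_ge0.
apply/rowP => i; rewrite mxE; apply/eqP.
have := h i; rewrite mem_index_enum => /(_ isT)/=.
by rewrite powR_eq0 normr_eq0 (gt_eqF p0) andbT.
Qed.

Lemma lpnorm_eq0 x : (lpnorm p x == 0) = (x == 0).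
Proof. by rewrite powR_eq0 -/(psum p x) psum_eq0 invr_eq0 gt_eqF//= andbT. Qed.

Lemma lpnorm_gt0 x : x != 0 -> 0 < lpnorm p x.
Proof. by move=> x0; rewrite lt_neqAle eq_sym lpnorm_eq0 x0 lpnorm_ge0. Qed.

Lemma lpnorm_normalize x : x != 0 -> lpnorm p (normalize p x) = 1.
Proof.
move=> x0; rewrite /normalize lpnormZ ?invr_ge0 ?lpnorm_ge0//.
by rewrite mulVf// lpnorm_eq0.
Qed.

Lemma normalizeZ s x : 0 < s -> normalize p (s *: x) = normalize p x.
Proof.
move=> s0; rewrite /normalize lpnormZ ?ltW// scalerA invfM.
by rewrite (mulrC s^-1) mulfVK ?gt_eqF.
Qed.

Lemma lpnorm_normalizeK x : lpnorm p x *: normalize p x = x.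
Proof.
have [->|x0] := eqVneq x 0; first by rewrite /normalize !scaler0.
by rewrite /normalize scalerA mulfV ?scale1r// lpnorm_eq0.
Qed.

Lemma measurable_psum : measurable_fun [set: borel_rV R n] (@psum R n p).
Proof.
apply: measurable_sum => i; apply: measurable_fun_powR.
by apply: measurableT_comp => //; exact: measurable_coord.
Qed.

Lemma measurable_lpnorm : measurable_fun [set: borel_rV R n] (@lpnorm R n p).
Proof. exact: measurable_fun_powR measurable_psum. Qed.

Lemma measurable_normalize : measurable_fun [set: borel_rV R n]
  (@normalize R n p : borel_rV R n -> borel_rV R n).
Proof.
apply: measurable_rV => i; under eq_fun do rewrite mxE.
apply: measurable_funM; last exact: measurable_coord.
rewrite (_ : (fun x : borel_rV R n => _) = (fun x => lpnorm p x `^ (-1))).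
  exact: measurable_fun_powR measurable_lpnorm.
by apply/funext => x; rewrite powR_inv1// lpnorm_ge0.
Qed.

Lemma measurable_lpnorm_preimage (B : set R) : measurable B ->
  measurable (@lpnorm R n p @^-1` B : set (borel_rV R n)).
Proof. by move=> mB; rewrite -[X in measurable X]setTI; exact: measurable_lpnorm. Qed.

Lemma measurable_normalize_preimage (A : set (borel_rV R n)) : measurable A ->
  measurable (@normalize R n p @^-1` A : set (borel_rV R n)).
Proof. by move=> mB; rewrite -[X in measurable X]setTI; exact: measurable_normalize. Qed.

Lemma lpballE : @lpball R n p = @lpnorm R n p @^-1` `]-oo, 1]%classic.
Proof. by apply/seteqP; split=> x; rewrite /= in_itv. Qed.

Lemma measurable_lpball : measurable (@lpball R n p : set (borel_rV R n)).
Proof. by rewrite lpballE; exact: measurable_lpnorm_preimage. Qed.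

Lemma measurable_lpsphere : measurable (@lpsphere R n p : set (borel_rV R n)).
Proof.
rewrite (_ : lpsphere p = @lpnorm R n p @^-1` [set 1]) //.
exact: measurable_lpnorm_preimage.
Qed.

Lemma measurable_rV0 : measurable ([set 0] : set (borel_rV R n)).
Proof.
rewrite (_ : [set 0] = @lpnorm R n p @^-1` [set 0]).
  exact: measurable_lpnorm_preimage.
apply/seteqP; split=> x /=; first by move=> ->; apply/eqP; rewrite lpnorm_eq0.
by move=> /eqP; rewrite lpnorm_eq0 => /eqP.
Qed.

Let mu := rV_measure R n.

Lemma measurable_box (a : R) :
  measurable [set x : borel_rV R n | forall i, `|x ord0 i| <= a].
Proof.
rewrite (_ : [set x : borel_rV R n | _] = \bigcap_(i in [set: 'I_n])
    [set x : borel_rV R n | `|x ord0 i| <= a]); last first.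
  by apply/seteqP; split=> x /= h i; [move=> _|]; exact: h.
apply: fin_bigcap_measurable => // i _.
rewrite (_ : [set x | _] = (fun x : borel_rV R n => x ord0 i) @^-1` `[- a, a]%classic).
  by rewrite -[X in measurable X]setTI; exact: measurable_coord.
by apply/seteqP; split=> x /=; rewrite in_itv/= ler_norml.
Qed.

(** The indicator of a box is a product over coordinates. Boxes serve as test sets: one contains the
    ball, one fits inside it, and the one of side 0 shows that the origin is null. *)
Lemma rV_measure_box (a : R) : 0 <= a ->
  mu [set x : borel_rV R n | forall i, `|x ord0 i| <= a] = ((2 * a) ^+ n)%:E.
Proof.
move=> a0; set B := [set x | _].
have BE (x : 'rV[R]_n) : \1_B x = \prod_(i < n) \1_`[- a, a]%classic (x ord0 i) :> R.
  rewrite indicE; case: (boolP (x \in B)) => [|]; rewrite ?inE ?notin_setE /B/= => h.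
    rewrite big1// => i _; rewrite indicE mem_set//= in_itv/= -ler_norml.
    exact: h.
  move/existsNP : h => [i hi]; rewrite (bigD1 i)//= indicE memNset ?mul0r//.
  by rewrite /= in_itv/= -ler_norml.
have mB : measurable (B : set (borel_rV R n)) by exact: measurable_box.
rewrite -(setIT B) -integral_indic//.
under eq_integral do rewrite BE.
rewrite (ge0_integral_rV_measure_prod (f := fun _ => \1_`[- a, a]%classic))//.
under eq_bigr do rewrite integral_indic// setIT.
under eq_bigr do rewrite /= lebesgue_measure_itv/= lte_fin.
have -> : (if (- a < a)%R then a%:E - (- a)%:E else 0)%E = (2 * a)%:E.
  case: ifPn => [|]; first by rewrite -EFinB opprK mulr_natl mulr2n.
  by rewrite -leNgt => h; have a00 : a = 0; [lra | rewrite a00 mulr0].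
by rewrite prodEFin prodr_const card_ord.
Qed.

Lemma lpball_fin : (mu (@lpball R n p) < +oo)%E.
Proof.
apply: (@le_lt_trans _ _ (mu [set x : borel_rV R n | forall i, `|x ord0 i| <= 1])).
  apply: le_measure; rewrite ?inE.
  - exact: measurable_lpball.
  - exact: measurable_box.
  move=> x; rewrite /lpball/= => x1 i; rewrite leNgt; apply/negP => h.
  have : 1 < psum p x.
    apply: (@lt_le_trans _ _ (`|x ord0 i| `^ p)).
      by rewrite -[ltLHS](p1E p) gt0_ltr_powR// nnegrE.
    by rewrite /psum (bigD1 i)//= lerDl sumr_ge0// => j _; exact: powR_ge0.
  rewrite -lpnormXp ltNge => /negP; apply.
  by rewrite -[leRHS](p1E p) ge0_ler_powR// ?nnegrE ?lpnorm_ge0// ltW.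
by rewrite rV_measure_box// ltry.
Qed.

(** The cube of half-side [1/(n+1)] fits inside: there [|x_i|^p <= |x_i|] because [|x_i| <= 1 <= p],
    and the sum is at most [n/(n+1)]. *)
Lemma lpball_gt0 : (0 < mu (@lpball R n p))%E.
Proof.
have h : 0 <= n.+1%:R^-1 :> R by rewrite invr_ge0.
apply: (@lt_le_trans _ _
    (mu [set x : borel_rV R n | forall i, `|x ord0 i| <= n.+1%:R^-1])).
  by rewrite rV_measure_box// lte_fin exprn_gt0// mulr_gt0// invr_gt0.
apply: le_measure; rewrite ?inE.
- exact: measurable_box.
- exact: measurable_lpball.
move=> x /= xn; rewrite /lpball/= -[leRHS](p1E p^-1) ge0_ler_powR//.
- by rewrite invr_ge0 ltW.
- by rewrite nnegrE psum_ge0.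
- by rewrite nnegrE.
apply: (@le_trans _ _ (\sum_(i < n) n.+1%:R^-1)).
  apply: ler_sum => i _; apply: (le_trans _ (xn i)).
  have [->|x0] := eqVneq (x ord0 i) 0; first by rewrite normr0 powR0 ?gt_eqF.
  rewrite -[leRHS]powRr1// ger_powR// normr_gt0 x0/= (le_trans (xn i))//.
  by rewrite invf_le1// ler1n.
by rewrite sumr_const card_ord -(mulr_natl n.+1%:R^-1) ler_pdivrMr// mul1r ler_nat.
Qed.

Lemma rV_measure_set0 : (0 < n)%N -> mu [set 0] = 0%E.
Proof.
move=> n0; apply/eqP; rewrite eq_le measure_ge0 andbT.
have -> : 0%E = mu [set x : borel_rV R n | forall i, `|x ord0 i| <= 0].
  by rewrite rV_measure_box// mulr0 expr0n gtn_eqF.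
apply: le_measure; rewrite ?inE.
- exact: measurable_rV0.
- exact: measurable_box.
by move=> _ -> i; rewrite mxE normr0.
Qed.

End lpnorm_theory.

Section polar.
Context (R : realType) (n : nat) (p : R).
Hypotheses (n0 : (0 < n)%N) (p1 : 1 <= p).

Let mu := rV_measure R n.
Let p0 : 0 < p. Proof. exact: lt_le_trans p1. Qed.

Let mu00 : mu [set 0] = 0%E. Proof. exact: rV_measure_set0. Qed.

(** The parameter [r = 0] puts the origin in the cone over any nonempty [B], while normalisation
    does not send the origin to the sphere; it is therefore removed and added back. *)
Lemma cone_overE (B : set 'rV[R]_n) : B `<=` lpsphere p -> B !=set0 ->
  cone_over B = (lpball p `&` normalize p @^-1` B) `\ 0 `|` [set 0].
Proof.
move=> Bs [b Bb]; apply/seteqP; split=> y.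
  move=> [r [x [/andP[r0 r1] Bx ->]]].
  have x1 : lpnorm p x = 1 by exact: Bs.
  have [->|rN0] := eqVneq r 0; first by right; rewrite scale0r.
  have r_gt0 : 0 < r by rewrite lt_neqAle eq_sym rN0.
  left; split; last first.
    move=> /= /eqP; rewrite -(lpnorm_eq0 p1) (lpnormZ p1)// x1 mulr1.
    by rewrite (negbTE rN0).
  split; first by rewrite /lpball/= (lpnormZ p1)// x1 mulr1.
  by rewrite /= (normalizeZ p1)// /normalize x1 invr1 scale1r.
move=> [[[y1 By] /= y0]|->]; last by exists 0, b; rewrite scale0r; split=> //; rewrite lexx ler01.
exists (lpnorm p y), (normalize p y); split => //; last by rewrite (lpnorm_normalizeK p1).
by rewrite lpnorm_ge0 y1.
Qed.

Lemma volume_cone_over (B : set (borel_rV R n)) : measurable B -> B `<=` lpsphere p ->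
  volume (cone_over B) = mu (lpball p `&` normalize p @^-1` B).
Proof.
move=> mB Bs.
have mC : measurable (lpball p `&` normalize p @^-1` B : set (borel_rV R n)).
  by apply: measurableI; [exact: measurable_lpball|exact: measurable_normalize_preimage].
have [->|/set0P B0] := eqVneq B set0.
  rewrite preimage_set0 setI0 measure0 (_ : cone_over set0 = set0).
    by rewrite volumeE ?measure0.
  by apply/seteqP; split=> y // [r [x []]].
rewrite cone_overE// (_ : _ `|` _ = (lpball p `&` normalize p @^-1` B) `|` [set 0]).
  rewrite volumeE ?measureU0//; try exact: (measurable_rV0 p1).
  by apply: measurableU => //; exact: (measurable_rV0 p1).
apply/seteqP; split=> x [h|->]; try by right.
  by left; case: h.
by have [->|x0] := eqVneq x 0; [right|left; split => // /eqP; rewrite (negbTE x0)].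
Qed.

Variable Q : probability (borel_rV R n) R.
Hypothesis Q_cone : forall B : set (borel_rV R n), measurable B ->
  B `<=` lpsphere p -> Q B = cone_measure p B.

Let b : R := fine (mu (lpball p)).

Let bE : mu (lpball p) = b%:E.
Proof. by rewrite fineK// ge0_fin_numE// lpball_fin. Qed.

Let b_gt0 : 0 < b.
Proof. by rewrite -lte_fin -bE lpball_gt0. Qed.

Let Q_sphere_sub (B : set (borel_rV R n)) : measurable B -> B `<=` lpsphere p ->
  mu (lpball p `&` normalize p @^-1` B) = (Q B * mu (lpball p))%E.
Proof.
move=> mB Bs; rewrite Q_cone// /cone_measure volume_cone_over// volumeE; last first.
  exact: measurable_lpball.
rewrite -/mu bE inver gt_eqF// -muleA -EFinM mulVf ?gt_eqF// mule1.
by [].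
Qed.

(** The law is prescribed only on subsets of the sphere. Almost every point of the ball normalises
    into the sphere, so applying the prescription to the whole sphere gives [Q (lpsphere p) = 1],
    and an arbitrary [A] may be cut down to its trace on the sphere. *)
Lemma cone_lawE (A : set (borel_rV R n)) : measurable A ->
  mu (lpball p `&` normalize p @^-1` A) = (Q A * mu (lpball p))%E.
Proof.
move=> mA.
have mS : measurable (lpsphere p : set (borel_rV R n)) by exact: measurable_lpsphere.
have mC (B : set (borel_rV R n)) : measurable B ->
    measurable (lpball p `&` normalize p @^-1` B : set (borel_rV R n)).
  move=> mB; apply: measurableI; first exact: measurable_lpball.
  exact: measurable_normalize_preimage.
have m0 := @measurable_rV0 R n p p1.
have ae_sphere (B : set (borel_rV R n)) : measurable B ->
    mu (lpball p `&` normalize p @^-1` B) =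
    mu (lpball p `&` normalize p @^-1` (B `&` lpsphere p)).
  move=> mB; have mBS := measurableI _ _ mB mS.
  apply/eqP; rewrite eq_le; apply/andP; split; last first.
    apply: le_measure; rewrite ?inE; [exact: mC|exact: mC|].
    by move=> x [? []].
  rewrite -[leRHS](measureU0 (mC _ mBS) m0 mu00).
  apply: le_measure; rewrite ?inE; [exact: mC| |].
    by apply: measurableU => //; exact: mC.
  move=> x [x1 Bx]; have [->|x0] := eqVneq x 0; [by right|left].
  by split => //; split => //; exact: lpnorm_normalize.
rewrite ae_sphere// Q_sphere_sub; [|exact: measurableI|by move=> x []].
congr (_ * _)%E; suff QS : Q (lpsphere p) = 1%E.
  apply/eqP; rewrite eq_le; apply/andP; split.
    by apply: le_measure; rewrite ?inE//; [exact: measurableI].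
  rewrite -[leRHS]adde0 -(_ : Q (~` lpsphere p) = 0%E); last first.
    by rewrite probability_setC// QS subee.
  apply: (le_trans _ (measureU2 _ _ _)); [|exact: measurableI|exact: measurableC].
  apply: le_measure; rewrite ?inE//.
    by apply: measurableU; [exact: measurableI|exact: measurableC].
  by move=> x Ax; have [?|?] := pselect (lpsphere p x); [left|right].
have := ae_sphere setT measurableT; rewrite preimage_setT setIT setTI Q_sphere_sub//.
rewrite bE -[Q _]fineK ?fin_num_measure// -EFinM => -[h].
by congr EFin; apply: (mulIf (lt0r_neq0 b_gt0)); rewrite mul1r -h.
Qed.

End polar.

Section polar_scaling.
Context (R : realType) (n : nat) (p : R).
Hypotheses (p1 : 1 <= p).
Let mu := rV_measure R n.

Lemma rV_measure_sector (A : set (borel_rV R n)) (s : R) : 0 < s -> measurable A ->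
  mu (lpnorm p @^-1` `]-oo, s] `&` normalize p @^-1` A) =
  ((s ^+ n)%:E * mu (lpball p `&` normalize p @^-1` A))%E.
Proof.
move=> s0 mA.
have mC (B : set R) : measurable B ->
    measurable (lpnorm p @^-1` B `&` normalize p @^-1` A : set (borel_rV R n)).
  move=> mB; apply: measurableI; first exact: measurable_lpnorm_preimage.
  exact: measurable_normalize_preimage.
have muE (B : set R) : measurable B -> mu (lpnorm p @^-1` B `&` normalize p @^-1` A) =
    (\int[mu]_x (\1_(lpnorm p @^-1` B `&` normalize p @^-1` A) x)%:E)%E.
  by move=> mB; rewrite integral_indic ?setIT//; exact: mC.
rewrite lpballE !muE// -(ge0_integral_rV_measureZ s0); last 2 first.
- by apply/measurable_EFinP; apply: measurable_indic; exact: mC.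
- by move=> x; rewrite lee_fin.
congr *%E; apply: eq_integral => x _; rewrite !indicE; congr (_%:R%:E).
congr (nat_of_bool _).
apply/idP/idP; rewrite !inE/= (normalizeZ p1)// (lpnormZ p1) ?ltW// !in_itv/=.
  by move=> [h hA]; split=> //; rewrite -(ler_pM2l s0) mulr1.
by move=> [h hA]; split=> //; rewrite -[leRHS]mulr1 ler_pM2l.
Qed.

End polar_scaling.

Section radial_measure.
Context (R : realType) (n : nat) (p : R).
Hypothesis (p1 : 1 <= p).

(** Binding [p1] makes the bound on [p] an argument, so that the sigma-finiteness instance, whose
    proof relies on it, can be attached to the function. *)
Definition radial_measure : set R -> \bar R := let _ := p1 in
  pushforward (rV_measure R n) (@lpnorm R n p : borel_rV R n -> R).

Let radial_measure0 : radial_measure set0 = 0%E.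
Proof. by rewrite /radial_measure /pushforward preimage_set0 measure0. Qed.

Let radial_measure_ge0 A : (0 <= radial_measure A)%E.
Proof. by rewrite /radial_measure /pushforward measure_ge0. Qed.

Let radial_measure_sigma_additive : semi_sigma_additive radial_measure.
Proof.
move=> F mF tF mUF; rewrite /radial_measure /pushforward preimage_bigcup.
apply: measure_semi_sigma_additive.
- by move=> k; exact: measurable_lpnorm_preimage.
- apply/trivIsetP => /= i j _ _ ij; rewrite -preimage_setI.
  by move/trivIsetP : tF => /(_ _ _ _ _ ij) ->//; rewrite preimage_set0.
- by rewrite -preimage_bigcup; exact: measurable_lpnorm_preimage.
Qed.

HB.instance Definition _ := isMeasure.Build _ _ _ radial_measure
  radial_measure0 radial_measure_ge0 radial_measure_sigma_additive.

Lemma radial_measure_fin (s : R) : (radial_measure `]-oo, s] < +oo)%E.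
Proof.
(* The scaling of sectors requires a positive radius, and [s] may be negative. *)
apply: (@le_lt_trans _ _ (radial_measure `]-oo, Num.max s 1])).
  apply: le_measure; rewrite ?inE//.
  by move=> x /=; rewrite !in_itv/= => /le_trans; apply; rewrite le_max lexx.
rewrite /radial_measure/= /pushforward -(setIT (_ @^-1` _)).
rewrite -[X in _ `&` X](preimage_setT (normalize p)) rV_measure_sector//; last first.
  by rewrite lt_max ltr01 orbT.
rewrite preimage_setT setIT lte_mul_pinfty ?lpball_fin// lee_fin exprn_ge0//.
by rewrite le_max ler01 orbT.
Qed.

Let radial_measure_sigma_finite : sigma_finite [set: R] radial_measure.
Proof.
exists (fun k => `]-oo, k%:R]%classic) => [|k].
  apply/esym; rewrite -subTset => x _; exists (Num.truncn `|x|).+1 => //=.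
  by rewrite in_itv/= (le_trans (ler_norm _))// ltW// truncnS_gt.
by split => //; exact: radial_measure_fin.
Qed.

HB.instance Definition _ := Measure_isSigmaFinite.Build _ _ _ radial_measure
  radial_measure_sigma_finite.

End radial_measure.

Section polar_integration.
Context (R : realType) (n : nat) (p : R).
Hypotheses (n0 : (0 < n)%N) (p1 : 1 <= p).
Variable Q : probability (borel_rV R n) R.
Hypothesis QE : forall A : set (borel_rV R n), measurable A ->
  rV_measure R n (lpball p `&` normalize p @^-1` A) =
  (Q A * rV_measure R n (lpball p))%E.
Let mu := rV_measure R n.
Let nu := radial_measure n p1.

Let mC (A : set (borel_rV R n)) (E : set R) : measurable A -> measurable E ->
  measurable (normalize p @^-1` A `&` lpnorm p @^-1` E : set (borel_rV R n)).
Proof.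
move=> mA mE; apply: measurableI; first exact: measurable_normalize_preimage.
exact: measurable_lpnorm_preimage.
Qed.

Let sector_le (A : set (borel_rV R n)) (s : R) : measurable A ->
  mu (normalize p @^-1` A `&` lpnorm p @^-1` `]-oo, s]) = (Q A * nu `]-oo, s])%E.
Proof.
move=> mA; have [s0|s0] := ltP 0 s.
  rewrite setIC rV_measure_sector// QE// muleCA; congr *%E.
  rewrite /nu /radial_measure /pushforward/= -(setIT (_ @^-1` _)).
  rewrite -[X in _ `&` X](preimage_setT (normalize p)) rV_measure_sector//.
  by rewrite preimage_setT setIT.
have nu0 : nu `]-oo, s]%classic = 0%E.
  apply/eqP; rewrite eq_le measure_ge0 andbT -(rV_measure_set0 p1 n0).
  apply: (@le_measure _ _ _ mu (lpnorm p @^-1` `]-oo, s]) [set 0]); rewrite ?inE.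
  - exact: measurable_lpnorm_preimage.
  - exact: (measurable_rV0 p1).
  move=> x /=; rewrite in_itv/= => xs; apply/eqP; rewrite -(lpnorm_eq0 p1).
  by rewrite eq_le lpnorm_ge0 (le_trans xs).
rewrite nu0 mule0; apply/eqP; rewrite eq_le measure_ge0 andbT -nu0.
apply: (@le_measure _ _ _ mu _ (lpnorm p @^-1` `]-oo, s])); rewrite ?inE.
- exact: mC.
- exact: measurable_lpnorm_preimage.
- by move=> x [].
Qed.

(** For fixed [A] both sides are measures in [E]. They agree and are finite on half-lines []-oo,
    s]], hence agree on the differences []a, b]], which determine them. *)
Let sector (A : set (borel_rV R n)) (E : set R) : measurable A -> measurable E ->
  mu (normalize p @^-1` A `&` lpnorm p @^-1` E) = (Q A * nu E)%E.
Proof.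
move=> mA mE.
pose mA' := @measurable_normalize_preimage R n p A mA.
pose m1 : {measure set R -> \bar R} :=
  measure_function_pushforward__canonical__measure_function_Measure
    (mrestr mu mA') (@measurable_lpnorm R n p).
have q0 : 0 <= fine (Q A) by exact: fine_ge0.
pose m2 : {measure set R -> \bar R} := mscale (NngNum q0) nu.
have m1E B : m1 B = mu (normalize p @^-1` A `&` lpnorm p @^-1` B) by rewrite setIC.
have m2E B : m2 B = (Q A * nu B)%E.
  by rewrite -[in RHS](fineK (fin_num_measure Q A mA)).
rewrite -m1E -m2E; clearbody m1 m2.
have m1le s : m1 `]-oo, s]%classic = m2 `]-oo, s]%classic.
  by rewrite m1E m2E; exact: sector_le.
have m1fin s : (m1 `]-oo, s]%classic < +oo)%E.
  rewrite m1le m2E -(fineK (fin_num_measure Q A mA)).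
  by rewrite lte_mul_pinfty// ?lee_fin//; exact: radial_measure_fin.
apply: (measure_unique (@ocitv R) (fun k => `]-k%:R, k%:R]%classic)) => //.
- exact: ocitvI.
- move=> k; exact: is_ocitv.
- rewrite -subTset => x _; exists (Num.truncn `|x|).+1 => //=.
  have := truncnS_gt `|x|; rewrite ltr_norml in_itv/= => /andP[-> /ltW ->].
  by [].
- move=> B [[a b]] _ <- /=.
  have [ab|ab] := ltP a b; last first.
    rewrite set_itv_ge; last by rewrite -leNgt bnd_simp.
    by rewrite !measure0.
  have -> : `]a, b]%classic = `]-oo, b]%classic `\` `]-oo, a]%classic :> set R.
    apply/seteqP; split=> x /=; rewrite !in_itv/=.
      by move=> /andP[ax ->]; split => //; apply/negP; rewrite -ltNge.
    by move=> [-> /negP]; rewrite -ltNge => ->.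
  have I : `]-oo, b]%classic `&` `]-oo, a]%classic = `]-oo, a]%classic :> set R.
    by apply/setIidPr => x /=; rewrite !in_itv/= => /le_trans; apply; exact: ltW.
  have m2fin s : (m2 `]-oo, s]%classic < +oo)%E by rewrite -m1le.
  rewrite !measureD//; [|exact: m2fin|exact: m1fin].
  by rewrite I; congr (_ - _)%E; exact: m1le.
- move=> k; apply: le_lt_trans (m1fin k%:R).
  by apply: le_measure; rewrite ?inE//; move=> x /=; rewrite !in_itv/= => /andP[].
Qed.

(** By [sector], the map to direction and radius carries Lebesgue measure to the product of [Q] and
    [radial_measure], and Tonelli separates the factors. The radial integral is kept as an integral
    over the whole space, so no density [s^(n-1)] has to be written. *)
Lemma polar_integral (h : borel_rV R n -> R) (phi : R -> R) :
  measurable_fun [set: borel_rV R n] h -> measurable_fun [set: R] phi ->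
  (forall x, 0 <= h x) -> (forall s, 0 <= phi s) ->
  (\int[mu]_x (h (normalize p x) * phi (lpnorm p x))%:E =
   \int[Q]_x (h x)%:E * \int[mu]_x (phi (lpnorm p x))%:E)%E.
Proof.
move=> mh mphi h0 phi0.
pose T (x : borel_rV R n) : borel_rV R n * R := (normalize p x, lpnorm p x).
have mT : measurable_fun [set: borel_rV R n] T.
  apply: measurable_fun_pair; first exact: measurable_normalize.
  exact: measurable_lpnorm.
have mF : measurable_fun [set: borel_rV R n * R]
    (fun z => (h z.1 * phi z.2)%:E).
  apply/measurable_EFinP; apply: measurable_funM.
    exact: (measurableT_comp mh (@measurable_fst _ _ _ _)).
  exact: (measurableT_comp mphi (@measurable_snd _ _ _ _)).
have F0 (z : borel_rV R n * R) : (0 <= (h z.1 * phi z.2)%:E)%E.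
  by rewrite lee_fin mulr_ge0.
transitivity (\int[pushforward mu T]_z (h z.1 * phi z.2)%:E)%E.
  by rewrite (ge0_integral_pushforward mT)// => z _; exact: F0.
transitivity (\int[(Q \x nu)%E]_z (h z.1 * phi z.2)%:E)%E.
  pose m' : {measure set (borel_rV R n * R) -> \bar R} :=
    measure_function_pushforward__canonical__measure_function_Measure mu mT.
  apply: (@eq_measure_integral _ _ _ _ (Q \x nu)%E m') => A mA _.
  have pu := @product_measure_unique _ _ _ _ R Q (radial_measure n p1) m'.
  by apply/esym; apply: (pu _ A mA) => B E mB mE; exact: sector.
rewrite fubini_tonelli1//.
have mphiE : measurable_fun [set: R] (fun s => (phi s)%:E).
  exact/measurable_EFinP.
transitivity (\int[Q]_x ((h x)%:E * \int[nu]_s (phi s)%:E))%E.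
  apply: eq_integral => x _; rewrite -ge0_integralZl//.
  by move=> s _; rewrite lee_fin.
  by rewrite lee_fin.
rewrite ge0_integralZr//; last 3 first.
- exact/measurable_EFinP.
- by move=> x _; rewrite lee_fin.
- by apply: integral_ge0 => s _; rewrite lee_fin.
congr *%E; rewrite /nu /radial_measure ge0_integral_pushforward//.
- exact: measurable_lpnorm.
- by move=> s _; rewrite lee_fin.
Qed.

End polar_integration.

(** * Moments against the weight *)

Section weight.
Context (R : realType).
Implicit Types (p t : R).

Definition weight1 p t : R := expR (- (`|t| `^ p)).

Lemma weight1_ge0 p t : 0 <= weight1 p t.
Proof. exact: expR_ge0. Qed.

Lemma measurable_weight1 p : measurable_fun [set: R] (weight1 p).
Proof.
apply: measurableT_comp => //; apply: measurable_funN.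
exact: measurable_fun_powR.
Qed.

(** One exponential dominates the weights for all [p >= 1] at once; this keeps the upper constants
    independent of [p]. *)
Lemma weight1_le p t : 1 <= p -> weight1 p t <= expR 1 * expR (- `|t|).
Proof.
move=> p1; rewrite -expRD ler_expR.
suff : `|t| <= 1 + `|t| `^ p by lra.
have [t1|t1] := leP 1 `|t|; first by rewrite (le_trans (le1r_powR t1 p1))// lerDr.
by rewrite (le_trans (ltW t1))// lerDl powR_ge0.
Qed.

Lemma weight1_ge p t : 0 <= p -> `|t| <= 1 -> expR (-1) <= weight1 p t.
Proof.
move=> p0 t1; rewrite ler_expR lerN2.
by have := ge0_ler_powR p0 (normr_ge0 t) (ler01 : 1 \in Num.nneg) t1; rewrite powR1.
Qed.

Lemma exprn_le_expR (x : R) k : 0 <= x -> x ^+ k <= k`!%:R * expR x.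
Proof.
move=> x0; case: k => [|k]; first by rewrite expr0 fact0 mul1r -expR0 ler_expR.
rewrite mulrC -ler_pdivrMr ?ltr0n ?fact_gt0//.
by apply: le_trans (expR_ge1Dxn k x0); rewrite lerDr.
Qed.

(** The integrand is at most twice the sum of the exponential density of rate 1/2 and its mirror
    image, each of mass 1. *)
Lemma integral_expR_abs_half :
  (\int[lebesgue_measure]_t (expR (- (`|t| / 2)))%:E <= 4%:E :> \bar R)%E.
Proof.
pose f := exponential_pdf (2^-1 : R).
have f0 t : 0 <= f t by exact: exponential_pdf_ge0.
have mf : measurable_fun [set: R] f by exact: measurable_exponential_pdf.
have fE t : 0 <= t -> f t = 2^-1 * expR (- (t / 2)).
  by move=> t0; rewrite /f exponential_pdfE// mulNr (mulrC t).
have If : (\int[lebesgue_measure]_t (f t)%:E = 1)%E.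
  exact: integral_exponential_pdf.
have mfN : measurable_fun [set: R] (fun t => f (- t)).
  by apply: measurableT_comp => //; exact: oppr_measurable.
have mE : measurable_fun [set: R] (EFin \o f) by exact/measurable_EFinP.
have mEN : measurable_fun [set: R] (fun t => (f (- t))%:E) by exact/measurable_EFinP.
apply: (@le_trans _ _ (\int[lebesgue_measure]_t (2%:E * ((f t)%:E + (f (- t))%:E)))%E).
  apply: ge0_le_integral => //.
  - apply/measurable_EFinP; apply: measurableT_comp => //; apply: measurable_funN.
    by apply: measurable_funM => //; exact: measurableT_comp.
  - by apply: measurable_funeM; exact: emeasurable_funD.
  - move=> t _; rewrite -EFinD -EFinM lee_fin.
    have [t0|t0] := leP 0 t.
      by rewrite ger0_norm// fE// mulrDr mulVKf// lerDl mulr_ge0.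
    by rewrite ltr0_norm// (fE (- t)) ?oppr_ge0 ?(ltW t0)// mulrDr mulVKf// lerDr mulr_ge0.
rewrite ge0_integralZl//; last 2 first.
- exact: emeasurable_funD.
- by move=> t _; rewrite -EFinD lee_fin addr_ge0.
rewrite ge0_integralD//; last 2 first.
- by move=> t _; rewrite lee_fin.
- by move=> t _; rewrite lee_fin.
rewrite (ge0_integral_lebesgueN (f := EFin \o f))//.
rewrite /comp If -EFinD -EFinM lee_fin.
by lra.
Qed.

Lemma integral_weight1_even p j : 1 <= p ->
  (\int[lebesgue_measure]_t (t ^+ (2 * j) * weight1 p t)%:E <=
   (4 * expR 1 * (2 * j)`!%:R * 4 ^+ j)%:E)%E.
Proof.
move=> p1.
have mexp : measurable_fun [set: R] (fun t : R => (expR (- (`|t| / 2)))%:E).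
  apply/measurable_EFinP; apply: measurableT_comp => //; apply: measurable_funN.
  by apply: measurable_funM => //; exact: measurableT_comp.
pose c : R := expR 1 * (2 * j)`!%:R * 4 ^+ j.
have c0 : 0 <= c by rewrite !mulr_ge0// ?expR_ge0// exprn_ge0.
apply: (@le_trans _ _ (\int[lebesgue_measure]_t (c%:E * (expR (- (`|t| / 2)))%:E))%E).
  apply: ge0_le_integral => //.
  - by move=> t _; rewrite lee_fin mulr_ge0 ?weight1_ge0// exprM exprn_ge0 ?sqr_ge0.
  - apply/measurable_EFinP; apply: measurable_funM; last exact: measurable_weight1.
    exact: exprn_measurable.
  - exact: measurable_funeM.
  move=> t _; rewrite -EFinM lee_fin.
  (* Half of the exponential decay pays for the power, through [y^(2j) <= (2j)! e^y] at [y = |t|/2];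
     the other half remains integrable. *)
  have h1 : t ^+ (2 * j) <= (2 * j)`!%:R * 4 ^+ j * expR (`|t| / 2).
    have := @exprn_le_expR (`|t| / 2) (2 * j) (divr_ge0 (normr_ge0 _) (ler0n _ 2)).
    have e4 : 2 ^+ (2 * j) = 4 ^+ j :> R by rewrite exprM -natrX.
    rewrite expr_div_n e4 -normrX ger0_norm; last by rewrite exprM exprn_ge0 ?sqr_ge0.
    by rewrite ler_pdivrMr ?exprn_gt0// mulrAC.
  apply: (le_trans (ler_pM _ _ h1 (weight1_le t p1))); rewrite ?weight1_ge0//.
    by rewrite exprM exprn_ge0 ?sqr_ge0.
  have E : expR (`|t| / 2) * expR (- `|t|) = expR (- (`|t| / 2)).
    by rewrite -expRD; congr expR; lra.
  by rewrite -E /c le_eqVlt; apply/orP; left; apply/eqP; ring.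
rewrite ge0_integralZl//; apply: (@le_trans _ _ (c%:E * 4%:E)%E).
  by rewrite lee_pmul2l ?integral_expR_abs_half// lte_fin /c !mulr_gt0 ?expR_gt0// ?ltr0n ?fact_gt0// exprn_gt0.
by rewrite -EFinM lee_fin /c le_eqVlt; apply/orP; left; apply/eqP; ring.
Qed.

Lemma integral_indic_ge (a b c : R) (f : R -> R) : a <= b -> 0 <= c ->
  measurable_fun [set: R] f -> (forall t, 0 <= f t) ->
  (forall t, a <= t <= b -> c <= f t) ->
  ((c * (b - a))%:E <= \int[lebesgue_measure]_t (f t)%:E)%E.
Proof.
move=> ab c0 mf f0 cf.
have mI : measurable (`[a, b]%classic : set R) by [].
apply: (@le_trans _ _ (\int[lebesgue_measure]_(t in `[a, b]) (f t)%:E)%E); last first.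
  apply: ge0_subset_integral => //; first exact/measurable_EFinP.
  by move=> t _; rewrite lee_fin.
apply: (@le_trans _ _ (\int[lebesgue_measure]_(t in `[a, b]) (cst c%:E) t)%E).
  rewrite integral_cst//= lebesgue_measure_itv/= lte_fin.
  have [ab'|ba] := ltP a b; first by rewrite -EFinB -EFinM.
  by rewrite (_ : b - a = 0) ?mulr0 ?mule0//; lra.
apply: ge0_le_integral => //.
  by apply/measurable_EFinP; exact: measurable_funTS.
Qed.

Lemma integral_weight1_ge p : 0 <= p ->
  ((2 * expR (-1))%:E <= \int[lebesgue_measure]_t (weight1 p t)%:E :> \bar R)%E.
Proof.
move=> p0; rewrite (_ : 2 * expR (-1) = expR (-1) * (1 - (-1))); last by ring.
apply: integral_indic_ge; rewrite ?expR_ge0//.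
- exact: measurable_weight1.
- by move=> t; exact: weight1_ge0.
- by move=> t; rewrite -ler_norml; exact: weight1_ge.
Qed.

Lemma integral_sqr_weight1_ge p : 0 <= p ->
  ((8^-1 * expR (-1))%:E <= \int[lebesgue_measure]_t (t ^+ 2 * weight1 p t)%:E :> \bar R)%E.
Proof.
(* Only the interval from 1/2 to 1 is kept, where [t^2 >= 1/4] and the weight is at least [1/e]. *)
move=> p0; rewrite (_ : 8^-1 * expR (-1) = (4^-1 * expR (-1)) * (1 - 2^-1)); last by field.
apply: integral_indic_ge; rewrite ?mulr_ge0 ?expR_ge0//.
- by lra.
- by apply: measurable_funM; [exact: exprn_measurable|exact: measurable_weight1].
- by move=> t; rewrite mulr_ge0 ?sqr_ge0 ?weight1_ge0.
- move=> t /andP[t1 t2]; apply: ler_pM; rewrite ?expR_ge0//; first by nra.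
  by apply: weight1_ge => //; rewrite ger0_norm//; lra.
Qed.

Definition weight_mass p : R := fine (\int[lebesgue_measure]_t (weight1 p t)%:E)%E.

Lemma weight_massE p : 1 <= p ->
  (\int[lebesgue_measure]_t (weight1 p t)%:E)%E = (weight_mass p)%:E.
Proof.
move=> p1; rewrite fineK// ge0_fin_numE; last first.
  by apply: integral_ge0 => t _; rewrite lee_fin weight1_ge0.
have := integral_weight1_even 0 p1.
under eq_integral do rewrite muln0 expr0 mul1r.
by move/le_lt_trans; apply; rewrite ltry.
Qed.

Lemma weight_mass_ge p : 1 <= p -> 2 * expR (-1) <= weight_mass p.
Proof.
by move=> p1; rewrite -lee_fin -weight_massE// integral_weight1_ge// (le_trans ler01).
Qed.

Lemma weight_mass_le p : 1 <= p -> weight_mass p <= 4 * expR 1.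
Proof.
move=> p1; rewrite -lee_fin -weight_massE//.
have := integral_weight1_even 0 p1.
under eq_integral do rewrite muln0 expr0 mul1r.
by rewrite muln0 fact0 expr0 !mulr1.
Qed.

Lemma weight_mass_gt0 p : 1 <= p -> 0 < weight_mass p.
Proof. by move=> p1; rewrite (lt_le_trans _ (weight_mass_ge p1))// mulr_gt0// expR_gt0. Qed.

End weight.

Definition weight (R : realType) (n : nat) (p : R) (x : 'rV[R]_n) : R :=
  expR (- psum p x).

Section weight_theory.
Context (R : realType) (n : nat) (p : R).
Hypothesis p1 : 1 <= p.
Implicit Types x : 'rV[R]_n.

Let p0 : 0 < p. Proof. exact: lt_le_trans p1. Qed.
Let mu := rV_measure R n.
Let Z := weight_mass p.

Lemma weight_ge0 x : 0 <= weight p x.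
Proof. exact: expR_ge0. Qed.

Lemma weight_lpnormE x : weight p x = expR (- (lpnorm p x `^ p)).
Proof. by rewrite lpnormXp. Qed.

Lemma weight_prodE x : weight p x = \prod_(i < n) weight1 p (x ord0 i).
Proof. by rewrite /weight /psum -sumrN expR_sum. Qed.

Lemma measurable_weight : measurable_fun [set: borel_rV R n] (@weight R n p).
Proof.
apply: measurableT_comp => //; apply: measurable_funN.
exact: measurable_psum.
Qed.

Lemma integral_prod_weight (g : 'I_n -> R -> R) :
  (forall i, measurable_fun [set: R] (g i)) -> (forall i t, 0 <= g i t) ->
  (\int[mu]_x ((\prod_(i < n) g i ((x : 'rV[R]_n) ord0 i)) * weight p x)%:E =
   \prod_(i < n) \int[lebesgue_measure]_t (g i t * weight1 p t)%:E)%E.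
Proof.
move=> mg g0.
rewrite -(ge0_integral_rV_measure_prod (f := fun i t => g i t * weight1 p t)).
- by apply: eq_integral => x _; rewrite weight_prodE big_split.
- by move=> i; apply: measurable_funM => //; exact: measurable_weight1.
- by move=> i t; rewrite mulr_ge0 ?weight1_ge0.
Qed.

Lemma integral_weight : (\int[mu]_x (weight p x)%:E = (Z ^+ n)%:E)%E.
Proof.
have := @integral_prod_weight (fun _ _ => 1) (fun _ => measurable_cst _) (fun _ _ => ler01).
under eq_integral do rewrite big1// mul1r.
move=> ->; under eq_bigr => i _ do under eq_integral do rewrite mul1r.
by rewrite weight_massE// prodEFin prodr_const card_ord.
Qed.

Lemma integral_weightZ (s : R) : 0 < s ->
  (\int[mu]_x (weight p (s *: (x : 'rV[R]_n)))%:E = (Z ^+ n / s ^+ n)%:E)%E.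
Proof.
move=> s0.
have := @ge0_integral_rV_measureZ R n s (fun x => (weight p x)%:E) s0.
rewrite integral_weight => h.
have {h} : ((s ^+ n)%:E * \int[mu]_x (weight p (s *: (x : 'rV[R]_n)))%:E = (Z ^+ n)%:E)%E.
  apply: h; last by move=> x; rewrite lee_fin weight_ge0.
  by apply/measurable_EFinP; exact: measurable_weight.
have sn0 : 0 < s ^+ n by rewrite exprn_gt0.
set I := (\int[mu]_x _)%E => h.
have {h} <- : ((s ^+ n)^-1%:E * ((s ^+ n)%:E * I) = (Z ^+ n / s ^+ n)%:E)%E.
  by rewrite h -EFinM mulrC.
by rewrite muleA -EFinM mulVf ?gt_eqF// mul1e.
Qed.

Lemma expRN_le_subr (y : R) : 0 <= y <= 2^-1 -> expR (- (2 * y)) <= 1 - y.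
Proof.
move=> /andP[y0 y1]; rewrite expRN -[leRHS]invrK lef_pV2 ?posrE ?expR_gt0//; last first.
  by rewrite invr_gt0; lra.
apply: le_trans (expR_ge1Dx (2 * y)); rewrite invf_ple ?posrE//; try lra.
rewrite -[leLHS]mul1r ler_pdivrMr; try lra.
by nra.
Qed.

(** The power is absorbed by a slight dilation. With [r = |x|_p] and [v = r^p / (4n)], the
    inequality [v <= e^v] gives [r^(2k) <= (4 nu)^(2k) exp (y r^p)] for [y = k / (2 n p)]; and
    [s^p = exp (- 2y) <= 1 - y], valid as [k <= n] forces [y <= 1/2], turns [exp (y r^p - r^p)] into
    at most [W(s x)]. Its integral costs only [s^(-n) = exp (k / p^2) <= e^k]. *)
Lemma integral_lpnorm_weight_le k : (0 < n)%N -> (k <= n)%N ->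
  (\int[mu]_x ((lpnorm p x) ^+ (2 * k) * weight p x)%:E <=
   ((16 * expR 1) ^+ k * (n%:R `^ p^-1) ^+ (2 * k) * Z ^+ n)%:E)%E.
Proof.
move=> n0 kn.
have nR0 : 0 < n%:R :> R by rewrite ltr0n.
pose y : R := k%:R / (2 * n%:R * p).
have knR : k%:R <= n%:R :> R by rewrite ler_nat.
have y01 : 0 <= y <= 2^-1.
  rewrite /y divr_ge0 ?mulr_ge0 ?(ltW p0)//=.
  rewrite ler_pdivrMr ?mulr_gt0// (_ : 2^-1 * _ = n%:R * p); last by field.
  by rewrite (le_trans knR)// ler_peMr// ltW.
pose s : R := expR (- (2 * y / p)).
have s0 : 0 < s by exact: expR_gt0.
have spE : s `^ p = expR (- (2 * y)).
  by rewrite /s -expRM; congr expR; rewrite mulNr divfK ?gt_eqF.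
pose nu : R := n%:R `^ p^-1.
have nu0 : 0 <= nu by exact: powR_ge0.
have ptw x : lpnorm p x ^+ (2 * k) * weight p x <= (4 * nu) ^+ (2 * k) * weight p (s *: x).
  rewrite /weight psumZ ?(ltW s0)// spE -(lpnormXp p1).
  set r := lpnorm p x; have r0 : 0 <= r by exact: lpnorm_ge0.
  pose v := r `^ p / (4 * n%:R).
  have v0 : 0 <= v by rewrite divr_ge0 ?powR_ge0 ?mulr_ge0.
  have rle : r <= 4 * nu * expR (v / p).
    have h : r `^ p <= 4 * n%:R * expR v.
      rewrite -[leLHS](_ : 4 * n%:R * v = _); last by rewrite mulrC divfK// gt_eqF// mulr_gt0.
      rewrite ler_wpM2l ?mulr_ge0//.
      by apply: le_trans (expR_ge1Dx v); rewrite lerDr.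
    have := @ge0_ler_powR R p^-1; rewrite invr_ge0 (ltW p0) => /(_ isT).
    move=> /(_ (r `^ p) (4 * n%:R * expR v)); rewrite !nnegrE powR_ge0.
    rewrite !mulr_ge0 ?expR_ge0// => /(_ isT isT h).
    rewrite -powRrM mulfV ?gt_eqF// powRr1// => /le_trans; apply.
    rewrite powRM ?mulr_ge0 ?expR_ge0// powRM// -expRM -/nu.
    rewrite ler_wpM2r ?expR_ge0// ler_wpM2r//.
    by rewrite ler1_powR ?ler1n// invf_le1.
  have := lerXn2r (2 * k) _ _ rle; rewrite !nnegrE r0 mulr_ge0 ?mulr_ge0 ?expR_ge0//.
  move=> /(_ isT isT); rewrite exprMn -expRM_natl => h.
  apply: (le_trans (ler_wpM2r (expR_ge0 _) h)).
  rewrite -mulrA -expRD ler_wpM2l ?exprn_ge0 ?mulr_ge0// ler_expR.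
  have -> : (2 * k)%:R * (v / p) = y * r `^ p.
    rewrite /v /y natrM; field.
    by rewrite !gt_eqF.
  have := expRN_le_subr y01; have : 0 <= r `^ p by exact: powR_ge0.
  set e := expR _; set w := r `^ p; nra.
apply: (@le_trans _ _ (\int[mu]_x (((4 * nu) ^+ (2 * k))%:E * (weight p (s *: (x : 'rV[R]_n)))%:E))%E).
  apply: ge0_le_integral => //.
  - by move=> x _; rewrite lee_fin mulr_ge0 ?exprn_ge0 ?lpnorm_ge0 ?weight_ge0.
  - apply/measurable_EFinP; apply: measurable_funM; last exact: measurable_weight.
    by apply: measurable_funX; exact: measurable_lpnorm.
  - apply: measurable_funeM; apply/measurable_EFinP.
    exact: (measurableT_comp measurable_weight (@measurable_rV_scale R n s)).
  - by move=> x _; rewrite -EFinM lee_fin.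
rewrite ge0_integralZl//; last 3 first.
- apply/measurable_EFinP.
  exact: (measurableT_comp measurable_weight (@measurable_rV_scale R n s)).
- by move=> x _; rewrite lee_fin weight_ge0.
- by rewrite lee_fin exprn_ge0// mulr_ge0.
rewrite integral_weightZ// -EFinM lee_fin.
have -> : (16 * expR 1) ^+ k * nu ^+ (2 * k) * Z ^+ n =
    (4 * nu) ^+ (2 * k) * (Z ^+ n * expR 1 ^+ k).
  rewrite !exprMn !(exprM _ 2) (_ : 4 ^+ 2 = 16 :> R); last by rewrite -natrX.
  by ring.
rewrite ler_wpM2l ?exprn_ge0 ?mulr_ge0// ler_wpM2l ?exprn_ge0 ?(ltW (weight_mass_gt0 p1))//.
rewrite /s -!expRM_natl -expRN ler_expR mulrN opprK mulr1.
have -> : n%:R * (2 * y / p) = k%:R / (p * p).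
  by rewrite /y; field; rewrite !gt_eqF.
by rewrite ler_pdivrMr ?mulr_gt0// ler_peMr// mulr_ege1.
Qed.

(** A Chernoff bound for small radii. Where [psum p x <= n/9], doubling [x] raises the exponent by
    at most [(2^p - 1) n/9 <= n/3], so [W(x) <= e^(n/3) W(2x)]. The region carries at most the
    fraction [(e^(1/3) / 2)^n <= 3/4] of the mass, and on the rest
    [|x|_p >= (n/9)^(1/p) >= n^(1/p) / 9]. *)
Lemma integral_lpnorm_weight_ge m : (0 < n)%N -> p <= 2 ->
  (((4^-1 * (n%:R `^ p^-1 / 9) ^+ (2 * m) * Z ^+ n)%:E) <=
    \int[mu]_x ((lpnorm p x) ^+ (2 * m) * weight p x)%:E)%E.
Proof.
move=> n0 p2.
have nR1 : 1 <= n%:R :> R by rewrite ler1n.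
pose a : R := (n%:R / 9) `^ p^-1.
have a0 : 0 <= a by exact: powR_ge0.
have aX : a `^ p = n%:R / 9 by rewrite -powRrM mulVf ?gt_eqF// powRr1// divr_ge0.
have ale : n%:R `^ p^-1 / 9 <= a.
  rewrite /a powRM// ?invr_ge0// ler_wpM2l ?powR_ge0//.
  by apply: ger1_powR; [apply/andP; split; lra|rewrite invf_le1].
pose A := a ^+ (2 * m); have A0 : 0 <= A by rewrite exprn_ge0.
pose E : R := expR (n%:R / 3).
have E0 : 0 <= E by exact: expR_ge0.
have ptw x : A * weight p x <=
    lpnorm p x ^+ (2 * m) * weight p x + A * E * weight p (2 *: x).
  have [ax|xa] := leP a (lpnorm p x).
    apply: (@le_trans _ _ (lpnorm p x ^+ (2 * m) * weight p x)).
      by rewrite ler_wpM2r ?weight_ge0// lerXn2r// nnegrE (le_trans a0).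
    by rewrite lerDl !mulr_ge0// weight_ge0.
  apply: (@le_trans _ _ (A * E * weight p (2 *: x))); last first.
    by rewrite lerDr mulr_ge0 ?weight_ge0// exprn_ge0// lpnorm_ge0.
  rewrite -mulrA ler_wpM2l// /E /weight psumZ// -expRD ler_expR.
  have h4 : 2 `^ p <= 4 :> R.
    apply: (@le_trans _ _ (2 `^ 2%:R)); first by rewrite ler_powR// ler1n.
    by rewrite powR_mulrn// -natrX.
  have : psum p x <= n%:R / 9.
    rewrite -aX -(lpnormXp p1) ge0_ler_powR ?(ltW p0)// ?nnegrE ?lpnorm_ge0//.
    exact: ltW.
  have := psum_ge0 p x; nra.
have mW := measurable_weight.
have mWs : measurable_fun [set: borel_rV R n] (fun x : borel_rV R n => weight p (2 *: (x : 'rV[R]_n))).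
  exact: (measurableT_comp measurable_weight (@measurable_rV_scale R n 2)).
have mL : measurable_fun [set: borel_rV R n]
    (fun x : borel_rV R n => lpnorm p (x : 'rV[R]_n) ^+ (2 * m) * weight p x).
  exact: (measurable_funM (measurable_funX _ (@measurable_lpnorm R n p)) mW).
have L0 x : 0 <= lpnorm p x ^+ (2 * m) * weight p x.
  by rewrite mulr_ge0 ?weight_ge0// exprn_ge0// lpnorm_ge0.
have main : ((A * Z ^+ n)%:E <=
    \int[mu]_x ((lpnorm p x) ^+ (2 * m) * weight p x)%:E +
    (A * E * (Z ^+ n / 2 ^+ n))%:E)%E.
  have h := ge0_integral_le_add mu mL mW mWs L0 weight_ge0
    (fun x => weight_ge0 (2 *: x)) A0 (mulr_ge0 A0 E0) ptw.
  rewrite EFinM (EFinM (A * E)) -integral_weight -(integral_weightZ (ltr0Sn R 1)).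
  exact: h.
have EZ : E / 2 ^+ n <= 3 / 4.
  have e13 : expR (3^-1) <= 3 / 2 :> R.
    have := expR_ge1Dx (- 3^-1 : R); rewrite expRN => h.
    rewrite -[leLHS]invrK invf_ple ?posrE ?invr_gt0 ?expR_gt0//.
    by apply: le_trans h; lra.
  rewrite /E expRM_natl -expr_div_n.
  apply: (@le_trans _ _ ((3 / 4) ^+ n)).
    by rewrite lerXn2r ?nnegrE ?divr_ge0 ?expR_ge0//; lra.
  rewrite -[leRHS]expr1; apply: ler_wiXn2l => //; lra.
have Zn0 : 0 <= Z ^+ n by rewrite exprn_ge0// ltW// weight_mass_gt0.
apply: (@le_trans _ _ ((A * Z ^+ n)%:E - (A * E * (Z ^+ n / 2 ^+ n))%:E)%E); last first.
  by rewrite leeBlDr.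
rewrite -EFinB lee_fin.
have -> : A * E * (Z ^+ n / 2 ^+ n) = (A * Z ^+ n) * (E / 2 ^+ n) by ring.
apply: (@le_trans _ _ (4^-1 * (A * Z ^+ n))).
  rewrite -mulrA ler_wpM2l ?invr_ge0// ler_wpM2r//.
  by rewrite lerXn2r ?nnegrE ?divr_ge0 ?powR_ge0.
have AZ0 : 0 <= A * Z ^+ n by rewrite mulr_ge0.
by move: (A * Z ^+ n) (E / _) AZ0 EZ => u v u0 v1; nra.
Qed.

End weight_theory.

(** * Upper bound for moments of the Euclidean norm against the weight *)

Section truncated_exponential.
Context (R : realType).
Implicit Types (a b x : R).

(* The truncation keeps E texp (x Y^2) finite when Y has density exp (- |t|^p), p < 2,
   and texp is still submultiplicative. *)
Definition texp (m : nat) a : R := \sum_(0 <= j < m.+1) a ^+ j / j`!%:R.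

Lemma texp_ge0 m a : 0 <= a -> 0 <= texp m a.
Proof. by move=> a0; apply: sumr_ge0 => j _; rewrite divr_ge0// exprn_ge0. Qed.

Lemma texp0 m : texp m 0 = 1.
Proof.
rewrite /texp big_nat_recl// expr0 fact0 divr1 big1_seq ?addr0// => j _.
by rewrite expr0n mul0r.
Qed.

Lemma exprn_le_texp m a : 0 <= a -> a ^+ m <= m`!%:R * texp m a.
Proof.
move=> a0; rewrite mulrC -ler_pdivrMr ?ltr0n ?fact_gt0//.
rewrite /texp big_nat_recr//= lerDr sumr_ge0// => j _.
by rewrite divr_ge0// exprn_ge0.
Qed.

(** By the binomial formula the left side collects the terms [a^i b^j / (i! j!)] with [i + j <= m];
    the product contains these and further nonnegative ones. *)
Lemma texpD m a b : 0 <= a -> 0 <= b -> texp m (a + b) <= texp m a * texp m b.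
Proof.
move=> a0 b0; pose F i j := a ^+ i / i`!%:R * (b ^+ j / j`!%:R).
have F0 i j : 0 <= F i j by rewrite mulr_ge0// divr_ge0// exprn_ge0.
have -> : texp m (a + b) = \sum_(0 <= k < m.+1) \sum_(0 <= j < m.+1 | (j <= k)%N) F (k - j)%N j.
  apply: eq_big_nat => k /andP[_ km].
  have -> : \sum_(0 <= j < m.+1 | (j <= k)%N) F (k - j)%N j = \sum_(0 <= j < k.+1) F (k - j)%N j.
    by rewrite (big_nat_widen 0 k.+1 m.+1)//; apply: eq_bigl => j; rewrite ltnS.
  rewrite exprDn mulr_suml big_mkord; apply: eq_bigr => j _.
  have jk : (j <= k)%N by rewrite -ltnS.
  rewrite /F -mulr_natr -(bin_fact jk) !natrM.
  have f0 i : i`!%:R != 0 :> R by rewrite pnatr_eq0 -lt0n fact_gt0.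
  have c0 : 'C(k, j)%:R != 0 :> R by rewrite pnatr_eq0 -lt0n bin_gt0.
  by field; rewrite c0 !f0.
rewrite (exchange_big_dep_nat xpredT)//=.
rewrite {1}/texp [leRHS]mulrC mulr_suml; apply: ler_sum_nat => j /andP[_ jm].
rewrite mulrC.
have -> : \sum_(0 <= k < m.+1 | (j <= k)%N) F (k - j)%N j =
    \sum_(0 <= i < m.+1 - j) F i j.
  rewrite -[RHS](_ : \sum_(0 + j <= k < m.+1) F (k - j)%N j = _); last first.
    by rewrite big_addn; apply: eq_bigr => i _; rewrite addnK.
  rewrite add0n (big_nat_widenl j 0)//.
apply: (@le_trans _ _ (\sum_(0 <= i < m.+1) F i j)).
  rewrite [leRHS](@big_cat_nat _ _ _ (m.+1 - j)) ?leq_subr//=.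
  by rewrite lerDl sumr_ge0.
by rewrite /texp mulr_suml.
Qed.

Lemma texp_sum m n (y : 'I_n -> R) : (forall i, 0 <= y i) ->
  texp m (\sum_(i < n) y i) <= \prod_(i < n) texp m (y i).
Proof.
move=> y0; suff : 0 <= \sum_(i < n) y i /\ texp m (\sum_(i < n) y i) <= \prod_(i < n) texp m (y i) by case.
elim/big_ind2 : _ => // [|a1 b1 a2 b2 [a10 h1] [a20 h2]].
  by rewrite texp0.
split; first exact: addr_ge0.
apply: le_trans (texpD m a10 a20) _.
by rewrite ler_pM// texp_ge0.
Qed.

Lemma measurable_texp m : measurable_fun [set: R] (texp m).
Proof.
by apply: measurable_sum => j; apply: measurable_funM => //; exact: exprn_measurable.
Qed.

End truncated_exponential.

Section even_moments.
Context (R : realType) (p : R).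
Hypothesis p1 : 1 <= p.
Let Z := weight_mass p.

Lemma expR1_le4 : expR 1 <= 4 :> R.
Proof.
have h := expR_ge1Dx (- 2^-1 : R).
have e0 := expR_gt0 (2^-1 : R).
have : expR (- 2^-1) * expR (2^-1) = 1 :> R by rewrite -expRD addNr expR0.
have -> : expR 1 = expR (2^-1) * expR (2^-1) :> R.
  by rewrite -expRD; congr expR; lra.
by move: (expR _) (expR _) e0 h => u v u0 h; nra.
Qed.

(** Expresses the bound relative to the mass, as needed for a product over [n] coordinates:
    [4 e <= 32 Z] follows from [Z >= 2/e] and [e <= 4]. *)
Lemma integral_even_weight1 j :
  (\int[lebesgue_measure]_t (t ^+ (2 * j) * weight1 p t)%:E <=
   (32 * (2 * j)`!%:R * 4 ^+ j * Z)%:E)%E.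
Proof.
apply: (le_trans (integral_weight1_even j p1)); rewrite lee_fin.
have Zge := weight_mass_ge p1; rewrite -/Z in Zge.
have : 4 * expR 1 <= 32 * Z.
  have e1 : expR (-1) * expR 1 = 1 :> R by rewrite -expRD addNr expR0.
  have := expR1_le4; have := expR_gt0 (1 : R); have := expR_gt0 (- 1 : R).
  by move: (expR 1) (expR (-1)) e1 Zge => u v e1 Zge v0 u0 u4; nra.
move=> h; have -> : 32 * (2 * j)`!%:R * 4 ^+ j * Z = 32 * Z * (2 * j)`!%:R * 4 ^+ j :> R by ring.
by rewrite ler_wpM2r ?exprn_ge0// ler_wpM2r.
Qed.

Lemma ffact_leq_exp a b : (a ^_ b <= a ^ b)%N.
Proof.
elim: b => [|b IH]; first by rewrite ffactn0 expn0.
by rewrite ffactnSr expnSr leq_mul// leq_subr.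
Qed.

Lemma fact2_le j : ((2 * j)`! <= (2 * j) ^ j * j`!)%N.
Proof.
have h : (j <= 2 * j)%N by rewrite mul2n -addnn leq_addl.
rewrite -(ffact_fact h) {2}mul2n -addnn addnK.
by rewrite leq_mul2r ffact_leq_exp orbT.
Qed.

Lemma sum_half_le2 m : \sum_(0 <= i < m) (2^-1 : R) ^+ i <= 2.
Proof.
suff -> : \sum_(0 <= i < m) (2^-1 : R) ^+ i = 2 - 2 * 2^-1 ^+ m.
  by rewrite gerDl oppr_le0 mulr_ge0// exprn_ge0.
elim: m => [|m IH]; first by rewrite big_nil expr0 mulr1 subrr.
by rewrite big_nat_recr//= IH exprS; field.
Qed.

(** The excess over the mass must be of order [1/m], because the bound is later raised to the power
    [n]. With parameter [1/(512 m)] the term of degree [j] is at most [32 Z (j / (64 m))^j], and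
    [j <= m] makes these terms decay geometrically. *)
Lemma integral_texp_weight1 m : (0 < m)%N ->
  (\int[lebesgue_measure]_t (texp m (((8 * 64) * m%:R)^-1 * t ^+ 2) * weight1 p t)%:E <=
   (Z * (1 + m%:R^-1))%:E)%E.
Proof.
move=> m0; have mR : 0 < m%:R :> R by rewrite ltr0n.
pose x : R := ((8 * 64) * m%:R)^-1; rewrite -/x.
have x0 : 0 < x by rewrite invr_gt0 mulr_gt0.
have Z0 : 0 < Z by exact: weight_mass_gt0.
have w0 t : 0 <= weight1 p t by exact: weight1_ge0.
have te j t : 0 <= t ^+ (2 * j) * weight1 p t.
  by rewrite mulr_ge0// exprM exprn_ge0// sqr_ge0.
have mte j : measurable_fun [set: R] (fun t : R => (t ^+ (2 * j) * weight1 p t)%:E).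
  apply/measurable_EFinP; apply: measurable_funM; last exact: measurable_weight1.
  exact: exprn_measurable.
have c0 j : 0 <= x ^+ j / j`!%:R by rewrite divr_ge0// exprn_ge0// ltW.
have teE t : (texp m (x * t ^+ 2) * weight1 p t)%:E =
    (\sum_(0 <= j < m.+1) (x ^+ j / j`!%:R)%:E * (t ^+ (2 * j) * weight1 p t)%:E)%E.
  rewrite /texp mulr_suml -sumEFin; apply: eq_bigr => j _.
  by rewrite -EFinM exprMn -exprM; congr EFin; ring.
under eq_integral do rewrite teE.
rewrite ge0_integral_sum//; last 2 first.
- by move=> j; apply: measurable_funeM; exact: mte.
- by move=> j t _; rewrite -EFinM lee_fin mulr_ge0.
have -> : (\sum_(0 <= j < m.+1) \int[lebesgue_measure]_t
      ((x ^+ j / j`!%:R)%:E * (t ^+ (2 * j) * weight1 p t)%:E) =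
    \sum_(0 <= j < m.+1) (x ^+ j / j`!%:R)%:E *
      \int[lebesgue_measure]_t (t ^+ (2 * j) * weight1 p t)%:E)%E.
  apply: eq_bigr => j _; rewrite ge0_integralZl ?lee_fin//; first exact: mte.
  by move=> t _; rewrite lee_fin.
rewrite big_nat_recl// expr0 fact0 divr1 mul1e muln0.
under eq_integral do rewrite expr0 mul1r.
rewrite weight_massE// mulrDr mulr1 EFinD leeD2l//.
have term i : (0 <= i < m)%N ->
    ((x ^+ i.+1 / i.+1`!%:R)%:E * \int[lebesgue_measure]_t (t ^+ (2 * i.+1) * weight1 p t)%:E <=
     (Z / (2 * m%:R) * 2^-1 ^+ i)%:E)%E.
  move=> /andP[_ im].
  apply: (le_trans (lee_wpmul2l _ (integral_even_weight1 i.+1))); first by rewrite lee_fin.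
  rewrite -EFinM lee_fin.
  set j := i.+1.
  have jm : j%:R <= m%:R :> R by rewrite ler_nat.
  have f0 : 0 < j`!%:R :> R by rewrite ltr0n fact_gt0.
  have h1 : (2 * j)`!%:R / j`!%:R <= (2 * j%:R) ^+ j :> R.
    rewrite ler_pdivrMr// -natrM -natrX -natrM ler_nat.
    exact: fact2_le.
  have -> : x ^+ j / j`!%:R * (32 * (2 * j)`!%:R * 4 ^+ j * Z) =
      32 * Z * (x * 4) ^+ j * ((2 * j)`!%:R / j`!%:R).
    by rewrite exprMn; ring.
  apply: (@le_trans _ _ (32 * Z * (x * 4) ^+ j * (2 * j%:R) ^+ j)).
    by rewrite ler_wpM2l// !mulr_ge0 ?exprn_ge0 ?mulr_ge0 ?(ltW Z0) ?(ltW x0).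
  have -> : 32 * Z * (x * 4) ^+ j * (2 * j%:R) ^+ j = 32 * Z * (j%:R / (64 * m%:R)) ^+ j.
    rewrite -mulrA -exprMn; congr (_ * _ ^+ _); rewrite /x.
    by field; rewrite gt_eqF.
  have h2 : j%:R / (64 * m%:R) <= 64^-1 :> R.
    by rewrite ler_pdivrMr ?mulr_gt0// mulKf.
  have h3 : (j%:R / (64 * m%:R)) ^+ i <= 64^-1 ^+ i :> R.
    by rewrite lerXn2r ?nnegrE// divr_ge0// mulr_ge0.
  have h4 : j%:R * 64^-1 ^+ i <= 2^-1 ^+ i :> R.
    have : (j <= 2 ^ i)%N by rewrite ltn_expl.
    rewrite -(ler_nat R) natrX => h.
    apply: (@le_trans _ _ (2 ^+ i * 64^-1 ^+ i)).
      by rewrite ler_wpM2r// exprn_ge0.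
    by rewrite -exprMn lerXn2r ?nnegrE//; lra.
  (* One factor keeps its [1/m], which is the required gain; only the other [i = j - 1] factors are
     bounded by 1/64. *)
  have -> : (j%:R / (64 * m%:R)) ^+ j = (j%:R / (64 * m%:R)) ^+ i * (j%:R / (64 * m%:R)) :> R.
    exact: exprSr.
  rewrite (mulrA (32 * Z)).
  apply: (@le_trans _ _ (32 * Z * (64^-1 ^+ i) * (j%:R / (64 * m%:R)))).
        by rewrite ler_wpM2r ?divr_ge0 ?mulr_ge0// ler_wpM2l ?mulr_ge0// ltW.
  have -> : 32 * Z * 64^-1 ^+ i * (j%:R / (64 * m%:R)) = Z / (2 * m%:R) * (j%:R * 64^-1 ^+ i).
    by field; rewrite gt_eqF.
  by rewrite ler_wpM2l// divr_ge0 ?mulr_ge0// ltW.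
apply: (@le_trans _ _ (\sum_(0 <= i < m) (Z / (2 * m%:R) * 2^-1 ^+ i)%:E)%E).
  rewrite big_seq_cond [leRHS]big_seq_cond; apply: lee_sum => i; rewrite andbT mem_index_iota.
  exact: term.
rewrite sumEFin lee_fin -mulr_sumr.
apply: (@le_trans _ _ (Z / (2 * m%:R) * 2)).
  by rewrite ler_wpM2l ?sum_half_le2// divr_ge0 ?mulr_ge0// ltW.
by rewrite le_eqVlt; apply/orP; left; apply/eqP; field; rewrite gt_eqF.
Qed.

(** The power is dominated by [m! x^(-m) texp m (x |y|^2)], and submultiplicativity of [texp]
    factors the integral. The two conditions pin [m] to the order [sqrt n]: [n <= m^2] gives
    [(1 + 1/m)^n <= e^m], and [m^2 <= 16 n] gives [m! x^(-m) <= (512 m^2)^m <= (512 * 16 n)^m]. *)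
Lemma integral_sqrnorm_weight n m : (0 < m)%N -> (n <= m ^ 2)%N -> (m ^ 2 <= 16 * n)%N ->
  (\int[rV_measure R n]_x ((dot x x) ^+ m * weight p (x : 'rV[R]_n))%:E <=
   (((8 * 64) * 64 * n%:R) ^+ m * Z ^+ n)%:E)%E.
Proof.
move=> m0 nm mn; have mR : 0 < m%:R :> R by rewrite ltr0n.
have Z0 : 0 < Z by exact: weight_mass_gt0.
pose x : R := ((8 * 64) * m%:R)^-1.
have x0 : 0 < x by rewrite invr_gt0 mulr_gt0.
pose C : R := m`!%:R / x ^+ m.
have C0 : 0 <= C by rewrite divr_ge0// exprn_ge0// ltW.
have mt : measurable_fun [set: R] (fun t : R => texp m (x * t ^+ 2)).
  apply: (measurableT_comp (measurable_texp m)).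
  by apply: measurable_funM => //; exact: exprn_measurable.
have t0 (t : R) : 0 <= texp m (x * t ^+ 2).
  by rewrite texp_ge0// mulr_ge0 ?sqr_ge0// ltW.
have mprod : measurable_fun [set: borel_rV R n] (fun y : borel_rV R n =>
    (\prod_(i < n) texp m (x * (y : 'rV[R]_n) ord0 i ^+ 2)) * weight p (y : 'rV[R]_n)).
  apply: measurable_funM; last exact: measurable_weight.
  apply: measurable_prod => i _.
  exact: (measurableT_comp mt (@measurable_coord R n i)).
have prod0 (y : 'rV[R]_n) :
    0 <= (\prod_(i < n) texp m (x * y ord0 i ^+ 2)) * weight p y.
  by rewrite mulr_ge0 ?weight_ge0// prodr_ge0.
apply: (@le_trans _ _ (\int[rV_measure R n]_y (C%:E *
    ((\prod_(i < n) texp m (x * (y : 'rV[R]_n) ord0 i ^+ 2)) * weight p (y : 'rV[R]_n))%:E))%E).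
  apply: ge0_le_integral => //.
  - move=> y _; rewrite lee_fin mulr_ge0 ?weight_ge0// exprn_ge0//.
    by rewrite /dot sumr_ge0// => i _; rewrite -expr2 sqr_ge0.
  - apply/measurable_EFinP; apply: measurable_funM; last exact: measurable_weight.
    apply: measurable_funX.
    by apply: measurable_dot; exact: measurable_id.
  - by apply: measurable_funeM; exact/measurable_EFinP.
  move=> y _; rewrite -EFinM lee_fin mulrA ler_wpM2r ?weight_ge0//.
  have y0 i : 0 <= x * (y : 'rV[R]_n) ord0 i ^+ 2 by rewrite mulr_ge0 ?sqr_ge0// ltW.
  apply: (@le_trans _ _ (C * texp m (\sum_(i < n) x * (y : 'rV[R]_n) ord0 i ^+ 2))); last first.
    by rewrite ler_wpM2l// texp_sum.
  rewrite -mulr_sumr.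
  have -> : \sum_(i < n) (y : 'rV[R]_n) ord0 i ^+ 2 = dot (y : 'rV[R]_n) y.
    by apply: eq_bigr => i _; rewrite expr2.
  have d0 : 0 <= dot (y : 'rV[R]_n) y.
    by rewrite /dot sumr_ge0// => i _; rewrite -expr2 sqr_ge0.
  have := @exprn_le_texp R m (x * dot (y : 'rV[R]_n) y) (mulr_ge0 (ltW x0) d0).
  by rewrite exprMn mulrC -ler_pdivlMr ?exprn_gt0// mulrAC.
rewrite ge0_integralZl//; last 2 first.
- exact/measurable_EFinP.
- by move=> y _; rewrite lee_fin.
rewrite (@integral_prod_weight R n p (fun _ t => texp m (x * t ^+ 2)))//.
apply: (@le_trans _ _ (C%:E * \prod_(i < n) (Z * (1 + m%:R^-1))%:E)%E).
  rewrite lee_wpmul2l// !big_const; elim: #|_| => //= k IH.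
  apply: lee_pmul => //; last exact: integral_texp_weight1.
    by apply: integral_ge0 => t _; rewrite lee_fin mulr_ge0 ?weight1_ge0.
  elim: k {IH} => //= k IH; apply: mule_ge0 => //.
  by apply: integral_ge0 => t _; rewrite lee_fin mulr_ge0 ?weight1_ge0.
rewrite prodEFin prodr_const card_ord -EFinM lee_fin.
rewrite exprMn mulrA mulrAC ler_wpM2r ?exprn_ge0 ?(ltW Z0)//.
have h1 : (1 + m%:R^-1) ^+ n <= 4 ^+ m :> R.
  apply: (@le_trans _ _ (expR (n%:R * m%:R^-1))).
    by rewrite expRM_natl lerXn2r ?nnegrE ?addr_ge0 ?expR_ge0 ?invr_ge0// expR_ge1Dx.
  apply: (@le_trans _ _ (expR (m%:R * 1))).
    rewrite ler_expR mulr1 ler_pdivrMr// -natrM ler_nat.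
    by rewrite mulnn.
  by rewrite expRM_natl lerXn2r ?nnegrE ?expR_ge0// expR1_le4.
have h2 : C <= ((8 * 64) * m%:R ^+ 2) ^+ m.
  have -> : C = m`!%:R * ((8 * 64) * m%:R) ^+ m by rewrite /C /x exprVn invrK.
  have -> : ((8 * 64) * m%:R ^+ 2) ^+ m = m%:R ^+ m * ((8 * 64) * m%:R) ^+ m :> R.
    by rewrite -exprMn; congr (_ ^+ _); ring.
  rewrite ler_wpM2r ?exprn_ge0 ?mulr_ge0//.
  rewrite -natrX ler_nat -ffactnn.
  exact: ffact_leq_exp.
have h3 : (8 * 64) * m%:R ^+ 2 * 4 <= (8 * 64) * 64 * n%:R :> R.
  have : (m ^ 2)%:R <= (16 * n)%:R :> R by rewrite ler_nat.
  by rewrite natrM natrX => h; lra.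
apply: (@le_trans _ _ (((8 * 64) * m%:R ^+ 2) ^+ m * 4 ^+ m)).
  by rewrite ler_pM// exprn_ge0// addr_ge0.
by rewrite -exprMn lerXn2r ?nnegrE ?mulr_ge0 ?exprn_ge0.
Qed.

End even_moments.

(** * Lower bound for even moments of a linear form against the weight *)

Section elementary.
Context (R : realFieldType).
Implicit Types (s u a b : R).

(** The first two terms of the binomial expansion, in which odd powers of [u] cancel; the
    coefficient of the second is twice the binomial coefficient of [2k+2] over 2, that is
    [2 (k+1) (2k+1)]. *)
Lemma symmetric_powerD_ge s u k :
  2 * s ^+ (2 * k.+1) + 2 * (k.+1%:R * (2 * k.+1%:R - 1)) * (u ^+ 2 * s ^+ (2 * k)) <=
  (s + u) ^+ (2 * k.+1) + (s - u) ^+ (2 * k.+1).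
Proof.
pose P i := (s + u) ^+ (2 * i) + (s - u) ^+ (2 * i).
pose Q i := s * u * ((s + u) ^+ (2 * i) - (s - u) ^+ (2 * i)).
have PS i : P i.+1 = (s ^+ 2 + u ^+ 2) * P i + 2 * Q i.
  by rewrite /P /Q mulnS !exprD; ring.
have QS i : Q i.+1 = (s ^+ 2 + u ^+ 2) * Q i + 2 * (s ^+ 2 * u ^+ 2) * P i.
  by rewrite /P /Q mulnS !exprD; ring.
rewrite !(exprM s 2) -/(P k.+1).
(* The recursion couples the even part [P] with the odd part [Q], so the induction also carries the
   leading term of [Q]. *)
suff : 2 * (s ^+ 2) ^+ k.+1 + 2 * (k.+1%:R * (2 * k.+1%:R - 1)) * (u ^+ 2 * (s ^+ 2) ^+ k)
    <= P k.+1 /\ 4 * k.+1%:R * ((s ^+ 2) ^+ k.+1 * u ^+ 2) <= Q k.+1 by case.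
elim: k => [|k [IH1 IH2]].
  by rewrite /P /Q muln1 !expr0; split; rewrite le_eqVlt; apply/orP; left; apply/eqP; ring.
rewrite (PS k.+1) (QS k.+1); move: IH1 IH2.
rewrite -[k.+2%:R]natr1 -[k.+1%:R]natr1 !(exprS (s ^+ 2)).
have := exprn_ge0 k (sqr_ge0 s); move: ((s ^+ 2) ^+ k) (k%:R) (ler0n R k) => w i i0 w0.
have := sqr_ge0 s; have := sqr_ge0 u; move: (s ^+ 2) (u ^+ 2) => a b b0 a0 h1 h2.
move: (P k.+1) (Q k.+1) h1 h2 => p q h1 h2.
have aw0 : 0 <= a * w by rewrite mulr_ge0.
have abw : 0 <= b * (a * w) by rewrite mulr_ge0.
have c0 : 0 <= 2 * ((i + 1) * (2 * (i + 1) - 1)) * (b * w) * b.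
  by rewrite !mulr_ge0//; lra.
have d0 : 0 <= 2 * ((i + 1) * (2 * (i + 1) - 1)) * (b * w) * a * b.
  by rewrite !mulr_ge0//; lra.
have h1a := ler_wpM2l a0 h1; have h1b := ler_wpM2l b0 h1.
have h2a := ler_wpM2l a0 h2.
have h2b : 0 <= b * q.
  by apply: mulr_ge0 => //; apply: le_trans h2; rewrite !mulr_ge0//; lra.
have h1ab := ler_wpM2l (mulr_ge0 a0 b0) h1.
by split; lra.
Qed.

Lemma exprS_diff_le a b k : 0 <= a -> a <= b ->
  b ^+ k.+1 <= a ^+ k.+1 + k.+1%:R * (b - a) * b ^+ k.
Proof.
move=> a0 ab; elim: k => [|k IH]; first by rewrite expr0 !expr1; lra.
have b0 : 0 <= b by exact: le_trans ab.
have h := ler_wpM2l b0 IH.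
have h2 : a ^+ k.+1 <= b ^+ k.+1 by rewrite lerXn2r.
have h3 : (b - a) * a ^+ k.+1 <= (b - a) * b ^+ k.+1 by rewrite ler_wpM2l// subr_ge0.
rewrite -[k.+2%:R]natr1 exprS (exprS a k.+1).
have e : b * (k.+1%:R * (b - a) * b ^+ k) = k.+1%:R * (b - a) * b ^+ k.+1.
  by rewrite (exprS b k); ring.
move: h; rewrite mulrDr e => h.
move: (b ^+ k.+1) (a ^+ k.+1) (k.+1%:R) h h3 => x y z h h3.
nra.
Qed.

(* A lower bound for the k-th elementary symmetric function of reals in [0, M] whose
   sum is V, set up to satisfy the recursion in [lacunary_boundD]. *)
Definition lacunary_bound (M : R) (k : nat) (V : R) : R :=
  Num.max (V - k.-1%:R * M) 0 ^+ k / k`!%:R.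

Lemma lacunary_bound_ge0 M k V : 0 <= lacunary_bound M k V.
Proof. by rewrite divr_ge0// exprn_ge0// le_max lexx orbT. Qed.

(** Mirrors the identity by which adjoining a variable [y] adds [y e_k] to [e_(k+1)]. The increment
    of the power [k+1] is at most [(k+1) y B^k] by convexity, and [B <= C] for [k > 0] because the
    subtracted multiple of [M] drops by one while [y <= M]. *)
Lemma lacunary_boundD M k V y : 0 <= y -> y <= M ->
  lacunary_bound M k.+1 (V + y) <=
  lacunary_bound M k.+1 V + y * lacunary_bound M k V.
Proof.
move=> y0 yM; rewrite /lacunary_bound/=.
set A := Num.max (V - k%:R * M) 0; set B := Num.max (V + y - k%:R * M) 0.
set C := Num.max _ 0.
have A0 : 0 <= A by rewrite le_max lexx orbT.
have AB : A <= B by rewrite /A /B ge_max !le_max lexx orbT andbT; apply/orP; left; lra.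
have hA : V - k%:R * M <= A by rewrite le_max lexx.
have BA : B - A <= y.
  suff : B <= A + y by lra.
  by rewrite ge_max; apply/andP; split; lra.
have B0 := le_trans A0 AB.
have BC : B ^+ k <= C ^+ k.
  (* For [i = 0] the predecessor is also 0 and the bases compare the wrong way, but both powers are
     1. *)
  have gen i : Num.max (V + y - i%:R * M) 0 ^+ i <= Num.max (V - i.-1%:R * M) 0 ^+ i.
    case: i => [|i]; first by rewrite !expr0.
    apply: lerXn2r; rewrite ?nnegrE.
    - by rewrite le_max lexx orbT.
    - by rewrite le_max lexx orbT.
    rewrite ge_max !le_max lexx orbT andbT.
    by apply/orP; left; rewrite -[i.+1%:R]natr1/=; lra.
  exact: gen.
have f0 i : 0 < i`!%:R :> R by rewrite ltr0n fact_gt0.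
rewrite ler_pdivrMr// mulrDl divfK ?gt_eqF// factS natrM.
have -> : y * (C ^+ k / k`!%:R) * (k.+1%:R * k`!%:R) = k.+1%:R * (y * C ^+ k).
  by field; rewrite gt_eqF.
apply: (le_trans (exprS_diff_le k A0 AB)).
rewrite lerD2l -mulrA ler_wpM2l//.
by rewrite ler_pM ?subr_ge0// exprn_ge0.
Qed.

Lemma pronic_ge0 k : 0 <= k.+1%:R * (2 * k.+1%:R - 1) :> R.
Proof. by rewrite mulr_ge0// subr_ge0 -natrM ler1n. Qed.

Lemma weighted_symmetrization (w1 w t2 a2 c s1 s2 s3 s4 : R) :
  (2 * s1 + 2 * c * (a2 * t2 * s4)) * (w1 * w) <= (s2 + s3) * (w1 * w) ->
  2 * w1 * (s1 * w) + 2 * w1 * (c * a2 * t2) * (s4 * w) <=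
  s2 * (w1 * w) + s3 * (w1 * w).
Proof. by move=> h; lra. Qed.

Lemma lacunary_assembly (zn z f1 f c c2 a2 x y l : R) : f1 = 2 * c * f ->
  zn * z * f1 * x <= zn * z * f1 * (y + c2 / 2 * a2 * l) ->
  2 * (zn * z * (f1 * x)) <=
  2 * (zn * (f1 * y)) * z + 2 * (c * a2 * (zn * (f * l))) * (c2 * z).
Proof.
move=> f1E h.
have -> : 2 * (zn * (f1 * y)) * z + 2 * (c * a2 * (zn * (f * l))) * (c2 * z) =
    2 * (zn * z * f1 * (y + c2 / 2 * a2 * l)) by rewrite f1E; field.
by lra.
Qed.

End elementary.

Lemma double_ge0_integral_sym (R : realType) (G : R -> \bar R) :
  measurable_fun [set: R] G -> (forall t, 0 <= G t)%E ->
  (2%:E * \int[lebesgue_measure]_t G t = \int[lebesgue_measure]_t (G t + G (- t)%R))%E.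
Proof.
move=> mG G0.
have mGN : measurable_fun [set: R] (fun t : R => G (- t)%R).
  by apply: measurableT_comp => //; exact: oppr_measurable.
rewrite ge0_integralD// (ge0_integral_lebesgueN mG G0).
have -> : 2%:E = (1 + 1)%E :> \bar R by rewrite -EFinD.
by rewrite ge0_muleDl ?lee_fin ?ler01// mul1e.
Qed.

Section even_moment_lower.
Context (R : realType) (p : R).
Hypothesis p1 : 1 <= p.
Let Z := weight_mass p.

Lemma dot_row_mx n (t : R) (y : 'rV[R]_n) (theta : 'rV[R]_n.+1) :
  dot (row_mx (t%:M : 'rV_1) y : 'rV_n.+1) theta =
  dot y (\row_j theta ord0 (lift ord0 j)) + theta ord0 ord0 * t.
Proof.
rewrite /dot big_ord_recl row_mx_scalarE unlift_none addrC mulrC; congr (_ + _).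
by apply: eq_bigr => j _; rewrite row_mx_scalarE liftK mxE.
Qed.

Lemma weight_row_mx n (t : R) (y : 'rV[R]_n) :
  weight p (row_mx (t%:M : 'rV_1) y : 'rV_n.+1) = weight1 p t * weight p y.
Proof.
rewrite !weight_prodE big_ord_recl row_mx_scalarE unlift_none; congr (_ * _).
by apply: eq_bigr => j _; rewrite row_mx_scalarE liftK.
Qed.

Lemma measurable_dot_weight n (theta : 'rV[R]_n) k :
  measurable_fun [set: borel_rV R n]
    (fun x : borel_rV R n => (dot (x : 'rV[R]_n) theta ^+ (2 * k) * weight p (x : 'rV[R]_n))%:E).
Proof.
apply/measurable_EFinP; apply: measurable_funM; last exact: measurable_weight.
apply: measurable_funX; apply: measurable_dot; first exact: measurable_id.
exact: measurable_cst.
Qed.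

Lemma even_power_ge0 (s : R) k : 0 <= s ^+ (2 * k).
Proof. by rewrite exprM exprn_ge0// sqr_ge0. Qed.

(** Lower bound for the normalised second moment of a coordinate: the second moment is at least
    [1/(8e)] and the mass at most [4e], with a factor 2 to spare. *)
Let c2 : R := (64 * expR 1 ^+ 2)^-1.

Lemma sqr_weight1_mass :
  ((c2 * Z)%:E <= \int[lebesgue_measure]_t (t ^+ 2 * weight1 p t)%:E)%E.
Proof.
apply: le_trans (integral_sqr_weight1_ge (le_trans ler01 p1)); rewrite lee_fin.
have Zle : Z <= 4 * expR 1 by exact: weight_mass_le.
have e0 := expR_gt0 (1 : R).
apply: (@le_trans _ _ (c2 * (4 * expR 1))).
  by rewrite ler_wpM2l// /c2 invr_ge0 mulr_ge0// exprn_ge0// ltW.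
rewrite expRN /c2 -subr_ge0.
have -> : 8^-1 * (expR 1)^-1 - (64 * expR 1 ^+ 2)^-1 * (4 * expR 1) = (16 * expR 1)^-1 :> R.
  by field; rewrite gt_eqF.
by rewrite invr_ge0 mulr_ge0// ltW.
Qed.

(** In the expansion of the power, odd monomials integrate to 0 and all others are nonnegative.
    Those with each coordinate used zero or two times have coefficient [(2k)! / 2^k] and sum to
    [(2k)!] times the [k]-th elementary symmetric function of the [theta_i^2 E x_i^2 / 2]; this
    explains [c2 / 2]. The induction on [n] avoids writing that function. *)
Lemma integral_dot_weight_ge n (theta : 'rV[R]_n) (M : R) k :
  0 <= M -> (forall i, theta ord0 i ^+ 2 <= M) ->
  ((Z ^+ n * ((2 * k)`!%:R * lacunary_bound (c2 / 2 * M) k (c2 / 2 * dot theta theta)))%:E <=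
   \int[rV_measure R n]_x (dot (x : 'rV[R]_n) theta ^+ (2 * k) * weight p (x : 'rV[R]_n))%:E)%E.
Proof.
move=> M0.
have c20 : 0 <= c2 / 2.
  by rewrite divr_ge0// invr_ge0 mulr_ge0// exprn_ge0// expR_ge0.
have Z0 : 0 < Z by exact: weight_mass_gt0.
elim: n theta k => [|n IHn] theta k thetaM.
  rewrite /= integral_dirac//; last exact: measurable_dot_weight.
  rewrite diracT mul1e lee_fin expr0 mul1r /dot !big_ord0 mulr0.
  rewrite /weight /psum big_ord0 oppr0 expR0 mulr1 /lacunary_bound.
  case: k => [|k].
    by rewrite !expr0 muln0 fact0 mul1r divr1.
  rewrite sub0r max_r; last by rewrite oppr_le0 mulr_ge0// mulr_ge0.
  by rewrite !expr0n/= mul0r mulr0.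
case: k => [|k].
  rewrite /lacunary_bound muln0 !fact0 expr0 divr1 !mulr1.
  rewrite -integral_weight// le_eqVlt; apply/orP; left; apply/eqP.
  by apply: eq_integral => x _; rewrite expr0 mul1r.
pose th : 'rV[R]_n := \row_j theta ord0 (lift ord0 j).
pose a : R := theta ord0 ord0.
have thM i : th ord0 i ^+ 2 <= M by rewrite mxE.
have dotE : dot theta theta = dot th th + a ^+ 2.
  rewrite /dot big_ord_recl addrC -expr2; congr (_ + _).
  by apply: eq_bigr => i _; rewrite !mxE.
pose A i := (2 * i)`!%:R * lacunary_bound (c2 / 2 * M) i (c2 / 2 * dot th th).
have A0 i : 0 <= A i by rewrite mulr_ge0// lacunary_bound_ge0.
have IH i : ((Z ^+ n * A i)%:E <=
    \int[rV_measure R n]_x (dot (x : 'rV[R]_n) th ^+ (2 * i) * weight p (x : 'rV[R]_n))%:E)%E.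
  exact: IHn.
have mF := @measurable_dot_weight n.+1 theta k.+1.
have F0 (x : borel_rV R n.+1) :
    (0 <= (dot (x : 'rV[R]_n.+1) theta ^+ (2 * k.+1) * weight p (x : 'rV[R]_n.+1))%:E)%E.
  by rewrite lee_fin mulr_ge0 ?weight_ge0 ?even_power_ge0.
rewrite integral_rV_measureS//.
set G := fun t : R => (\int[rV_measure R n]_y _)%E.
have mG : measurable_fun [set: R] G by exact: (measurable_integral_row mF F0).
have G0 t : (0 <= G t)%E by apply: integral_ge0 => y _; exact: F0.
pose c : R := k.+1%:R * (2 * k.+1%:R - 1).
have c0 : 0 <= c by exact: pronic_ge0.
have mGN : measurable_fun [set: R] (fun t => G (- t)).
  by apply: measurableT_comp => //; exact: oppr_measurable.
have mdw i := @measurable_dot_weight n th i.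
have dw0 i (y : 'rV[R]_n) : 0 <= dot y th ^+ (2 * i) * weight p y.
  by rewrite mulr_ge0 ?weight_ge0 ?even_power_ge0.
(* Pairing [t] with [-t] removes odd powers of the first coordinate; the two terms retained use it
   zero times and twice. *)
have Gsym t : ((2 * weight1 p t * (Z ^+ n * A k.+1 + c * a ^+ 2 * t ^+ 2 * (Z ^+ n * A k)))%:E
    <= G t + G (- t)%R)%E.
  rewrite /G -ge0_integralD//;
    try exact: (measurableT_comp mF (@measurable_row_section R n _)).
  apply: (@le_trans _ _ (\int[rV_measure R n]_y
     ((2 * weight1 p t)%:E * (dot (y : 'rV[R]_n) th ^+ (2 * k.+1) * weight p (y : 'rV[R]_n))%:E +
      (2 * weight1 p t * (c * a ^+ 2 * t ^+ 2))%:E *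
        (dot (y : 'rV[R]_n) th ^+ (2 * k) * weight p (y : 'rV[R]_n))%:E))%E).
    have w20 : 0 <= 2 * weight1 p t by rewrite mulr_ge0// weight1_ge0.
    have w2c0 : 0 <= 2 * weight1 p t * (c * a ^+ 2 * t ^+ 2).
      by rewrite (mulr_ge0 w20)// mulr_ge0 ?sqr_ge0// (mulr_ge0 c0) ?sqr_ge0.
    rewrite ge0_integralD//; try by apply: measurable_funeM; exact: mdw.
    all: try by move=> y _; rewrite -EFinM lee_fin mulr_ge0.
    rewrite ge0_integralZl ?lee_fin//; try exact: mdw.
    all: try by move=> y _; rewrite lee_fin.
    rewrite ge0_integralZl ?lee_fin//; try exact: mdw.
    all: try by move=> y _; rewrite lee_fin.
    have -> : 2 * weight1 p t * (Z ^+ n * A k.+1 + c * a ^+ 2 * t ^+ 2 * (Z ^+ n * A k)) =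
        2 * weight1 p t * (Z ^+ n * A k.+1) +
        2 * weight1 p t * (c * a ^+ 2 * t ^+ 2) * (Z ^+ n * A k) by ring.
    rewrite EFinD (EFinM (2 * weight1 p t)) (EFinM (2 * weight1 p t * (c * a ^+ 2 * t ^+ 2))).
    by rewrite leeD// lee_wpmul2l// lee_fin.
  have w20 : 0 <= 2 * weight1 p t by rewrite mulr_ge0// weight1_ge0.
  have w2c0 : 0 <= 2 * weight1 p t * (c * a ^+ 2 * t ^+ 2).
    by rewrite (mulr_ge0 w20)// mulr_ge0 ?sqr_ge0// (mulr_ge0 c0) ?sqr_ge0.
  apply: ge0_le_integral => //.
  - move=> y _; rewrite -!EFinM -EFinD lee_fin.
    by rewrite addr_ge0// mulr_ge0.
  - by apply: emeasurable_funD; apply: measurable_funeM; exact: mdw.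
  - apply: emeasurable_funD.
      exact: (measurableT_comp mF (@measurable_row_section R n _)).
    exact: (measurableT_comp mF (@measurable_row_section R n _)).
  move=> y _; rewrite -!EFinM -!EFinD lee_fin !dot_row_mx !weight_row_mx -/th -/a.
  have -> : weight1 p (- t) = weight1 p t by rewrite /weight1 normrN.
  have := symmetric_powerD_ge (dot y th) (a * t) k; rewrite -/c mulrN => h.
  have := ler_wpM2r (mulr_ge0 (weight1_ge0 p t) (weight_ge0 p y)) h.
  rewrite exprMn.
  move: (dot y th ^+ (2 * k.+1)) ((_ + a * t) ^+ _) ((_ - a * t) ^+ _) (dot y th ^+ (2 * k)).
  move: (weight1 p t) (weight p y) (t ^+ 2) (a ^+ 2) => w1 w t2 a2 s1 s2 s3 s4.
  exact: weighted_symmetrization.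
pose I := (\int[lebesgue_measure]_t G t)%E.
have II := double_ge0_integral_sym mG G0.
rewrite -[leRHS]/I; set LHS := _%:E.
suff : (2%:E * LHS <= 2%:E * I)%E by rewrite lee_pmul2l.
rewrite II /LHS.
have mW : measurable_fun [set: R] (fun t : R => (weight1 p t)%:E).
  by apply/measurable_EFinP; exact: measurable_weight1.
have mtW : measurable_fun [set: R] (fun t : R => (t ^+ 2 * weight1 p t)%:E).
  apply/measurable_EFinP; apply: measurable_funM; last exact: measurable_weight1.
  exact: exprn_measurable.
pose u := 2 * (Z ^+ n * A k.+1); pose v := 2 * (c * a ^+ 2 * (Z ^+ n * A k)).
have Zn0 : 0 <= Z ^+ n by rewrite exprn_ge0// ltW.
have ZA i : 0 <= Z ^+ n * A i := mulr_ge0 Zn0 (A0 i).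
have u0 : 0 <= u := mulr_ge0 (ler0n _ 2) (ZA _).
have v0 : 0 <= v := mulr_ge0 (ler0n _ 2) (mulr_ge0 (mulr_ge0 c0 (sqr_ge0 a)) (ZA k)).
have tw0 t : 0 <= t ^+ 2 * weight1 p t by rewrite mulr_ge0 ?sqr_ge0 ?weight1_ge0.
apply: (@le_trans _ _ (\int[lebesgue_measure]_t
    (u%:E * (weight1 p t)%:E + v%:E * (t ^+ 2 * weight1 p t)%:E))%E); last first.
  apply: ge0_le_integral => //.
  - move=> t _; rewrite -!EFinM -EFinD lee_fin.
    by apply: addr_ge0; apply: mulr_ge0 => //; exact: weight1_ge0.
  - by apply: emeasurable_funD; exact: measurable_funeM.
  - exact: (emeasurable_funD mG mGN).
  - move=> t _; apply: le_trans (Gsym t); rewrite -!EFinM -EFinD lee_fin /u /v.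
    by rewrite le_eqVlt; apply/orP; left; apply/eqP; ring.
rewrite ge0_integralD//; try exact: measurable_funeM.
all: try by move=> t _; rewrite -EFinM lee_fin; apply: mulr_ge0 => //; exact: weight1_ge0.
rewrite ge0_integralZl ?lee_fin//; last by move=> t _; rewrite lee_fin weight1_ge0.
rewrite ge0_integralZl ?lee_fin//; last by move=> t _; rewrite lee_fin.
rewrite weight_massE// -/Z.
apply: (@le_trans _ _ (u%:E * Z%:E + v%:E * (c2 * Z)%:E)%E); last first.
  by rewrite leeD2l// lee_wpmul2l ?lee_fin// sqr_weight1_mass.
rewrite -!EFinM -EFinD lee_fin /u /v exprSr.
have LB : lacunary_bound (c2 / 2 * M) k.+1 (c2 / 2 * dot theta theta) <=
    lacunary_bound (c2 / 2 * M) k.+1 (c2 / 2 * dot th th) +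
    c2 / 2 * a ^+ 2 * lacunary_bound (c2 / 2 * M) k (c2 / 2 * dot th th).
  rewrite dotE mulrDr; apply: lacunary_boundD.
    exact: mulr_ge0 c20 (sqr_ge0 a).
  by apply: ler_wpM2l => //; exact: thetaM.
(* The binomial coefficient [c] is exactly what carries [(2k)!] to [(2k+2)!], up to the 2 absorbed
   by [c2 / 2]. *)
have factE : (2 * k.+1)`!%:R = 2 * c * (2 * k)`!%:R :> R.
  rewrite mulnS !addSn add0n !factS !natrM /c -!natr1.
  rewrite natrM; ring.
have f0 : 0 <= Z ^+ n * Z * (2 * k.+1)`!%:R.
  by apply: mulr_ge0 => //; apply: mulr_ge0 => //; exact: ltW.
exact: (lacunary_assembly factE (ler_wpM2l f0 LB)).
Qed.

End even_moment_lower.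

(** * Moments of the cone measure *)

(* The cone measure of a Borel set, with the division by the volume cleared. *)
Definition is_cone_law (R : realType) (n : nat) (p : R)
    (Q : probability (borel_rV R n) R) : Prop :=
  forall A : set (borel_rV R n), measurable A ->
  rV_measure R n (lpball p `&` normalize p @^-1` A) =
  (Q A * rV_measure R n (lpball p))%E.

Lemma dot_ge0 (R : realType) n (x : 'rV[R]_n) : 0 <= dot x x.
Proof. by rewrite /dot sumr_ge0// => i _; rewrite -expr2 sqr_ge0. Qed.

Lemma dotZl (R : realType) n (s : R) (x y : 'rV[R]_n) : dot (s *: x) y = s * dot x y.
Proof. by rewrite /dot mulr_sumr; apply: eq_bigr => i _; rewrite mxE mulrA. Qed.

Lemma dotC (R : realType) n (x y : 'rV[R]_n) : dot x y = dot y x.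
Proof. by apply: eq_bigr => i _; rewrite mulrC. Qed.

Lemma ex_sqrt_between n : (0 < n)%N -> exists s, [/\ (0 < s)%N, (n <= s ^ 2)%N & (s ^ 2 <= 4 * n)%N].
Proof.
move=> n0; have ex : exists s, (n <= s ^ 2)%N by exists n; rewrite -mulnn leq_pmulr.
case: (ex_minnP ex) => s ns smin; exists s.
have s0 : (0 < s)%N by rewrite lt0n; apply/eqP => s0; move: ns n0; rewrite s0; lia.
split => //; case: s ns smin s0 => // s ns smin _.
have : (s ^ 2 < n)%N by rewrite ltnNge; apply/negP => /smin; rewrite ltnn.
by case: s ns smin => [|s] ns smin h; nia.
Qed.

(** Hoelder's inequality, derived from Young's: [z^2 <= (2/p) z^p + 1 - 2/p] is summed over
    [z = |x_i| / a], where [a = |x|_p / n^(1/p)] is the scale at which the [z^p] sum to [n]. *)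
Lemma sqrnorm_le_lpnorm (R : realType) n (p : R) (x : 'rV[R]_n) : (0 < n)%N -> 2 < p ->
  dot x x <= n%:R / (n%:R `^ p^-1) ^+ 2 * lpnorm p x ^+ 2.
Proof.
move=> n0 p2; have p0 : 0 < p by exact: lt_trans p2.
have p1 : 1 <= p by rewrite ltW// (lt_trans _ p2)// ltr1n.
have nR : 0 < n%:R :> R by rewrite ltr0n.
have [->|x0] := eqVneq x 0.
  rewrite /dot big1; last by move=> i _; rewrite mxE mul0r.
  by apply: mulr_ge0; [apply: divr_ge0 => //|]; exact: sqr_ge0.
have young (z : R) : 0 <= z -> z ^+ 2 <= 2 / p * z `^ p + (1 - 2 / p).
  move=> z0.
  have q0 : 0 < p / (p - 2) by rewrite divr_gt0// subr_gt0.
  have := @conjugate_powR R (z ^+ 2) 1 (p / 2) (p / (p - 2)) (sqr_ge0 z) ler01.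
  rewrite divr_gt0// q0 => /(_ isT isT).
  have e : (p / 2)^-1 + (p / (p - 2))^-1 = 1.
    by field; rewrite !gt_eqF ?subr_gt0.
  move=> /(_ e); rewrite mulr1 powR1 -powR_mulrn// -powRrM.
  have -> : 2 * (p / 2) = p by field.
  have -> : 1 / (p / (p - 2)) = 1 - 2 / p.
    by field; rewrite !gt_eqF ?subr_gt0.
  by rewrite invf_div mulrC.
set nu := n%:R `^ p^-1.
have nu0 : 0 < nu by exact: powR_gt0.
set r := lpnorm p x.
have r0 : 0 < r by exact: lpnorm_gt0.
pose a := r / nu; have a0 : 0 < a by rewrite divr_gt0.
have aE : n%:R / nu ^+ 2 * r ^+ 2 = n%:R * a ^+ 2.
  by rewrite /a expr_div_n; field; rewrite gt_eqF.
rewrite aE.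
have apE : a `^ p = r `^ p / n%:R.
  rewrite /a powRM ?invr_ge0 ?(ltW r0) ?(ltW nu0)//; congr (_ * _).
  rewrite -powR_inv1 ?(ltW nu0)// -powRrM mulN1r powRN; congr (_^-1).
  by rewrite /nu -powRrM mulVf ?gt_eqF// powRr1.
have sumE : \sum_(i < n) (`|x ord0 i| / a) `^ p = n%:R.
  under eq_bigr do rewrite powRM ?invr_ge0 ?(ltW a0)//.
  rewrite -mulr_suml -/(psum p x) -(lpnormXp p1) -/r.
  have -> : a^-1 `^ p = (a `^ p)^-1.
    by rewrite -powR_inv1 ?(ltW a0)// -powRrM mulN1r powRN.
  have rp : r `^ p != 0 by rewrite powR_eq0 (gt_eqF r0).
  by rewrite apE; field; rewrite rp pnatr_eq0 -lt0n n0.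
apply: (@le_trans _ _ (a ^+ 2 * \sum_(i < n) (2 / p * (`|x ord0 i| / a) `^ p + (1 - 2 / p)))).
  rewrite /dot mulr_sumr; apply: ler_sum => i _.
  have := young (`|x ord0 i| / a); rewrite divr_ge0 ?(ltW a0)// => /(_ isT) h.
  apply: le_trans (ler_wpM2l (sqr_ge0 a) h).
  have -> : a ^+ 2 * (`|x ord0 i| / a) ^+ 2 = `|x ord0 i| ^+ 2 by field; rewrite gt_eqF.
  by rewrite real_normK ?num_real// expr2.
rewrite big_split/= -mulr_sumr sumE sumr_const card_ord -mulr_natr.
by rewrite le_eqVlt; apply/orP; left; apply/eqP; field; rewrite gt_eqF.
Qed.

Section cone_moments.
Context (R : realType).

(** The radial function [s^(2k) exp (- s^p)] restores the homogeneity lost by normalising, so that a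
    moment of [Q] becomes a quotient of two integrals against the weight. *)
Lemma polar_homogeneous (n : nat) (p : R) (Q : probability (borel_rV R n) R)
    (g : borel_rV R n -> R) k :
  (0 < n)%N -> 1 <= p -> is_cone_law p Q ->
  measurable_fun [set: borel_rV R n] g -> (forall x, 0 <= g x) ->
  (forall s (x : 'rV[R]_n), 0 <= s -> g (s *: x) = s ^+ (2 * k) * g x) ->
  (\int[Q]_x (g x)%:E *
   \int[rV_measure R n]_x (lpnorm p (x : 'rV[R]_n) ^+ (2 * k) * weight p (x : 'rV[R]_n))%:E =
   \int[rV_measure R n]_x (g x * weight p (x : 'rV[R]_n))%:E)%E.
Proof.
move=> n0 p1 QE mg g0 gZ.
pose phi (s : R) := s ^+ (2 * k) * expR (- (s `^ p)).
have mphi : measurable_fun [set: R] phi.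
  apply: measurable_funM; first exact: exprn_measurable.
  apply: measurableT_comp => //; apply: measurable_funN.
  exact: measurable_powR.
have phi0 s : 0 <= phi s by rewrite mulr_ge0 ?expR_ge0 ?even_power_ge0.
have := polar_integral n0 p1 QE mg mphi g0 phi0.
have -> : (\int[rV_measure R n]_x (phi (lpnorm p (x : 'rV[R]_n)))%:E =
  \int[rV_measure R n]_x (lpnorm p (x : 'rV[R]_n) ^+ (2 * k) * weight p (x : 'rV[R]_n))%:E)%E.
  by apply: eq_integral => x _; rewrite weight_lpnormE.
move=> <-; apply: eq_integral => x _; congr EFin.
rewrite /phi -weight_lpnormE// mulrA (mulrC (g _)) -gZ ?lpnorm_ge0//.
by rewrite (lpnorm_normalizeK p1).
Qed.

Lemma lpnorm_normalize_le1 n (p : R) (x : 'rV[R]_n) : 1 <= p ->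
  lpnorm p (normalize p x) <= 1.
Proof.
move=> p1; have [->|x0] := eqVneq x 0; last by rewrite lpnorm_normalize.
rewrite /normalize scaler0 (_ : lpnorm p 0 = 0) ?ler01//.
by apply/eqP; rewrite lpnorm_eq0.
Qed.

Lemma measurable_sqrnorm_pow n k :
  measurable_fun [set: borel_rV R n] (fun x : borel_rV R n => dot (x : 'rV[R]_n) x ^+ k).
Proof. by apply: measurable_funX; apply: measurable_dot; exact: measurable_id. Qed.

(** [is_cone_law] speaks of sectors of the ball, so the pointwise bound is integrated over the ball,
    with its indicator as radial function, and the volume of the ball then cancels. *)
Lemma sqrnorm_moment_gt2 (n : nat) (p : R) (Q : probability (borel_rV R n) R) k :
  (0 < n)%N -> 2 < p -> is_cone_law p Q ->
  (\int[Q]_x (dot (x : 'rV[R]_n) x ^+ k)%:E <=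
   ((n%:R / (n%:R `^ p^-1) ^+ 2) ^+ k)%:E)%E.
Proof.
move=> n0 p2 QE.
have p1 : 1 <= p by rewrite ltW// (lt_trans _ p2)// ltr1n.
set D := n%:R / _.
have D0 : 0 <= D by rewrite divr_ge0// sqr_ge0.
pose phi : R -> R := \1_`]-oo, 1]%classic.
have h0 (x : borel_rV R n) : 0 <= dot (x : 'rV[R]_n) x ^+ k by rewrite exprn_ge0// dot_ge0.
have phi0 s : 0 <= phi s by [].
have mphi : measurable_fun [set: R] phi by exact: measurable_indic.
have := polar_integral n0 p1 QE (@measurable_sqrnorm_pow n k) mphi h0 phi0.
have phiE : (\int[rV_measure R n]_x (phi (lpnorm p (x : 'rV[R]_n)))%:E =
    rV_measure R n (lpball p))%E.
  have mB : measurable (lpball p : set (borel_rV R n)) by exact: measurable_lpball.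
  transitivity (\int[rV_measure R n]_x (\1_(lpball p : set (borel_rV R n)) x)%:E)%E; last first.
    by rewrite integral_indic// setIT.
  apply: eq_integral => x _; rewrite /phi !indicE.
  suff -> : (lpnorm p x \in `]-oo, 1]%classic) = (x \in lpball p) by [].
  by apply/idP/idP; rewrite !inE /lpball/= ?in_itv.
rewrite phiE => E.
have bfin := lpball_fin n p1; have b0 := lpball_gt0 n p1.
suff : (\int[Q]_x (dot (x : 'rV[R]_n) x ^+ k)%:E * rV_measure R n (lpball p) <=
    (D ^+ k)%:E * rV_measure R n (lpball p))%E.
  by rewrite lee_pmul2r// ge0_fin_numE// ltW.
rewrite -E -phiE -ge0_integralZl//; last 3 first.
- apply/measurable_EFinP; apply: (measurableT_comp mphi).
  exact: measurable_lpnorm.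
- by move=> x _; rewrite lee_fin.
- by rewrite lee_fin exprn_ge0.
have mN : measurable_fun [set: borel_rV R n]
    (fun x : borel_rV R n => phi (lpnorm p (x : 'rV[R]_n))).
  by apply: (measurableT_comp mphi); exact: measurable_lpnorm.
apply: ge0_le_integral => //.
- by move=> x _; rewrite lee_fin mulr_ge0.
- apply/measurable_EFinP; apply: measurable_funM => //.
  exact: (measurableT_comp (@measurable_sqrnorm_pow n k) (@measurable_normalize R n p)).
- by apply: measurable_funeM; exact/measurable_EFinP.
move=> x _; rewrite -EFinM lee_fin ler_wpM2r// lerXn2r ?nnegrE ?dot_ge0//.
apply: (le_trans (sqrnorm_le_lpnorm _ n0 p2)); rewrite -/D.
by rewrite ler_piMr// exprn_ile1 ?lpnorm_ge0// lpnorm_normalize_le1.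
Qed.

(** The quotient of [integral_sqrnorm_weight] by [integral_lpnorm_weight_ge]; the constants 4 and
    [81 = 9^2] come from the denominator. *)
Lemma sqrnorm_moment_le2 (n : nat) (p : R) (Q : probability (borel_rV R n) R) m :
  (0 < n)%N -> 1 <= p -> p <= 2 -> is_cone_law p Q ->
  (0 < m)%N -> (n <= m ^ 2)%N -> (m ^ 2 <= 16 * n)%N ->
  (\int[Q]_x (dot (x : 'rV[R]_n) x ^+ m)%:E <=
   (4 * (8 * 64 * 64 * 81 * (n%:R / (n%:R `^ p^-1) ^+ 2)) ^+ m)%:E)%E.
Proof.
move=> n0 p1 p2 QE m0 nm mn.
have g0 (x : borel_rV R n) : 0 <= dot (x : 'rV[R]_n) x ^+ m by rewrite exprn_ge0// dot_ge0.
have := @polar_homogeneous n p Q (fun x => dot (x : 'rV[R]_n) x ^+ m) m n0 p1 QE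
  (@measurable_sqrnorm_pow n m) g0.
have gZ (s : R) (x : 'rV[R]_n) : 0 <= s ->
    dot (s *: x) (s *: x) ^+ m = s ^+ (2 * m) * dot x x ^+ m.
  by move=> _; rewrite dotZl dotC dotZl mulrA -expr2 exprMn -exprM.
move=> /(_ gZ) E.
have U := integral_sqrnorm_weight p1 m0 nm mn.
have L := @integral_lpnorm_weight_ge R n p p1 m n0 p2.
have Z0 := weight_mass_gt0 p1.
have nu0 : 0 < n%:R `^ p^-1 :> R by rewrite powR_gt0// ltr0n.
set a := 4^-1 * _ ^+ (2 * m) * _ in L.
have a0 : 0 < a.
  by rewrite /a !mulr_gt0 ?invr_gt0 ?exprn_gt0// divr_gt0.
set I := (\int[Q]_x _)%E in E *.
have I0 : (0 <= I)%E by apply: integral_ge0 => x _; rewrite lee_fin.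
have IU : (I * a%:E <= ((8 * 64 * 64 * n%:R) ^+ m * weight_mass p ^+ n)%:E)%E.
  by apply: le_trans U; rewrite -E lee_wpmul2l.
rewrite -lee_pdivlMr// -EFinM in IU.
apply: (le_trans IU); rewrite lee_fin /a exprM.
set nu := n%:R `^ p^-1; rewrite -/nu in nu0.
have -> : (8 * 64 * 64 * 81 * (n%:R / nu ^+ 2)) ^+ m =
    (8 * 64 * 64 * n%:R) ^+ m * (((nu / 9) ^+ 2) ^+ m)^-1.
  rewrite -[in RHS]exprVn -[in RHS]exprMn; congr (_ ^+ _).
  by field; rewrite gt_eqF.
have nz : ((nu / 9) ^+ 2) ^+ m != 0 by rewrite expf_neq0// expf_neq0// mulf_neq0// gt_eqF.
have zz : weight_mass p ^+ n != 0 by rewrite expf_neq0// gt_eqF.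
move: (_ ^+ m) (((nu / 9) ^+ 2) ^+ m) (weight_mass p ^+ n) nz zz => x y z yn zn.
by rewrite le_eqVlt; apply/orP; left; apply/eqP; field; rewrite yn zn.
Qed.

(** For [p <= 2] the moment bound is available only at orders comparable to [sqrt n]; a smaller [k]
    is reached from [m = max (k, s)], with [s] about [sqrt n]. *)
Lemma sqrnorm_moment : exists2 C : R, 1 <= C &
  forall (n : nat) (p : R) (Q : probability (borel_rV R n) R) k,
  (0 < n)%N -> 1 <= p -> is_cone_law p Q -> (0 < k)%N -> (k ^ 2 <= 16 * n)%N ->
  (\int[Q]_x (dot (x : 'rV[R]_n) x ^+ k)%:E <=
   ((C * (n%:R / (n%:R `^ p^-1) ^+ 2)) ^+ k)%:E)%E.
Proof.
pose K : R := 8 * 64 * 64 * 81.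
have K1 : 1 <= K by rewrite /K !mulr_ege1// ler1n.
have C1 : 1 <= 5 * K by rewrite mulr_ege1// ler1n.
exists (5 * K) => // n p Q k n0 p1 QE k0 kn.
set D := n%:R / _.
have D0 : 0 < D by rewrite divr_gt0 ?ltr0n// exprn_gt0// powR_gt0// ltr0n.
have [p2|p2] := ltP 2 p.
  apply: (le_trans (sqrnorm_moment_gt2 k n0 p2 QE)).
  rewrite lee_fin lerXn2r ?nnegrE ?mulr_ge0 ?(ltW D0) ?(le_trans ler01 C1)//.
  by rewrite -/D ler_peMl// ltW.
have [s [s0 ns sn]] := ex_sqrt_between n0.
pose m := maxn k s.
have km : (k <= m)%N by exact: leq_maxl.
have m0 : (0 < m)%N by exact: leq_trans km.
have nm : (n <= m ^ 2)%N by rewrite (leq_trans ns)// leq_sqr leq_maxr.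
have mn : (m ^ 2 <= 16 * n)%N.
  by rewrite /m; case: (leqP k s) => // _; lia.
have := sqrnorm_moment_le2 n0 p1 p2 QE m0 nm mn; rewrite -/D -/K => h.
pose A := K * D; have A0 : 0 < A by rewrite mulr_gt0// (lt_le_trans ltr01).
(* Stands in for Lyapunov's inequality: [v^k <= 1 + v^m] for [k <= m], at [v = u / A]. After
   integration it gives [(1 + 4) A^k], hence the 5. *)
have ptw (u : R) : 0 <= u -> u ^+ k <= A ^+ k + A ^+ k * (A ^+ m)^-1 * u ^+ m.
  move=> u0; have e : u = A * (u / A) by field; rewrite gt_eqF.
  pose v := u / A; have v0 : 0 <= v by rewrite divr_ge0// ltW.
  have -> : A ^+ k * (A ^+ m)^-1 * u ^+ m = A ^+ k * v ^+ m.
    by rewrite /v expr_div_n; ring.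
  rewrite {1}e -/v exprMn -{2}[A ^+ k]mulr1 -mulrDr ler_wpM2l ?exprn_ge0 ?(ltW A0)//.
  have [v1|v1] := leP v 1.
    by rewrite (le_trans (exprn_ile1 _ v0 v1))// lerDl exprn_ge0.
  rewrite (le_trans (_ : _ <= v ^+ m)) ?lerDr ?ler01//.
  by rewrite ler_weXn2l// ltW.
have Ak0 : 0 <= A ^+ k by rewrite exprn_ge0// ltW.
have c0 : 0 <= A ^+ k * (A ^+ m)^-1 by rewrite mulr_ge0// invr_ge0 exprn_ge0// ltW.
have mk j : measurable_fun [set: borel_rV R n] (fun x : borel_rV R n => (dot (x : 'rV[R]_n) x ^+ j)%:E).
  by apply/measurable_EFinP; exact: measurable_sqrnorm_pow.
have d0 j (x : 'rV[R]_n) : (0 <= (dot x x ^+ j)%:E)%E.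
  by rewrite lee_fin exprn_ge0// dot_ge0.
apply: (@le_trans _ _ (\int[Q]_x ((A ^+ k)%:E +
    (A ^+ k * (A ^+ m)^-1)%:E * (dot (x : 'rV[R]_n) x ^+ m)%:E))%E).
  apply: ge0_le_integral => //.
  - by apply: emeasurable_funD => //; exact: measurable_funeM.
  - by move=> x _; rewrite -EFinM -EFinD lee_fin ptw// dot_ge0.
rewrite ge0_integralD//; last 2 first.
- by move=> x _; rewrite mule_ge0// lee_fin.
- exact: measurable_funeM.
rewrite (integral_cst Q)//= probability_setT mule1 ge0_integralZl ?lee_fin//.
apply: (@le_trans _ _ ((A ^+ k)%:E + (A ^+ k * (A ^+ m)^-1)%:E * (4 * A ^+ m)%:E)%E).
  by rewrite leeD2l// lee_wpmul2l// lee_fin.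
rewrite -EFinM -EFinD lee_fin.
have -> : A ^+ k + A ^+ k * (A ^+ m)^-1 * (4 * A ^+ m) = 5 * A ^+ k.
  by field; rewrite expf_neq0// gt_eqF.
have -> : 5 * K * D = 5 * A by rewrite /A mulrA.
rewrite [leRHS]exprMn ler_wpM2r//.
by case: k k0 {kn m km m0 nm mn h ptw Ak0 c0} => // k _; rewrite exprS ler_peMr// exprn_ege1// ler1n.
Qed.

Lemma fact2_ge k : (k ^ k * k`! <= (2 * k)`!)%N.
Proof.
have h : (k <= 2 * k)%N by rewrite mul2n -addnn leq_addl.
have e : (2 * k - k = k)%N by rewrite mul2n -addnn addnK.
rewrite -(ffact_fact h) e leq_mul2r mul2n -addnn; apply/orP; right.
suff gen b : (k ^ b <= (k + b) ^_ b)%N by exact: gen.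
elim: b => [|b IH]; first by rewrite ffactn0 expn0.
by rewrite addnS ffactSS expnS leq_mul// -addnS leq_addr.
Qed.

(** The condition on [(k - 1) M] leaves at least half of the sum in [lacunary_bound], which is then
    at least [(c2/4)^k / k!]; the growth [k^k] is the quotient [(2k)! / k!], and [16 e] comes from
    [integral_lpnorm_weight_le]. *)
Lemma dot_moment_ge : exists2 c : R, 0 < c &
  forall (n : nat) (p : R) (Q : probability (borel_rV R n) R) (theta : 'rV[R]_n) (M : R) k,
  (0 < n)%N -> 1 <= p -> is_cone_law p Q -> (0 < k)%N -> (k <= n)%N ->
  dot theta theta = 1 -> (forall i, theta ord0 i ^+ 2 <= M) -> k.-1%:R * M <= 2^-1 ->
  (((c * (k%:R / (n%:R `^ p^-1) ^+ 2)) ^+ k)%:E <=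
    \int[Q]_x (dot (x : 'rV[R]_n) theta ^+ (2 * k))%:E)%E.
Proof.
have e0 := expR_gt0 (1 : R).
pose c2 : R := (64 * expR 1 ^+ 2)^-1.
have c20 : 0 < c2 by rewrite invr_gt0 mulr_gt0// exprn_gt0.
exists (c2 / 4 / (16 * expR 1)).
  by rewrite divr_gt0 ?mulr_gt0// divr_gt0.
move=> n p Q theta M k n0 p1 QE k0 kn th1 thM kM.
have M0 : 0 <= M.
  by apply: le_trans (thM (Ordinal n0)); exact: sqr_ge0.
have mg : measurable_fun [set: borel_rV R n]
    (fun x : borel_rV R n => dot (x : 'rV[R]_n) theta ^+ (2 * k)).
  apply: measurable_funX; apply: measurable_dot; first exact: measurable_id.
  exact: measurable_cst.
have g0 (x : borel_rV R n) : 0 <= dot (x : 'rV[R]_n) theta ^+ (2 * k) by exact: even_power_ge0.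
have gZ (s : R) (x : 'rV[R]_n) : 0 <= s ->
    dot (s *: x) theta ^+ (2 * k) = s ^+ (2 * k) * dot x theta ^+ (2 * k).
  by move=> _; rewrite dotZl exprMn.
have E := polar_homogeneous n0 p1 QE mg g0 gZ.
have U := integral_lpnorm_weight_le p1 n0 kn.
have L := integral_dot_weight_ge p1 k M0 thM.
have Z0 := weight_mass_gt0 p1.
set nu := n%:R `^ p^-1 in U *.
have nu0 : 0 < nu by rewrite powR_gt0// ltr0n.
set b := (16 * expR 1) ^+ k * _ * _ in U.
have b0 : 0 < b by rewrite /b !mulr_gt0 ?exprn_gt0 ?mulr_gt0.
set I := (\int[Q]_x _)%E in E *.
have I0 : (0 <= I)%E by apply: integral_ge0 => x _; rewrite lee_fin.
have IL : (((c2 / 4 / (16 * expR 1) * (k%:R / nu ^+ 2)) ^+ k * b)%:E <= I * b%:E)%E.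
  apply: le_trans (lee_wpmul2l I0 U); rewrite E; apply: le_trans L.
  rewrite lee_fin th1 mulr1 /lacunary_bound -/c2.
  have f0 i : 0 < i`!%:R :> R by rewrite ltr0n fact_gt0.
  have -> : (c2 / 4 / (16 * expR 1) * (k%:R / nu ^+ 2)) ^+ k * b =
      weight_mass p ^+ n * (k%:R ^+ k * (c2 / 4) ^+ k).
    have h : (c2 / 4 / (16 * expR 1) * (k%:R / nu ^+ 2)) ^+ k *
        ((16 * expR 1) ^+ k * (nu ^+ 2) ^+ k) = k%:R ^+ k * (c2 / 4) ^+ k.
      by rewrite -!exprMn; congr (_ ^+ _); field; rewrite !gt_eqF.
    by rewrite /b (exprM nu) mulrA h mulrC.
  rewrite ler_wpM2l ?exprn_ge0 ?(ltW Z0)//.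
  have maxge : c2 / 4 <= Num.max (c2 / 2 - k.-1%:R * (c2 / 2 * M)) 0.
    rewrite le_max; apply/orP; left.
    have := ler_wpM2l (ltW c20) kM.
    by move: (k.-1%:R) => i; clear -c20 => h; lra.
  apply: (@le_trans _ _ (((2 * k)`!%:R / k`!%:R) * (c2 / 4) ^+ k)).
    rewrite ler_wpM2r ?exprn_ge0 ?divr_ge0 ?(ltW c20)//.
    by rewrite ler_pdivlMr// -natrX -natrM ler_nat fact2_ge.
  rewrite -mulrA ler_wpM2l ?(ltW (f0 _))// mulrC ler_wpM2r ?invr_ge0 ?(ltW (f0 _))//.
  by rewrite lerXn2r ?nnegrE ?divr_ge0 ?(ltW c20)// le_max lexx orbT.
by rewrite EFinM lee_pmul2r// in IL.
Qed.

End cone_moments.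

(** * Moments over the sphere *)

Section householder.
Context (R : rcfType) (n : nat).
Implicit Types (u v x y : 'rV[R]_n).

(** The Householder reflection across the hyperplane orthogonal to [v = x - u], or the identity when
    [v = 0]. *)
Lemma reflection (u x : 'rV[R]_n) : u *m u^T = x *m x^T ->
  exists H : 'M[R]_n, [/\ H^T = H, H *m H = 1%:M & u *m H = x].
Proof.
move=> ux; have [xu|xu] := eqVneq x u.
  by exists 1%:M; rewrite trmx1 mulmx1 mulmx1 xu.
pose v := x - u; pose s := (v *m v^T) ord0 ord0.
have v0 : v != 0 by rewrite subr_eq0.
have vv : v *m v^T = s%:M by rewrite [LHS]mx11_scalar.
have s0 : s != 0.
  apply: contra_neq v0 => s0; apply/rowP => i; rewrite [RHS]mxE.
  move: s0; rewrite /s mxE => /eqP; rewrite psumr_eq0; last first.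
    by move=> j _; rewrite [v^T _ _]mxE -expr2 sqr_ge0.
  move=> /allP /(_ i (mem_index_enum _)) /=.
  by rewrite [v^T _ _]mxE -expr2 sqrf_eq0 => /eqP.
pose W := v^T *m v.
have WW : W *m W = s *: W.
  by rewrite /W mulmxA -(mulmxA v^T) vv mul_mx_scalar -scalemxAl.
have WT : W^T = W by rewrite /W trmx_mul trmxK.
exists (1%:M - (2 / s) *: W); split.
- by rewrite linearB/= linearZ/= trmx1 WT.
- rewrite mulmxBl mulmxBr mulmx1 mul1mx mulmxBr mulmx1 -scalemxAl -scalemxAr WW.
  rewrite !scalerA (_ : 2 / s * (2 / s) * s = 2 / s + 2 / s); last by field.
  by rewrite scalerDl; apply/matrixP => i j; rewrite !mxE; ring.
- rewrite mulmxBr mulmx1 -scalemxAr /W mulmxA.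
  (* Equality of the lengths enters here: [|x - u|^2 = 2 |u|^2 - 2 <u, x> = - 2 <u, x - u>]. *)
  have -> : u *m v^T = (- (s / 2))%:M.
    have : s%:M = - (2 *: (u *m v^T)) :> 'M[R]_1.
      rewrite -vv /v linearB/= !mulmxBl !mulmxBr -ux scalerBr opprB.
      have -> : x *m u^T = u *m x^T.
        apply/matrixP => i j; rewrite [LHS]mxE [RHS]mxE; apply: eq_bigr => l _.
        by rewrite [u^T _ _]mxE [x^T _ _]mxE (ord1 i) (ord1 j) mulrC.
      by rewrite scaler_nat scaler_nat !mulr2n opprD; apply/matrixP => i j; rewrite !mxE; ring.
    move=> e; have -> : u *m v^T = - 2^-1 *: s%:M.
      by rewrite e scalerN scaleNr opprK scalerA mulVf ?pnatr_eq0// scale1r.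
    by rewrite scale_scalar_mx; congr (_%:M); ring.
  rewrite mul_scalar_mx scalerA /v.
  have -> : 2 / s * - (s / 2) = - 1 by field.
  by rewrite scaleN1r opprK addrC subrK.
Qed.

End householder.

Lemma dot_mulmxE (R : realType) n (x y : 'rV[R]_n) : dot x y = (x *m y^T) ord0 ord0.
Proof. by rewrite mxE; apply: eq_bigr => i _; rewrite [y^T _ _]mxE. Qed.

(** The generous exponent allows an elementary proof: for [|t| <= 1/2] the left side is at most
    [1/(1-t) + 1/(1+t) = 2/(1 - t^2)], and for larger [|t|] one has [|t| <= 2 t^2]. *)
Lemma cosh_le (R : realType) (t : R) : expR t + expR (- t) <= 2 * expR (2 * t ^+ 2).
Proof.
wlog t0 : t / 0 <= t.
  move=> H; have [/H//|t0] := leP 0 t.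
  by have := H (- t); rewrite opprK sqrrN addrC; apply; rewrite oppr_ge0 ltW.
have [t2|t2] := leP t 2^-1.
  have h1 := expR_ge1Dx t; have h2 := expR_ge1Dx (- t).
  have e1 : expR t * expR (- t) = 1 by rewrite -expRD subrr expR0.
  have h3 := expR_ge1Dx (2 * t ^+ 2).
  apply: le_trans (ler_wpM2l (ler0n _ 2) h3).
  move: (expR t) (expR (- t)) (expR_gt0 t) (expR_gt0 (- t)) h1 h2 e1 => a b a0 b0 h1 h2 e1.
  have hb : b * (1 + t) <= 1 by nra.
  have ha : a * (1 - t) <= 1 by nra.
  have tt : 0 < 1 - t ^+ 2 by nra.
  have : (a + b) * (1 - t ^+ 2) <= 2 by nra.
  have w0 := sqr_ge0 t; have w4 : t ^+ 2 <= 4^-1 by nra.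
  move=> h; rewrite -(ler_pM2r tt); apply: (le_trans h).
  by move: (t ^+ 2) w0 w4 => w w0 w4; nra.
apply: (@le_trans _ _ (2 * expR t)).
  have : expR (- t) <= expR t by rewrite ler_expR; lra.
  by move=> h; lra.
rewrite ler_wpM2l// ler_expR; nra.
Qed.

Section uniform_sphere.
Context (R : realType) (n : nat) (sigma : probability (borel_rV R n) R).
Hypothesis usigma : is_uniform_on_sphere sigma.

Lemma measurable_unit_sphere : measurable (@unit_sphere R n : set (borel_rV R n)).
Proof.
rewrite (_ : @unit_sphere R n = (fun x : borel_rV R n => dot (x : 'rV[R]_n) x) @^-1` [set 1])//.
rewrite -[X in measurable X]setTI.
have md : measurable_fun [set: borel_rV R n] (fun x : borel_rV R n => dot (x : 'rV[R]_n) x).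
  by apply: measurable_dot; exact: measurable_id.
exact: md.
Qed.

Lemma ge0_integral_sphereE (f : borel_rV R n -> \bar R) :
  measurable_fun [set: borel_rV R n] f -> (forall x, 0 <= f x)%E ->
  (\int[sigma]_x f x = \int[sigma]_(x in @unit_sphere R n) f x)%E.
Proof.
move=> mf f0; have mS := measurable_unit_sphere.
have SC : sigma (~` @unit_sphere R n) = 0%E.
  by rewrite probability_setC// usigma.1 subee.
rewrite (ge0_negligible_integral _ _ _ _ SC)//; last exact: measurableC.
by rewrite setTD setCK.
Qed.

Lemma measurable_mulmx (U : 'M[R]_n) : measurable_fun [set: borel_rV R n]
  (fun x : borel_rV R n => (x : 'rV[R]_n) *m U : borel_rV R n).
Proof.
apply: measurable_rV => i; under eq_fun do rewrite mxE.
apply: measurable_sum => j; apply: measurable_funM => //.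
exact: measurable_coord.
Qed.

Lemma integral_sphere_mulmx (U : 'M[R]_n) (f : borel_rV R n -> \bar R) :
  U *m U^T = 1%:M -> measurable_fun [set: borel_rV R n] f -> (forall x, 0 <= f x)%E ->
  (\int[sigma]_x f ((x : 'rV[R]_n) *m U) = \int[sigma]_x f x)%E.
Proof.
move=> UU mf f0.
transitivity (\int[pushforward sigma (fun x : borel_rV R n => (x : 'rV[R]_n) *m U : borel_rV R n)]_x f x)%E.
  by rewrite (ge0_integral_pushforward (measurable_mulmx U)).
pose nu : {measure set (borel_rV R n) -> \bar R} :=
  measure_function_pushforward__canonical__measure_function_Measure sigma (measurable_mulmx U).
by apply: (@eq_measure_integral _ _ _ _ sigma nu) => A mA _; exact: (usigma.2 U UU A mA).
Qed.

(* The sphere measure is invariant under sign changes of the coordinates; averaging over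
   all of them replaces the exponential by a product of hyperbolic cosines. *)
Lemma integral_sphere_exp (lam : R) :
  (\int[sigma]_x (expR (lam * \sum_(i < n) (x : 'rV[R]_n) ord0 i))%:E <=
   (expR (2 * lam ^+ 2))%:E)%E.
Proof.
pose f (x : 'rV[R]_n) := expR (lam * \sum_(i < n) x ord0 i).
have mf : measurable_fun [set: borel_rV R n] (fun x : borel_rV R n => (f x)%:E).
  apply/measurable_EFinP; apply: measurableT_comp => //; apply: measurable_funM => //.
  by apply: measurable_sum => i; exact: measurable_coord.
have f0 (x : 'rV[R]_n) : 0 <= f x by exact: expR_ge0.
pose D (e : {ffun 'I_n -> bool}) : 'M[R]_n := diag_mx (\row_i (-1) ^+ (e i)).
have DD e : D e *m (D e)^T = 1%:M.
  rewrite /D tr_diag_mx mulmx_diag; apply/matrixP => i j; rewrite !mxE -expr2.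
  by rewrite sqrr_sign.
have fD e (x : 'rV[R]_n) : f (x *m D e) = \prod_(i < n) expR (lam * ((-1) ^+ e i * x ord0 i)).
  rewrite /f -expR_sum mulr_sumr; congr expR; apply: eq_bigr => i _.
  by rewrite /D mul_mx_diag !mxE; congr (_ * _); exact: mulrC.
have mfD e : measurable_fun [set: borel_rV R n] (fun x : borel_rV R n => (f ((x : 'rV[R]_n) *m D e))%:E).
  exact: (measurableT_comp mf (measurable_mulmx (D e))).
set I := (\int[sigma]_x _)%E.
have IE e : (\int[sigma]_x (f ((x : 'rV[R]_n) *m D e))%:E = I)%E.
  by apply: (integral_sphere_mulmx (DD e) mf) => x; rewrite lee_fin.
pose N : R := (2 ^ n)%:R.
have N0 : 0 < N by rewrite ltr0n expn_gt0.
suff : (N%:E * I <= N%:E * (expR (2 * lam ^+ 2))%:E)%E by rewrite lee_pmul2l.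
have -> : (N%:E * I = \sum_(e : {ffun 'I_n -> bool}) \int[sigma]_x (f ((x : 'rV[R]_n) *m D e))%:E)%E.
  under eq_bigr do rewrite IE.
  by rewrite sumr_const card_ffun card_bool card_ord /N mule_natl.
rewrite -ge0_integral_sum//; last by move=> e x _; rewrite lee_fin.
have ptw (x : 'rV[R]_n) : unit_sphere x ->
    \sum_(e : {ffun 'I_n -> bool}) f (x *m D e) <= N * expR (2 * lam ^+ 2).
  move=> x1; under eq_bigr do rewrite fD.
  rewrite -(bigA_distr_bigA (fun (i : 'I_n) (b : bool) => expR (lam * ((-1) ^+ b * x ord0 i)))).
  apply: (@le_trans _ _ (\prod_(i < n) (2 * expR (2 * (lam * x ord0 i) ^+ 2)))).
    apply: ler_prod => i _; rewrite big_bool/= expr1 expr0 mulN1r mul1r mulrN addrC.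
    by rewrite addr_ge0 ?expR_ge0// cosh_le.
  rewrite big_split/= prodr_const card_ord -expR_sum /N natrX ler_wpM2l ?exprn_ge0//.
  rewrite -mulr_sumr ler_expR ler_wpM2l//.
  under eq_bigr do rewrite exprMn.
  rewrite -mulr_sumr (_ : \sum_(i < n) x ord0 i ^+ 2 = 1) ?mulr1//.
have ms : measurable_fun [set: borel_rV R n] (fun x : borel_rV R n =>
    (\sum_(e : {ffun 'I_n -> bool}) (f ((x : 'rV[R]_n) *m D e))%:E)%E).
  exact: emeasurable_sum.
rewrite ge0_integral_sphereE//; last by move=> x; apply: sume_ge0 => e _; rewrite lee_fin.
apply: (@le_trans _ _ (\int[sigma]_(x in @unit_sphere R n) (cst (N * expR (2 * lam ^+ 2))%:E) x)%E).
  apply: ge0_le_integral => //.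
  - exact: measurable_unit_sphere.
  - by move=> x _; apply: sume_ge0 => e _; rewrite lee_fin.
  - exact: measurable_funTS.
  - by move=> x Sx; rewrite sumEFin lee_fin ptw.
rewrite integral_cst//; last exact: measurable_unit_sphere.
rewrite -EFinM -[leRHS]mule1; apply: lee_wpmul2l; last exact: (probability_le1 sigma measurable_unit_sphere).
by rewrite lee_fin mulr_ge0 ?expR_ge0// ltW.
Qed.

(** The bound [y^(2k) <= (2k)! e^|y|] is applied to [lam] times the sum, with [lam = sqrt k]
    balancing [lam^(-2k)] against [exp (2 lam^2)]. The constant is [4 * 16 * 2], from
    [(2k)! / k^k <= (4k)^k], [e^(2k) <= 16^k] and [2 <= 2^k]. *)
Lemma integral_sphere_sum_even k : (0 < k)%N ->
  (\int[sigma]_x ((\sum_(i < n) (x : 'rV[R]_n) ord0 i) ^+ (2 * k))%:E <=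
   ((128 * k%:R) ^+ k)%:E)%E.
Proof.
move=> k0; have kR : 0 < k%:R :> R by rewrite ltr0n.
pose lam : R := Num.sqrt k%:R.
have lam2 : lam ^+ 2 = k%:R by rewrite sqr_sqrtr.
pose S (x : 'rV[R]_n) := \sum_(i < n) x ord0 i.
have mS : measurable_fun [set: borel_rV R n] (fun x : borel_rV R n => S x).
  by apply: measurable_sum => i; exact: measurable_coord.
have me (l : R) : measurable_fun [set: borel_rV R n] (fun x : borel_rV R n => (expR (l * S x))%:E).
  by apply/measurable_EFinP; apply: measurableT_comp => //; exact: measurable_funM.
pose c : R := (2 * k)`!%:R / lam ^+ (2 * k).
have lk : lam ^+ (2 * k) = k%:R ^+ k by rewrite exprM lam2.
have c0 : 0 <= c by rewrite /c lk divr_ge0// exprn_ge0.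
have e0 (l : R) (x : 'rV[R]_n) : (0 <= (expR (l * S x))%:E)%E by rewrite lee_fin expR_ge0.
apply: (@le_trans _ _ (\int[sigma]_x (c%:E * ((expR (lam * S x))%:E + (expR (- lam * S x))%:E)))%E).
  apply: ge0_le_integral => //.
  - by move=> x _; rewrite lee_fin even_power_ge0.
  - by apply/measurable_EFinP; apply: measurable_funX; exact: mS.
  - by apply: measurable_funeM; exact: emeasurable_funD.
  move=> x _; rewrite -EFinD -EFinM lee_fin /c lk mulrAC ler_pdivlMr ?exprn_gt0//.
  rewrite -lk -exprMn.
  have := exprn_le_expR (2 * k) (normr_ge0 (S x * lam)).
  rewrite -normrX ger0_norm ?even_power_ge0// => /le_trans; apply.
  rewrite ler_wpM2l// mulNr (mulrC lam).
  have [h|h] := leP 0 (S x * lam).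
    by rewrite ger0_norm// lerDl expR_ge0.
  by rewrite ltr0_norm// lerDr expR_ge0.
rewrite ge0_integralZl ?lee_fin//; last 2 first.
- exact: emeasurable_funD.
- by move=> x _; rewrite adde_ge0.
rewrite ge0_integralD//.
apply: (@le_trans _ _ (c%:E * ((expR (2 * lam ^+ 2))%:E + (expR (2 * lam ^+ 2))%:E))%E).
  rewrite lee_wpmul2l ?lee_fin// leeD ?integral_sphere_exp//.
  by rewrite -[X in (_ <= (expR (2 * X))%:E)%E]sqrrN integral_sphere_exp.
rewrite -EFinD -EFinM lee_fin lam2 /c lk.
have h1 : expR (2 * k%:R) <= 16 ^+ k :> R.
  rewrite mulrC expRM_natl lerXn2r ?nnegrE ?expR_ge0//.
  rewrite -[2]/(1 + 1) expRD; have := expR1_le4 R; have := expR_gt0 (1 : R).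
  by move: (expR 1) => e e0' e4; nra.
have h2 : (2 * k)`!%:R <= 4 ^+ k * k%:R ^+ k * k%:R ^+ k :> R.
  apply: (@le_trans _ _ (((2 * k) ^ (2 * k))%:R)).
    by rewrite ler_nat -ffactnn ffact_leq_exp.
  rewrite natrX natrM exprM -!exprMn le_eqVlt; apply/orP; left; apply/eqP.
  by congr (_ ^+ _); ring.
have h3 : 2 <= 2 ^+ k :> R.
  by case: k k0 {kR lam lam2 c lk c0 h1 h2} => // k _; rewrite exprS ler_peMr// exprn_ege1// ler1n.
apply: (@le_trans _ _ ((4 ^+ k * k%:R ^+ k) * (2 ^+ k * 16 ^+ k))).
  have -> : expR (2 * k%:R) + expR (2 * k%:R) = 2 * expR (2 * k%:R) :> R by ring.
  apply: ler_pM.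
  - by rewrite divr_ge0// exprn_ge0.
  - by rewrite mulr_ge0// expR_ge0.
  - by rewrite ler_pdivrMr// exprn_gt0.
  - by rewrite ler_pM// expR_ge0.
rewrite -!exprMn le_eqVlt; apply/orP; left; apply/eqP; congr (_ ^+ _).
by ring.
Qed.

(* A reflection reduces to x with all coordinates equal. *)
Lemma integral_sphere_dot_even (x : 'rV[R]_n) k : (0 < n)%N -> (0 < k)%N ->
  (\int[sigma]_theta (dot x theta ^+ (2 * k))%:E <=
   ((128 * k%:R * (dot x x / n%:R)) ^+ k)%:E)%E.
Proof.
move=> n0 k0; have nR : 0 < n%:R :> R by rewrite ltr0n.
pose r := Num.sqrt (dot x x / n%:R).
have d0 : 0 <= dot x x / n%:R by rewrite divr_ge0// dot_ge0.
have r2 : r ^+ 2 = dot x x / n%:R by rewrite sqr_sqrtr.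
pose u : 'rV[R]_n := const_mx r.
have uu : u *m u^T = x *m x^T.
  rewrite [LHS]mx11_scalar [RHS]mx11_scalar; congr (_%:M).
  rewrite -!dot_mulmxE /u {1}/dot; under eq_bigr do rewrite !mxE -expr2 r2.
  by rewrite sumr_const card_ord -[LHS]mulr_natr divfK ?gt_eqF.
have [H [HT HH uH]] := reflection uu.
have md (y : 'rV[R]_n) : measurable_fun [set: borel_rV R n]
    (fun theta : borel_rV R n => (dot y (theta : 'rV[R]_n) ^+ (2 * k))%:E).
  apply/measurable_EFinP; apply: measurable_funX; apply: measurable_dot.
    exact: measurable_cst.
  exact: measurable_id.
have -> : (\int[sigma]_theta (dot x theta ^+ (2 * k))%:E =
    \int[sigma]_theta (dot u theta ^+ (2 * k))%:E)%E.
  rewrite -(@integral_sphere_mulmx H (fun theta => (dot u (theta : 'rV[R]_n) ^+ (2 * k))%:E)).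
  - apply: eq_integral => theta _; rewrite !dot_mulmxE -uH trmx_mul HT mulmxA.
    by [].
  - by rewrite HT.
  - exact: md.
  - by move=> theta; rewrite lee_fin even_power_ge0.
have -> : (\int[sigma]_theta (dot u theta ^+ (2 * k))%:E =
    \int[sigma]_theta ((r ^+ (2 * k))%:E * ((\sum_(i < n) (theta : 'rV[R]_n) ord0 i) ^+ (2 * k))%:E))%E.
  apply: eq_integral => theta _; rewrite -EFinM -exprMn mulr_sumr.
  by congr (_ ^+ _)%:E; apply: eq_bigr => i _; rewrite mxE.
rewrite ge0_integralZl ?lee_fin ?even_power_ge0//; last 2 first.
- apply/measurable_EFinP; apply: measurable_funX.
  by apply: measurable_sum => i; exact: measurable_coord.
- by move=> theta _; rewrite lee_fin even_power_ge0.
apply: (le_trans (lee_wpmul2l _ (integral_sphere_sum_even k0))).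
  by rewrite lee_fin even_power_ge0.
by rewrite -EFinM lee_fin exprM r2 -exprMn mulrC.
Qed.

End uniform_sphere.

(** * Tails in a typical direction *)

Section probability_inequalities.
Context d (T : measurableType d) (R : realType) (P : probability T R).

(** Markov's inequality at level 1, applied to the complement. *)
Lemma probability_lt1_ge (f : T -> \bar R) :
  measurable_fun setT f -> (forall x, 0 <= f x)%E ->
  (\int[P]_x f x <= 2^-1%:E)%E ->
  measurable [set x | (f x < 1)%E] /\ (2^-1%:E <= P [set x | (f x < 1)%E])%E.
Proof.
move=> mf f0 If.
have mA : measurable [set x | (f x < 1)%E].
  by rewrite -[X in measurable X]setTI; exact: (measurable_lte measurableT mf (measurable_cst _)).
split => //; set A := [set x | _] in mA *.
have h : (P (~` A) <= 2^-1%:E)%E.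
  apply: le_trans If; rewrite -[P _]mul1e -integral_cst//; last exact: measurableC.
  apply: (@le_trans _ _ (\int[P]_(x in ~` A) f x)%E).
    apply: ge0_le_integral => //; first exact: measurableC.
      exact: measurable_funTS.
    by move=> x /=; rewrite /A/= => /negP; rewrite -leNgt.
  apply: ge0_subset_integral => //; exact: measurableC.
move: h; rewrite probability_setC//.
have := fin_num_measure P A mA; move: (P A) => [r| |]//= _.
by rewrite -EFinB !lee_fin; lra.
Qed.

(* Integrate [a Y <= 1_(m/2 <= Y) + a m / 2 + a^2 Y^2 / 4] with [a = m / S]. *)
Lemma paley_zygmund (Y : T -> R) (m S : R) :
  measurable_fun setT Y -> (forall x, 0 <= Y x) -> 0 <= m -> 0 < S ->
  (m%:E <= \int[P]_x (Y x)%:E)%E -> (\int[P]_x (Y x ^+ 2)%:E <= S%:E)%E ->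
  ((m ^+ 2 / (4 * S))%:E <= P [set x | m / 2 <= Y x]%R)%E.
Proof.
move=> mY Y0 m0 S0 hm hS; pose a := m / S.
have a0 : 0 <= a by rewrite divr_ge0// ltW.
set B := [set x | _].
have mB : measurable B.
  rewrite -[X in measurable X]setTI.
  exact: (measurable_fun_le measurableT (measurable_cst _) mY).
have mY2 : measurable_fun setT (fun x => (Y x ^+ 2)%:E).
  by apply/measurable_EFinP; exact: measurable_funX.
have mYE : measurable_fun setT (fun x => (Y x)%:E) by apply/measurable_EFinP.
have I1 : (\int[P]_x (a * Y x)%:E = a%:E * \int[P]_x (Y x)%:E)%E.
  under eq_integral do rewrite EFinM.
  by rewrite ge0_integralZl// => x _; rewrite lee_fin.
have I2 : (\int[P]_x ((\1_B x)%:E + ((a * m / 2)%:E + (a ^+ 2 / 4 * Y x ^+ 2)%:E)) =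
   P B + ((a * m / 2)%:E + (a ^+ 2 / 4)%:E * \int[P]_x (Y x ^+ 2)%:E))%E.
  have b0 : 0 <= a ^+ 2 / 4 by rewrite divr_ge0// sqr_ge0.
  have c0 : 0 <= a * m / 2 by rewrite divr_ge0// mulr_ge0.
  have mb : measurable_fun setT (fun x => (a ^+ 2 / 4 * Y x ^+ 2)%:E).
    by apply/measurable_EFinP; apply: measurable_funM => //; exact: measurable_funX.
  have m1 : measurable_fun setT (fun x => (\1_B x)%:E : \bar R).
    by apply/measurable_EFinP; exact: measurable_indic.
  have p1 (x : T) : setT x -> (0 <= (\1_B x)%:E :> \bar R)%E by rewrite lee_fin.
  have p2 (x : T) : setT x -> (0 <= (a ^+ 2 / 4 * Y x ^+ 2)%:E)%E.
    by rewrite lee_fin mulr_ge0// sqr_ge0.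
  have p3 (x : T) : setT x -> (0 <= (a * m / 2)%:E + (a ^+ 2 / 4 * Y x ^+ 2)%:E)%E.
    by move=> xT; rewrite adde_ge0// ?p2// lee_fin.
  have m3 : measurable_fun setT (fun x => (a * m / 2)%:E + (a ^+ 2 / 4 * Y x ^+ 2)%:E)%E.
    exact: emeasurable_funD.
  rewrite (ge0_integralD _ measurableT p1 m1 p3 m3).
  rewrite integral_indic// setIT; congr (_ + _)%E.
  have p4 (x : T) : setT x -> (0 <= (a * m / 2)%:E)%E by rewrite lee_fin.
  rewrite (ge0_integralD _ measurableT p4 (measurable_cst _) p2 mb)//.
  rewrite integral_cst// (_ : (_ * _)%E = (a * m / 2)%:E); last first.
    by rewrite -[RHS]mule1; congr (_ * _)%E; exact: probability_setT.
  congr (_ + _)%E.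
  under eq_integral do rewrite EFinM.
  by rewrite ge0_integralZl// => x _; rewrite lee_fin sqr_ge0.
have h : (a%:E * m%:E <= P B + ((a * m / 2)%:E + (a ^+ 2 / 4)%:E * S%:E))%E.
  apply: (@le_trans _ _ (a%:E * \int[P]_x (Y x)%:E)%E).
    by rewrite lee_wpmul2l.
  rewrite -I1; apply: (@le_trans _ _ (P B + ((a * m / 2)%:E + (a ^+ 2 / 4)%:E * \int[P]_x (Y x ^+ 2)%:E))%E); last first.
    by rewrite leeD2l// leeD2l// lee_wpmul2l// lee_fin divr_ge0// sqr_ge0.
  move: I2 => /eqP; rewrite eq_le => /andP[I2 _]; apply: le_trans I2.
  apply: ge0_le_integral => //.
  - by move=> x _; rewrite lee_fin mulr_ge0.
  - by apply/measurable_EFinP; exact: measurable_funM.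
  - apply: emeasurable_funD; first by apply/measurable_EFinP; exact: measurable_indic.
    apply: emeasurable_funD => //.
    by apply/measurable_EFinP; apply: measurable_funM => //; exact: measurable_funX.
  move=> x _; rewrite -!EFinD lee_fin.
  have Yx := Y0 x; have := sqr_ge0 (a * Y x - 2).
  have am := mulr_ge0 a0 m0; have aY := mulr_ge0 a0 Yx.
  have [xB|xB] := pselect (B x).
    by rewrite indicE mem_set//= => hh; nra.
  rewrite indicE memNset//= add0r => _.
  have : Y x < m / 2 by rewrite ltNge; apply/negP.
  by move=> hh; nra.
move: h; rewrite -(fineK (fin_num_measure P B mB)).
rewrite -!EFinM -!EFinD !lee_fin => h.
have -> : m ^+ 2 / (4 * S) = a * m - (a * m / 2 + a ^+ 2 / 4 * S).
  by rewrite /a; field; rewrite gt_eqF.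
by rewrite lerBlDr.
Qed.

End probability_inequalities.

Section random_direction.
Context (R : realType).

Lemma measurable_dot_pow d (T : measurableType d) n (f g : T -> borel_rV R n) k :
  measurable_fun [set: T] f -> measurable_fun [set: T] g ->
  measurable_fun [set: T] (fun x => (dot (f x) (g x) ^+ k)%:E).
Proof.
by move=> mf mg; apply/measurable_EFinP; apply: measurable_funX; exact: measurable_dot.
Qed.

Lemma fubini_dot_pow n (Q sigma : probability (borel_rV R n) R) k :
  (\int[sigma]_theta \int[Q]_x (dot (x : 'rV[R]_n) theta ^+ (2 * k))%:E =
   \int[Q]_x \int[sigma]_theta (dot (x : 'rV[R]_n) theta ^+ (2 * k))%:E)%E.
Proof.
pose f (z : borel_rV R n * borel_rV R n) := (dot (z.2 : 'rV[R]_n) z.1 ^+ (2 * k))%:E.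
have mf : measurable_fun [set: borel_rV R n * borel_rV R n] f.
  by apply: measurable_dot_pow; [exact: measurable_snd | exact: measurable_fst].
have f0 z : (0 <= f z)%E by rewrite lee_fin even_power_ge0.
exact: (@fubini_tonelli _ _ _ _ _ sigma Q f mf f0).
Qed.

Lemma measurable_integral_dot_pow n (Q : probability (borel_rV R n) R) k :
  measurable_fun [set: borel_rV R n]
    (fun theta => \int[Q]_x (dot (x : 'rV[R]_n) theta ^+ (2 * k))%:E)%E.
Proof.
pose f (z : borel_rV R n * borel_rV R n) := (dot (z.2 : 'rV[R]_n) z.1 ^+ (2 * k))%:E.
have mf : measurable_fun [set: borel_rV R n * borel_rV R n] f.
  by apply: measurable_dot_pow; [exact: measurable_snd | exact: measurable_fst].
have f0 z : (0 <= f z)%E by rewrite lee_fin even_power_ge0.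
exact: (@measurable_fun_fubini_tonelli_F _ _ _ _ _ Q f mf f0).
Qed.

Lemma double_moment_le : exists2 C : R, 1 <= C &
  forall (n : nat) (p : R) (Q sigma : probability (borel_rV R n) R) k,
  (0 < n)%N -> 1 <= p -> is_cone_law p Q -> is_uniform_on_sphere sigma ->
  (0 < k)%N -> (k ^ 2 <= 16 * n)%N ->
  (\int[sigma]_theta \int[Q]_x (dot (x : 'rV[R]_n) theta ^+ (2 * k))%:E <=
   ((C * (k%:R / (n%:R `^ p^-1) ^+ 2)) ^+ k)%:E)%E.
Proof.
have [C C1 hC] := sqrnorm_moment R.
exists (128 * C); first by rewrite mulr_ege1// ler1n.
move=> n p Q sigma k n0 p1 QE us k0 kn.
have C0 : 0 <= C by rewrite (le_trans ler01).
rewrite fubini_dot_pow.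
have nR : 0 < n%:R :> R by rewrite ltr0n.
have nu0 : 0 < n%:R `^ p^-1 :> R by rewrite powR_gt0.
pose a : R := 128 * k%:R / n%:R.
have a0 : 0 <= a by rewrite divr_ge0// mulr_ge0.
apply: (@le_trans _ _ (\int[Q]_x ((a ^+ k)%:E * (dot (x : 'rV[R]_n) x ^+ k)%:E))%E).
  apply: ge0_le_integral => //.
  - by move=> x _; apply: integral_ge0 => theta _; rewrite lee_fin even_power_ge0.
  - pose f (z : borel_rV R n * borel_rV R n) := (dot (z.1 : 'rV[R]_n) z.2 ^+ (2 * k))%:E.
    have mf : measurable_fun [set: borel_rV R n * borel_rV R n] f.
      by apply: measurable_dot_pow; [exact: measurable_fst | exact: measurable_snd].
    have f0 z : (0 <= f z)%E by rewrite lee_fin even_power_ge0.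
    exact: (@measurable_fun_fubini_tonelli_F _ _ _ _ _ sigma f mf f0).
  - apply: measurable_funeM; by apply: measurable_dot_pow; exact: measurable_id.
  - move=> x _; apply: (le_trans (integral_sphere_dot_even us x n0 k0)).
    rewrite -EFinM lee_fin -exprMn le_eqVlt; apply/orP; left; apply/eqP; congr (_ ^+ _).
    by rewrite /a; field; rewrite gt_eqF.
rewrite ge0_integralZl//; last 3 first.
- by apply: measurable_dot_pow; exact: measurable_id.
- by move=> x _; rewrite lee_fin exprn_ge0// dot_ge0.
- by rewrite lee_fin exprn_ge0.
apply: (le_trans (lee_wpmul2l _ (hC n p Q k n0 p1 QE k0 kn))).
  by rewrite lee_fin exprn_ge0.
rewrite -EFinM lee_fin -exprMn le_eqVlt; apply/orP; left; apply/eqP; congr (_ ^+ _).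
by rewrite /a; field; rewrite !gt_eqF.
Qed.

(** [F1] is the sum of the [theta_i^4] and [F2] the moment of order [4k], each scaled to have mean
    at most 1/4, so that [F1 + F2 < 1] with probability at least 1/2. Fourth powers give [theta_i^2]
    of order [1 / sqrt n], enough for [k] up to order [sqrt n]; order [4k] is the second moment that
    Paley-Zygmund needs for [<x, theta>^(2k)]. *)
Lemma good_directions : exists2 C : R, 1 <= C &
  forall (n : nat) (p : R) (Q sigma : probability (borel_rV R n) R) k,
  (0 < n)%N -> 1 <= p -> is_cone_law p Q -> is_uniform_on_sphere sigma ->
  (0 < k)%N -> ((2 * k) ^ 2 <= 16 * n)%N ->
  exists G : set (borel_rV R n), [/\ measurable G, G `<=` @unit_sphere R n,
    (2^-1%:E <= sigma G)%E &
    forall theta : 'rV[R]_n, G theta ->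
      (forall i, (theta ord0 i ^+ 2) ^+ 2 <= C / n%:R) /\
      (\int[Q]_x (dot (x : 'rV[R]_n) theta ^+ (2 * (2 * k)))%:E <=
       ((C * (k%:R / (n%:R `^ p^-1) ^+ 2)) ^+ (2 * k))%:E)%E].
Proof.
have [C C1 hC] := double_moment_le.
pose K : R := 128 * 2.
have K1 : 1 <= K by rewrite mulr_ege1// ler1n.
have K0 : 0 < K by rewrite (lt_le_trans ltr01).
have C0 : 0 < C by rewrite (lt_le_trans ltr01).
have e4K : 1 <= 4 * K ^+ 2 by rewrite mulr_ege1 ?ler1n// exprn_ege1.
exists (4 * K ^+ 2 * C); first by rewrite mulr_ege1.
move=> n p Q sigma k n0 p1 QE us k0 kn.
have nR : 0 < n%:R :> R by rewrite ltr0n.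
have nu0 : 0 < n%:R `^ p^-1 :> R by rewrite powR_gt0.
have kR : 0 < k%:R :> R by rewrite ltr0n.
have k2 : (0 < 2 * k)%N by rewrite muln_gt0.
pose D : R := (C * ((2 * k)%:R / (n%:R `^ p^-1) ^+ 2)) ^+ (2 * k).
have D0 : 0 < D by rewrite exprn_gt0// mulr_gt0// divr_gt0 ?exprn_gt0// ltr0n.
pose a : R := n%:R / (4 * K ^+ 2); pose b : R := (4 * D)^-1.
have a0 : 0 < a by rewrite divr_gt0// (lt_le_trans ltr01).
have b0 : 0 < b by rewrite invr_gt0 mulr_gt0.
pose F1 (theta : borel_rV R n) : \bar R :=
  (\sum_(i < n) a%:E * (((theta : 'rV[R]_n) ord0 i) ^+ (2 * 2))%:E)%E.
pose F2 (theta : borel_rV R n) : \bar R :=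
  (b%:E * \int[Q]_x (dot (x : 'rV[R]_n) theta ^+ (2 * (2 * k)))%:E)%E.
have mcoord i : measurable_fun [set: borel_rV R n]
    (fun theta : borel_rV R n => (((theta : 'rV[R]_n) ord0 i) ^+ (2 * 2))%:E).
  by apply/measurable_EFinP; apply: measurable_funX; exact: measurable_coord.
have F10 theta : (0 <= F1 theta)%E.
  by apply: sume_ge0 => i _; rewrite -EFinM lee_fin mulr_ge0 ?(ltW a0)// even_power_ge0.
have F20 theta : (0 <= F2 theta)%E.
  apply: mule_ge0; first by rewrite lee_fin ltW.
  by apply: integral_ge0 => x _; rewrite lee_fin even_power_ge0.
have mF1 : measurable_fun [set: borel_rV R n] F1.
  by apply: emeasurable_sum => i; apply: measurable_funeM; exact: mcoord.
have mF2 : measurable_fun [set: borel_rV R n] F2.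
  by apply: measurable_funeM; exact: measurable_integral_dot_pow.
have I1 : (\int[sigma]_theta F1 theta <= 4^-1%:E)%E.
  rewrite ge0_integral_sum//; last 2 first.
  - by move=> i; apply: measurable_funeM; exact: mcoord.
  - by move=> i theta _; rewrite -EFinM lee_fin mulr_ge0 ?(ltW a0)// even_power_ge0.
  apply: (@le_trans _ _ (\sum_(i < n) (a * (K / n%:R) ^+ 2)%:E)%E); last first.
    rewrite sumEFin lee_fin sumr_const card_ord -[leLHS]mulr_natr.
    rewrite le_eqVlt; apply/orP; left; apply/eqP; rewrite /a; field.
    by rewrite !gt_eqF.
  apply: lee_sum => i _.
  rewrite ge0_integralZl ?lee_fin ?(ltW a0)//; last by move=> x _; rewrite lee_fin even_power_ge0.
  rewrite [leRHS]EFinM; apply: lee_wpmul2l; first by rewrite lee_fin (ltW a0).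
  have := integral_sphere_dot_even us (delta_mx ord0 i) n0 (isT : (0 < 2)%N).
  have dE (y : 'rV[R]_n) : dot (delta_mx ord0 i) y = y ord0 i.
    rewrite /dot (bigD1 i)//= mxE !eqxx mul1r big1 ?addr0// => j ji.
    by rewrite mxE eqxx (negbTE ji) mul0r.
  have -> : (\int[sigma]_theta (dot (delta_mx ord0 i) theta ^+ (2 * 2))%:E =
      \int[sigma]_theta ((theta : 'rV[R]_n) ord0 i ^+ (2 * 2))%:E)%E.
    by apply: eq_integral => y _; congr (_ ^+ _)%:E; exact: dE.
  move=> /le_trans; apply; rewrite lee_fin dE mxE !eqxx /K.
  by rewrite !mul1r.
have I2 : (\int[sigma]_theta F2 theta <= 4^-1%:E)%E.
  rewrite ge0_integralZl ?lee_fin ?(ltW b0)//; last 2 first.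
  - exact: measurable_integral_dot_pow.
  - by move=> theta _; apply: integral_ge0 => x _; rewrite lee_fin even_power_ge0.
  apply: (le_trans (lee_wpmul2l _ (hC n p Q sigma (2 * k)%N n0 p1 QE us k2 kn))).
    by rewrite lee_fin ltW.
  rewrite -EFinM lee_fin -/D /b le_eqVlt; apply/orP; left; apply/eqP.
  by field; rewrite gt_eqF.
have IF : (\int[sigma]_theta (F1 theta + F2 theta) <= 2^-1%:E)%E.
  rewrite ge0_integralD// (_ : 2^-1%:E = 4^-1%:E + 4^-1%:E)%E ?leeD//.
  by rewrite -EFinD; congr _%:E; field.
have [mG sG] := probability_lt1_ge (emeasurable_funD mF1 mF2)
  (fun theta => adde_ge0 (F10 theta) (F20 theta)) IF.
set G := [set _ | _] in mG sG.
exists (G `&` @unit_sphere R n); split.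
- by apply: measurableI => //; exact: measurable_unit_sphere.
- by move=> x [].
- apply: (le_trans sG); pose S := @unit_sphere R n.
  have mS : measurable (S : set (borel_rV R n)) := @measurable_unit_sphere R n.
  have mCS : measurable (~` S : set (borel_rV R n)) by exact: measurableC.
  have mGS := measurableI _ _ mG mS; have mGC := measurableI _ _ mG mCS.
  have GE : G = (G `&` S) `|` (G `&` ~` S) by rewrite -setIUr setUv setIT.
  rewrite {1}GE; apply: (le_trans (measureU2 _ mGS mGC)).
  rewrite -[leRHS]adde0; apply: leeD2l.
  have -> : 0%E = sigma (~` S) by rewrite probability_setC// us.1 subee.
  by apply: le_measure; rewrite ?inE//; exact: subIsetr.
move=> theta [Gt _].
have h1 : (F1 theta <= 1)%E by rewrite (le_trans _ (ltW Gt))// leeDl.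
have h2 : (F2 theta <= 1)%E by rewrite (le_trans _ (ltW Gt))// leeDr.
split.
  move=> i; move: h1; rewrite /F1 (eq_bigr (fun i => (a * theta ord0 i ^+ (2 * 2))%:E)); last first.
    by move=> j _; rewrite EFinM.
  rewrite sumEFin lee_fin (bigD1 i)//= => h.
  have : a * theta ord0 i ^+ (2 * 2) <= 1.
    apply: le_trans h; rewrite lerDl; apply: sumr_ge0 => j _.
    by rewrite mulr_ge0 ?(ltW a0)// even_power_ge0.
  rewrite exprM mulrC -ler_pdivlMr// => /le_trans; apply.
  rewrite /a div1r invf_div ler_pM2r ?invr_gt0// ler_peMr// (le_trans ler01)//.
move: h2; rewrite /F2; set J := (\int[Q]_x _)%E => h2.
apply: (@le_trans _ _ (4 * D)%:E).
  have -> : (4 * D)%:E = ((4 * D)%:E * 1)%E by rewrite mule1.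
  have -> : J = ((4 * D)%:E * (b%:E * J))%E.
    by rewrite muleA -EFinM /b mulfV ?mul1e// gt_eqF// mulr_gt0.
  by rewrite lee_wpmul2l// lee_fin ltW// mulr_gt0.
rewrite lee_fin /D.
apply: (@le_trans _ _ (2 ^+ (2 * k) * (C * ((2 * k)%:R / (n%:R `^ p^-1) ^+ 2)) ^+ (2 * k))).
  rewrite ler_wpM2r ?(ltW D0)//.
  have -> : 4 = 2 ^+ 2 :> R by ring.
  by rewrite ler_weXn2l ?ler1n// leq_pmulr.
rewrite -exprMn lerXn2r ?nnegrE ?mulr_ge0 ?divr_ge0 ?exprn_ge0 ?(ltW K0) ?(ltW C0) ?(ltW nu0)//.
have -> : 2 * (C * ((2 * k)%:R / n%:R `^ p^-1 ^+ 2)) = 4 * C * (k%:R / n%:R `^ p^-1 ^+ 2).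
  by rewrite natrM; ring.
rewrite ler_wpM2r ?divr_ge0 ?exprn_ge0 ?(ltW nu0)//.
have : 1 <= K ^+ 2 by rewrite exprn_ege1.
move: (K ^+ 2) => L L1; nra.
Qed.

End random_direction.

Section tail_lower_bound.
Context (R : realType).

(** The order is [k = floor (t/K) + 1], positive even for small [t]; [K >= 2] gives
    [4 (k - 1)^2 <= n], which leaves room for the added 1 in both size conditions. *)
Lemma moment_order (n : nat) (K t : R) : (0 < n)%N -> 2 <= K -> 0 <= t -> t <= Num.sqrt n%:R ->
  exists k, [/\ (0 < k)%N, (k <= n)%N, ((2 * k) ^ 2 <= 16 * n)%N,
    k.-1%:R * K <= t & t <= k%:R * K].
Proof.
move=> n0 K2 t0 tn; have K0 : 0 < K by lra.
have /andP[h1 h2] := Num.Theory.truncn_itv (divr_ge0 t0 (ltW K0)).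
set j := Num.truncn (t / K) in h1 h2.
have jt : j%:R * K <= t by rewrite -ler_pdivlMr.
exists j.+1; split => //.
- have s2 : Num.sqrt n%:R ^+ 2 = n%:R :> R by rewrite sqr_sqrtr.
  have : (2 * j%:R) ^+ 2 <= n%:R :> R.
    rewrite -s2 lerXn2r ?nnegrE ?mulr_ge0 ?sqrtr_ge0//.
    by apply: le_trans tn; apply: le_trans jt; rewrite mulrC ler_wpM2l.
  rewrite -natrM -natrX ler_nat => h; nia.
- have s2 : Num.sqrt n%:R ^+ 2 = n%:R :> R by rewrite sqr_sqrtr.
  have : (2 * j%:R) ^+ 2 <= n%:R :> R.
    rewrite -s2 lerXn2r ?nnegrE ?mulr_ge0 ?sqrtr_ge0//.
    by apply: le_trans tn; apply: le_trans jt; rewrite mulrC ler_wpM2l.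
  rewrite -natrM -natrX ler_nat => h; nia.
- by rewrite -ler_pdivrMr// ltW.
Qed.

Lemma even_power_half_le (a y : R) k : (0 < k)%N -> 0 <= a ->
  a ^+ k / 2 <= y ^+ (2 * k) -> a / 2 <= y ^+ 2.
Proof.
move=> k0 a0 h; rewrite leNgt; apply/negP => ya.
move: h; rewrite leNgt exprM => /negP; apply.
have a20 : 0 < a by have := sqr_ge0 y; lra.
apply: (@lt_le_trans _ _ ((a / 2) ^+ k)).
  by rewrite ltr_pXn2r ?nnegrE ?sqr_ge0// ltW// divr_gt0.
rewrite expr_div_n ler_pM2l ?exprn_gt0// lef_pV2 ?posrE ?exprn_gt0//.
by rewrite -[leLHS]expr1 ler_weXn2l// ler1n.
Qed.

Lemma moment_ratio (c C r : R) k : 0 < c -> 0 < C -> 0 < r ->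
  ((c * r) ^+ k) ^+ 2 / (4 * (C * r) ^+ (2 * k)) = (4 * ((C / c) ^+ 2) ^+ k)^-1.
Proof.
move=> c0 C0 r0; rewrite mulnC [_ ^+ (k * 2)]exprM (exprAC _ 2 k) !exprMn exprVn.
have := exprn_gt0 k c0; have := exprn_gt0 k C0; have := exprn_gt0 k r0.
move: (c ^+ k) (C ^+ k) (r ^+ k) => x y z z0 y0 x0.
by field; rewrite !gt_eqF.
Qed.

Lemma tail_ge : exists c c0 : R, [/\ 0 < c, 0 < c0 &
  forall (n : nat) (p : R) (Q sigma : probability (borel_rV R n) R) t,
  (0 < n)%N -> 1 <= p -> is_cone_law p Q -> is_uniform_on_sphere sigma ->
  0 <= t -> t <= Num.sqrt n%:R ->
  exists G : set (borel_rV R n), [/\ measurable G, G `<=` @unit_sphere R n,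
    (2^-1%:E <= sigma G)%E &
    forall theta : 'rV[R]_n, G theta ->
      ((c0 * expR (- t))%:E <=
       Q [set x : borel_rV R n | c * Num.sqrt t / n%:R `^ p^-1 <= `|dot (x : 'rV[R]_n) theta|]%R)%E]].
Proof.
have [c2 c20 hc] := dot_moment_ge R.
have [C C1 hC] := good_directions R.
pose c1 := Num.min c2 1.
have c10 : 0 < c1 by rewrite lt_min c20 ltr01.
have c11 : c1 <= 1 by rewrite ge_min lexx orbT.
have c12 : c1 <= c2 by rewrite ge_min lexx.
have C0 : 0 < C by rewrite (lt_le_trans ltr01).
pose D := (C / c1) ^+ 2.
have D0 : 0 < D by rewrite exprn_gt0// divr_gt0.
(* [2 C] makes [(k - 1) C / sqrt n <= 1/2], the flatness required by [dot_moment_ge]; [D], the base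
   of the Paley-Zygmund ratio [1 / (4 D^k)], makes [D^(k-1) <= e^t]. *)
pose K := 2 * C + D.
have K2 : 2 <= K by rewrite /K; lra.
have K0 : 0 < K by lra.
exists (Num.sqrt (c1 / (2 * K))), (4 * D)^-1; split.
- by rewrite sqrtr_gt0 divr_gt0// mulr_gt0.
- by rewrite invr_gt0 mulr_gt0.
move=> n p Q sigma t n0 p1 QE us t0 tn.
have [k [k0 kn kkn kt tk]] := moment_order n0 K2 t0 tn.
have [G [mG GS sG hG]] := hC n p Q sigma k n0 p1 QE us k0 kkn.
exists G; split => // theta Gt; have [hM hS] := hG theta Gt.
have nR : 0 < n%:R :> R by rewrite ltr0n.
have kR : 0 < k%:R :> R by rewrite ltr0n.
set nu := n%:R `^ p^-1 in hS *.
have nu0 : 0 < nu by rewrite powR_gt0.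
have s0 : 0 < Num.sqrt n%:R :> R by rewrite sqrtr_gt0.
have hm : (((c2 * (k%:R / nu ^+ 2)) ^+ k)%:E <= \int[Q]_x (dot (x : 'rV[R]_n) theta ^+ (2 * k))%:E)%E.
  apply: (hc n p Q theta (C / Num.sqrt n%:R) k) => //; first exact: GS.
  - move=> i; rewrite -(ler_pXn2r (isT : (0 < 2)%N)) ?nnegrE ?sqr_ge0 ?divr_ge0 ?(ltW C0) ?(ltW s0)//.
    rewrite expr_div_n sqr_sqrtr//; apply: (le_trans (hM i)).
    by rewrite ler_pM2r ?invr_gt0// expr2 ler_peMr// ltW.
  - rewrite mulrA ler_pdivrMr//.
    have : k.-1%:R * K <= Num.sqrt n%:R := le_trans kt tn.
    rewrite /K; have := ler0n R k.-1; move: (k.-1%:R) (Num.sqrt n%:R) => j s j0.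
    by have := mulr_ge0 j0 (ltW D0); lra.
pose m := (c1 * (k%:R / nu ^+ 2)) ^+ k.
pose S := (C * (k%:R / nu ^+ 2)) ^+ (2 * k).
have r0 : 0 < k%:R / nu ^+ 2 by rewrite divr_gt0// exprn_gt0.
have m0 : 0 <= m by rewrite exprn_ge0// ltW// mulr_gt0.
have S0 : 0 < S by rewrite exprn_gt0// mulr_gt0.
have mY : measurable_fun [set: borel_rV R n] (fun x : borel_rV R n => dot (x : 'rV[R]_n) theta ^+ (2 * k)).
  apply: measurable_funX; apply: measurable_dot; first exact: measurable_id.
  exact: measurable_cst.
have hm' : (m%:E <= \int[Q]_x (dot (x : 'rV[R]_n) theta ^+ (2 * k))%:E)%E.
  apply: le_trans hm; rewrite lee_fin lerXn2r ?nnegrE ?ler_wpM2r ?(ltW r0)//.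
    by rewrite mulr_ge0// ltW.
  by rewrite mulr_ge0// ltW.
have hS' : (\int[Q]_x ((dot (x : 'rV[R]_n) theta ^+ (2 * k)) ^+ 2)%:E <= S%:E)%E.
  apply: le_trans hS; rewrite le_eqVlt; apply/orP; left; apply/eqP.
  by apply: eq_integral => x _; rewrite -exprM; congr (_ ^+ _)%:E; ring.
have := paley_zygmund mY (fun x => even_power_ge0 _ _) m0 S0 hm' hS'.
have mB : measurable [set x : borel_rV R n | m / 2 <= dot (x : 'rV[R]_n) theta ^+ (2 * k)].
  rewrite -[X in measurable X]setTI.
  exact: (measurable_fun_le measurableT (measurable_cst _) mY).
have mE : measurable [set x : borel_rV R n |
    Num.sqrt (c1 / (2 * K)) * Num.sqrt t / nu <= `|dot (x : 'rV[R]_n) theta|].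
  rewrite -[X in measurable X]setTI.
  apply: (measurable_fun_le measurableT (measurable_cst _)).
  apply: measurableT_comp => //; apply: measurable_dot; first exact: measurable_id.
  exact: measurable_cst.
move=> h; apply: (@le_trans _ _ (m ^+ 2 / (4 * S))%:E); last first.
  apply: (le_trans h); apply: le_measure; rewrite ?inE// => x /= hx.
  have h2 : c1 * (k%:R / nu ^+ 2) / 2 <= dot x theta ^+ 2.
    by apply: (even_power_half_le k0) hx; rewrite ltW// mulr_gt0.
  rewrite -(ler_pXn2r (isT : (0 < 2)%N)) ?nnegrE ?divr_ge0 ?mulr_ge0 ?sqrtr_ge0 ?(ltW nu0)//.
  rewrite real_normK ?num_real// expr_div_n exprMn !sqr_sqrtr//; last first.
    by rewrite divr_ge0// ltW// mulr_gt0.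
  apply: le_trans h2.
  have -> : c1 / (2 * K) * t / nu ^+ 2 = (c1 / (2 * K * nu ^+ 2)) * t.
    by field; rewrite !gt_eqF.
  have -> : c1 * (k%:R / nu ^+ 2) / 2 = (c1 / (2 * K * nu ^+ 2)) * (k%:R * K).
    by field; rewrite !gt_eqF.
  by rewrite ler_wpM2l// ltW// divr_gt0// !mulr_gt0 ?exprn_gt0.
rewrite lee_fin.
have -> : m ^+ 2 / (4 * S) = (4 * D ^+ k)^-1.
  exact: moment_ratio.
(* Only [k - 1] factors fit into [e^t], through [D <= e^D]; the remaining one is the [D] in the
   constant [1 / (4 D)]. *)
have Dk : D ^+ k.-1 <= expR t.
  apply: (@le_trans _ _ (expR (k.-1%:R * D))).
    rewrite expRM_natl lerXn2r ?nnegrE ?expR_ge0 ?(ltW D0)//.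
    by apply: le_trans (expR_ge1Dx D); rewrite lerDr.
  rewrite ler_expR; apply: le_trans kt; rewrite ler_wpM2l// /K lerDr.
  by rewrite mulr_ge0// ltW.
have Dk1 : 0 < 4 * D ^+ k.-1.+1 by rewrite mulr_gt0// exprn_gt0.
rewrite -(prednK k0) expRN -invfM lef_pV2 ?posrE//; last first.
  by apply: mulr_gt0 (expR_gt0 t); exact: mulr_gt0.
rewrite exprS.
by rewrite mulrA ler_wpM2l// mulr_ge0// ltW.
Qed.

End tail_lower_bound.

(** * Order statistics *)

Section order_statistics.
Context (R : realType).
Implicit Types (s : seq R) (v : R).

Lemma nth_sorted_ge s v j : sorted >=%R s -> (j < size s)%N ->
  (v <= nth 0 s j) = (j < count (fun x => v <= x)%R s)%N.
Proof.
elim: s j => [|x s IH] j //= xs js.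
have /allP xs' : all (fun y => y <= x) s
  by apply: order_path_min xs => b a c /= ba cb; exact: le_trans cb ba.
have [vx|xv] /= := leP v x.
  case: j js => [|j] /= js; first by rewrite vx.
  by rewrite ltnS in js; rewrite IH// (path_sorted xs).
rewrite add0n (eq_in_count (a2 := pred0)); last first.
  by move=> y /xs' yx /=; apply/negbTE; rewrite -ltNge (le_lt_trans yx).
rewrite count_pred0 ltn0; case: j js => [|j] /= js; first by rewrite leNgt xv.
by apply/negbTE; rewrite -ltNge (le_lt_trans (xs' _ _) xv)// mem_nth.
Qed.

Variable N : nat.
Implicit Types a b : 'I_N -> R.

Let desc a := sort >=%R [seq a i | i : 'I_N].

Let size_desc a : size (desc a) = N.
Proof. by rewrite size_sort size_map size_enum_ord. Qed.

Let sorted_desc a : sorted >=%R (desc a).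
Proof. by apply: sort_sorted => x y; rewrite /= le_total. Qed.

Let sum_desc a (f : R -> R) : \sum_(x <- desc a) f x = \sum_i f (a i).
Proof. by rewrite (perm_big [seq a i | i : 'I_N]) ?perm_sort//= big_map enumT. Qed.

(** Turns order statistics into counting; the lower bound for their sum and their measurability both
    rest on it. *)
Lemma kmax_geE a k v : (0 < k <= N)%N ->
  (v <= kmax k a) = (k <= \sum_(i < N) (v <= a i)%R)%N.
Proof.
case/andP; case: k => // k _ kN.
rewrite /kmax/= -/(desc a) nth_sorted_ge ?size_desc ?sorted_desc//.
by rewrite -sum1_count big_mkcond (perm_big [seq a i | i : 'I_N]) ?perm_sort//= big_map enumT;
  congr (_ < _)%N; apply: eq_bigr => i _; case: (v <= a i).
Qed.

Lemma kmax_ge0 a k : (forall i, 0 <= a i) -> 0 <= kmax k a.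
Proof.
move=> a0; rewrite /kmax -/(desc a).
have [h|h] := ltnP k.-1 (size (desc a)); last by rewrite nth_default.
have := mem_nth 0 h; rewrite mem_sort => /mapP[i _ ->]; exact: a0.
Qed.

Lemma sum_kmax_ge a l v : (l <= N)%N -> (forall i, 0 <= a i) ->
  v *+ minn (\sum_(i < N) (v <= a i)%R) l <= \sum_(1 <= k < l.+1) kmax k a.
Proof.
move=> lN a0; set m := minn _ l.
have ml : (m <= l)%N by exact: geq_minr.
rewrite (@big_cat_nat _ _ _ m.+1)//= -[leLHS]addr0 lerD//; last first.
  by apply: sumr_ge0 => k _; exact: kmax_ge0.
have -> : v *+ m = \sum_(1 <= k < m.+1) v by rewrite sumr_const_nat subn1.
rewrite !big_nat; apply: ler_sum => k.
move=> /andP[k0 km]; have kl : (k <= minn (\sum_(i < N) (v <= a i)%R) l)%N by [].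
by rewrite kmax_geE ?k0 ?(leq_trans kl) ?geq_minl// (leq_trans (geq_minr _ _)).
Qed.

(** Each of the [l] largest entries is at most [c] plus its excess over [c]; the excesses are
    nonnegative, so they may be summed over all indices, in any order. *)
Lemma sum_kmax_le a b l (c : R) : (l <= N)%N ->
  (forall i, 0 <= b i) -> (forall i, a i <= c + b i) ->
  \sum_(1 <= k < l.+1) kmax k a <= c *+ l + \sum_i b i.
Proof.
move=> lN b0 ab; rewrite big_add1/= big_mkord.
pose f (x : R) := Num.max (x - c) 0.
have f0 x : 0 <= f x by rewrite le_max lexx orbT.
apply: (@le_trans _ _ (\sum_(j < l) (c + f (nth 0 (desc a) j)))).
  by apply: ler_sum => j _; rewrite -lerBlDl le_max lexx.
rewrite big_split/= sumr_const card_ord lerD2l.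
apply: (@le_trans _ _ (\sum_i f (a i))); last first.
  by apply: ler_sum => i _; rewrite ge_max b0 lerBlDl ab.
rewrite -(sum_desc a f) (big_nth 0) size_desc -(big_mkord xpredT (fun j => f (nth 0 (desc a) j))).
rewrite (@big_cat_nat _ _ _ l 0 N)//= lerDl; exact: sumr_ge0.
Qed.

Lemma measurable_kmax d (T : measurableType d) (a : 'I_N -> T -> R) k :
  (0 < k <= N)%N -> (forall i, measurable_fun setT (a i)) ->
  measurable_fun setT (fun x => kmax k (fun i => a i x)).
Proof.
move=> kN ma; apply: (measurability (@RGenCInfty.G R)) => [|/= _ [_] [v] -> <-].
  exact: RGenCInfty.measurableE.
rewrite setTI (_ : _ @^-1` _ =
    [set x | k%:R <= \sum_(i < N) (\1_[set y | v <= a i y] x : R)]); last first.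
  apply/seteqP; split => x /=; rewrite in_itv/= andbT kmax_geE//.
    rewrite -(ler_nat R) natr_sum => /le_trans; apply; apply: ler_sum => i _.
    by rewrite indicE (_ : (x \in _) = (v <= a i x)) //; apply/idP/idP; rewrite inE.
  rewrite -(ler_nat R) natr_sum => /le_trans; apply; apply: ler_sum => i _.
  by rewrite indicE (_ : (x \in _) = (v <= a i x)) //; apply/idP/idP; rewrite inE.
rewrite -[X in measurable X]setTI.
apply: (measurable_fun_le measurableT (measurable_cst _)).
apply: measurable_sum => i; apply: measurable_indic.
by rewrite -[X in measurable X]setTI; exact: (measurable_fun_le measurableT (measurable_cst _) (ma i)).
Qed.

End order_statistics.

Section top_mean_bounds.
Context (R : realType) (n N l : nat) (q : R).
Hypotheses (l0 : (0 < l)%N) (lN : (l <= N)%N) (q1 : 1 <= q).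
Implicit Types (x : 'I_N -> 'rV[R]_n) (theta : 'rV[R]_n).

Let lR : 0 < l%:R :> R. Proof. by rewrite ltr0n. Qed.
Let q0 : 0 < q. Proof. exact: lt_le_trans q1. Qed.

Lemma top_mean_ge0 x theta : 0 <= top_mean l q x theta.
Proof. exact: powR_ge0. Qed.

Let arg_ge0 x theta :
  0 <= l%:R^-1 * \sum_(1 <= k < l.+1) kmax k (fun i => `|dot (x i) theta| `^ q).
Proof.
rewrite mulr_ge0 ?invr_ge0//; apply: sumr_ge0 => k _; apply: kmax_ge0 => i.
exact: powR_ge0.
Qed.

Let powRK (u : R) : 0 <= u -> (u `^ q) `^ q^-1 = u.
Proof. by move=> u0; rewrite -powRrM mulfV ?gt_eqF// powRr1. Qed.

Lemma top_mean_ge x theta (s : R) : 0 <= s ->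
  s * ((minn (\sum_(i < N) (s <= `|dot (x i) theta|)%R) l)%:R / l%:R) `^ q^-1
    <= top_mean l q x theta.
Proof.
move=> s0; set m := minn _ _.
have -> : s = (s `^ q) `^ q^-1 by rewrite powRK.
rewrite -powRM ?powR_ge0 ?divr_ge0//; apply: ge0_ler_powR.
- by rewrite invr_ge0 ltW.
- by rewrite nnegrE mulr_ge0 ?powR_ge0 ?divr_ge0.
- by rewrite nnegrE arg_ge0.
rewrite mulrA mulrC ler_wpM2l ?invr_ge0// mulr_natr.
have := @sum_kmax_ge R N (fun i => `|dot (x i) theta| `^ q) l (s `^ q) lN (fun i => powR_ge0 _ _).
rewrite (eq_bigr (fun i => nat_of_bool (s <= `|dot (x i) theta|)))// => i _.
congr nat_of_bool; apply/idP/idP => h.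
  rewrite leNgt; apply/negP => h'; move: h; rewrite leNgt => /negP; apply.
  by rewrite gt0_ltr_powR// nnegrE.
by rewrite ge0_ler_powR ?nnegrE// ltW.
Qed.

(** From [v^q <= 1 + v^(2k)] at [v = |<x_i, theta>| / A]; the outer root is removed by
    [(1 + W)^(1/q) <= 1 + W]. *)
Lemma top_mean_le_pow x theta (A : R) k : 0 < A -> q <= (2 * k)%:R ->
  top_mean l q x theta <= A * (1 + l%:R^-1 * \sum_i (dot (x i) theta / A) ^+ (2 * k)).
Proof.
move=> A0 qk; set W := _ * \sum_i _.
have W0 : 0 <= W.
  by rewrite mulr_ge0 ?invr_ge0//; apply: sumr_ge0 => i _; exact: even_power_ge0.
have h : \sum_(1 <= k < l.+1) kmax k (fun i => `|dot (x i) theta| `^ q) <=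
    (A `^ q) *+ l + \sum_i A `^ q * (dot (x i) theta / A) ^+ (2 * k).
  apply: sum_kmax_le => // i; first by rewrite mulr_ge0 ?powR_ge0 ?even_power_ge0.
  pose v := `|dot (x i) theta| / A.
  have v0 : 0 <= v by rewrite divr_ge0// ltW.
  have -> : `|dot (x i) theta| = A * v by rewrite /v mulrC divfK// gt_eqF.
  rewrite powRM ?(ltW A0)// -{2}[A `^ q]mulr1 -mulrDr ler_wpM2l ?powR_ge0//.
  have -> : (dot (x i) theta / A) ^+ (2 * k) = v ^+ (2 * k).
    rewrite /v -{2}(gtr0_norm A0) -normf_div -normrX ger0_norm//.
    exact: even_power_ge0.
  have [v1|v1] := leP v 1.
    rewrite -[leLHS]addr0 lerD ?exprn_ge0//.
    by have := @ge0_ler_powR _ q (ltW q0) v 1; rewrite powR1 !nnegrE; apply.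
  by rewrite -[leLHS]add0r lerD// -powR_mulrn//; apply: ler_powR => //; exact: ltW.
apply: (@le_trans _ _ ((A `^ q * (1 + W)) `^ q^-1)).
  apply: ge0_ler_powR; rewrite ?nnegrE ?arg_ge0 ?invr_ge0 ?(ltW q0)//.
    by rewrite mulr_ge0 ?powR_ge0// addr_ge0.
  rewrite ler_pdivrMl//; apply: (le_trans h).
  by rewrite -mulr_sumr /W -mulr_natr le_eqVlt; apply/orP; left; apply/eqP; field; rewrite gt_eqF.
rewrite powRM ?powR_ge0 ?addr_ge0// powRK ?(ltW A0)// ler_wpM2l ?(ltW A0)//.
by apply: ler1_powR; rewrite ?lerDl// invf_le1.
Qed.

(** The mean is at most the maximum, to which [v <= 1 + v^(2k)] is applied. This serves when [ln N]
    is the minimum defining the level, where [q] may exceed [2k]; the price is the loss of [1/l]. *)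
Lemma top_mean_le_max x theta (A : R) k : 0 < A -> (0 < k)%N ->
  top_mean l q x theta <= A * (1 + \sum_i (dot (x i) theta / A) ^+ (2 * k)).
Proof.
move=> A0 k0; set W := \sum_i _.
have W0 : 0 <= W by apply: sumr_ge0 => i _; exact: even_power_ge0.
have B0 : 0 <= A * (1 + W) by rewrite mulr_ge0 ?addr_ge0// ltW.
have h : \sum_(1 <= k < l.+1) kmax k (fun i => `|dot (x i) theta| `^ q) <=
    ((A * (1 + W)) `^ q) *+ l + \sum_(i < N) 0.
  apply: sum_kmax_le => // i; rewrite addr0.
  apply: ge0_ler_powR; rewrite ?nnegrE ?(ltW q0)//.
  rewrite mulrC -ler_pdivrMr//.
  have -> : `|dot (x i) theta| / A = `|dot (x i) theta / A|.
    by rewrite normf_div (gtr0_norm A0).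
  have Wi : (dot (x i) theta / A) ^+ (2 * k) <= W.
    rewrite /W (bigD1 i)//= lerDl; apply: sumr_ge0 => j _; exact: even_power_ge0.
  have [v1|v1] := leP `|dot (x i) theta / A| 1; first by rewrite (le_trans v1)// lerDl.
  rewrite -[leLHS]add0r lerD//; apply: le_trans Wi.
  rewrite -[leRHS]ger0_norm ?even_power_ge0// normrX.
  by rewrite -[leLHS]expr1 ler_weXn2l ?(ltW v1)// muln_gt0.
rewrite big1_eq addr0 in h.
rewrite -[leRHS]powRK//; apply: ge0_ler_powR; rewrite ?nnegrE ?arg_ge0 ?powR_ge0 ?invr_ge0 ?(ltW q0)//.
by rewrite ler_pdivrMl// mulr_natl.
Qed.

End top_mean_bounds.

Lemma measurable_top_mean (R : realType) d (T : measurableType d) n N l (q : R)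
    (X : 'I_N -> T -> borel_rV R n) (theta : T -> borel_rV R n) :
  (l <= N)%N -> (forall i, measurable_fun setT (X i)) -> measurable_fun setT theta ->
  measurable_fun setT (fun z => top_mean l q (fun i => X i z) (theta z)).
Proof.
move=> lN mX mt; apply: measurable_fun_powR.
apply: measurable_funM => //.
rewrite (_ : (fun z => _) = (fun z => \sum_(k < l)
    kmax k.+1 (fun i => `|dot (X i z) (theta z)| `^ q))); last first.
  by apply/funext => z; rewrite big_add1 big_mkord.
apply: measurable_sum => k; apply: measurable_kmax.
  by rewrite (leq_trans (ltn_ord k)).
move=> i; apply: measurable_fun_powR.
by apply: measurableT_comp => //; exact: measurable_dot.
Qed.

(** * The two bounds on the expected width *)

Section counting.
Context d (T : measurableType d) (R : realType) (P : probability T R).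

(** Pairwise independence bounds the second moment of the count by [m + m^2], so Paley-Zygmund gives
    [m / (4 (1 + m))], which is increasing in [m] and may be evaluated at [b <= m]. *)
Lemma count_ge (N : nat) (E : 'I_N -> set T) (b : R) : 0 < b ->
  (forall i, measurable (E i)) ->
  (forall i j, i != j -> P (E i `&` E j) = (P (E i) * P (E j))%E) ->
  b <= \sum_(i < N) fine (P (E i)) ->
  ((b / (4 * (1 + b)))%:E <= P [set x | b / 2 <= \sum_(i < N) (\1_(E i) x : R)]%R)%E.
Proof.
move=> b0 mE Eij; set m := \sum_i _ => bm; have m0 : 0 < m by exact: lt_le_trans bm.
pose Y (x : T) : R := \sum_(i < N) (\1_(E i) x : R).
have mI i : measurable_fun setT (\1_(E i) : T -> R) by exact: measurable_indic.
have mY : measurable_fun setT Y by exact: measurable_sum.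
have Y0 x : 0 <= Y x by exact: sumr_ge0.
have f_fin i : (fine (P (E i)))%:E = P (E i) by rewrite fineK// fin_num_measure.
have f_ge0 i : 0 <= fine (P (E i)) by rewrite fine_ge0.
have IY : (\int[P]_x (Y x)%:E = m%:E)%E.
  under eq_integral do rewrite /Y -sumEFin.
  rewrite ge0_integral_sum; [|exact: measurableT| |]; last 2 first.
  - by move=> i; apply/measurable_EFinP.
  - by move=> i x _; rewrite lee_fin.
  rewrite /m -sumEFin; apply: eq_bigr => i _.
  by rewrite f_fin integral_indic// setIT.
have IY2 : (\int[P]_x (Y x ^+ 2)%:E <= (m + m ^+ 2)%:E)%E.
  have YE x : (Y x ^+ 2)%:E = (\sum_(i < N) \sum_(j < N) (\1_(E i `&` E j) x : R)%:E)%E.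
    rewrite expr2 /Y mulr_suml -sumEFin; apply: eq_bigr => i _.
    rewrite mulr_sumr -sumEFin; apply: eq_bigr => j _.
    by rewrite indicI.
  under eq_integral do rewrite YE.
  have mIJ i j : measurable (E i `&` E j) by exact: measurableI.
  rewrite ge0_integral_sum; [|exact: measurableT| |]; last 2 first.
  - move=> i; apply: emeasurable_sum => j; apply/measurable_EFinP.
    exact: measurable_indic.
  - by move=> i x _; apply: sume_ge0 => j _; rewrite lee_fin.
  apply: (@le_trans _ _ (\sum_(i < N) (fine (P (E i)) + fine (P (E i)) * m)%:E)%E); last first.
    by rewrite sumEFin lee_fin big_split/= -mulr_suml -/m expr2.
  apply: lee_sum => i _; rewrite ge0_integral_sum; [|exact: measurableT| |]; last 2 first.
  - by move=> j; apply/measurable_EFinP; exact: measurable_indic.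
  - by move=> j x _; rewrite lee_fin.
  rewrite (bigD1 i)//= EFinD; apply: leeD.
    by rewrite integral_indic// setIT setIid f_fin.
  rewrite mulr_sumr -sumEFin [leRHS](bigD1 i)//= -[leLHS]add0e; apply: leeD.
    by rewrite lee_fin mulr_ge0.
  apply: lee_sum => j ji; rewrite integral_indic// setIT.
  apply: (@le_trans _ _ (P (E i `&` E j))); first exact: lexx.
  by rewrite Eij 1?eq_sym// EFinM !f_fin.
have S0 : 0 < m + m ^+ 2 by rewrite addr_gt0// exprn_gt0.
have h := paley_zygmund mY Y0 (ltW m0) S0 (eq_ind_r (fun u => (_ <= u)%E) (lexx _) IY) IY2.
have mle (c : R) : measurable [set x | c <= Y x].
  rewrite -[X in measurable X]setTI.
  exact: (measurable_fun_le measurableT (measurable_cst _) mY).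
apply: (@le_trans _ _ (m ^+ 2 / (4 * (m + m ^+ 2)))%:E).
  rewrite lee_fin.
  have -> : m ^+ 2 / (4 * (m + m ^+ 2)) = m / (4 * (1 + m)).
    by field; rewrite !gt_eqF// ?addr_gt0// ?mulr_gt0// ?addr_gt0.
  rewrite ler_pdivrMr ?mulr_gt0 ?addr_gt0// mulrAC ler_pdivlMr ?mulr_gt0 ?addr_gt0//.
  nra.
apply: (le_trans h); apply: le_measure; rewrite ?inE//.
by move=> x /=; apply: le_trans; rewrite ler_pM2r.
Qed.

End counting.

Section lower_bound.
Context (R : realType).

(** Lets the good directions found for the law of one [X i] serve all the others. *)
Lemma cone_law_unique n (p : R) (Q Q' : probability (borel_rV R n) R) A :
  (0 < n)%N -> 1 <= p -> is_cone_law p Q -> is_cone_law p Q' -> measurable A -> Q A = Q' A.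
Proof.
move=> n0 p1 QE QE' mA; have := QE A mA; rewrite (QE' A mA).
have := lpball_gt0 n p1; have := lpball_fin n p1.
case: (rV_measure R n (lpball p)) => [r| |]// _; rewrite lte_fin => r0.
rewrite -(fineK (fin_num_measure Q A mA)) -(fineK (fin_num_measure Q' A mA)) -!EFinM.
by move=> [] /(mulIf (lt0r_neq0 r0)) ->.
Qed.

(** Whether [t <= q] or [t <= ln (N/l)], one has [(N/l) e^(-t) >= e^(-q)], so the ratio is at least
    [(c/2) e^(-q)]. The root of order [q] reduces [e^(-q)] to [1/e >= 1/4] and does not decrease
    [c/2 <= 1]. *)
Lemma minn_ratio_ge (N l M : nat) (q t c : R) : (0 < l)%N -> (l <= N)%N -> 1 <= q ->
  0 < c -> c <= 1 -> t <= Num.max q (ln (N%:R / l%:R)) ->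
  N%:R * (c * expR (- t)) / 2 <= M%:R ->
  c / 8 <= ((minn M l)%:R / l%:R) `^ q^-1.
Proof.
move=> l0 lN q1 c0 c1 tq hM.
have lR : 0 < l%:R :> R by rewrite ltr0n.
have NR : 0 < N%:R :> R by rewrite ltr0n (leq_trans l0).
have Nl : 1 <= N%:R / l%:R :> R by rewrite ler_pdivlMr// mul1r ler_nat.
have q0 : 0 < q by exact: lt_le_trans q1.
have eq1 : expR (- q) <= 1 by rewrite -[leRHS]expR0 ler_expR oppr_le0 ltW.
have h0 : expR (- q) <= N%:R / l%:R * expR (- t).
  have [tq'|tq'] := leP t q.
    by rewrite -[leLHS]mul1r ler_pM ?expR_ge0// ler_expR lerN2.
  move: tq; rewrite le_max leNgt tq'/= => tl.
  apply: (le_trans eq1); rewrite [expR (- t)]expRN ler_pdivlMr ?expR_gt0//.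
  by rewrite mul1r -[leRHS]lnK ?posrE ?divr_gt0// ler_expR.
have h1 : c / 2 * expR (- q) <= (minn M l)%:R / l%:R.
  have := leq_total M l; case/orP => [Ml|lM].
    rewrite (minn_idPl Ml); apply: (@le_trans _ _ (N%:R * (c * expR (- t)) / 2 / l%:R)).
      have -> : N%:R * (c * expR (- t)) / 2 / l%:R = c / 2 * (N%:R / l%:R * expR (- t)).
        by field; rewrite gt_eqF.
      by rewrite ler_wpM2l// divr_ge0// ltW.
    by rewrite ler_pM2r ?invr_gt0.
  rewrite (minn_idPr lM) mulfV ?gt_eqF// -[leRHS]mulr1 ler_pM ?expR_ge0//.
    by rewrite divr_ge0// ltW.
  by rewrite ler_pdivrMr// mul1r (le_trans c1)// ler1n.
apply: (@le_trans _ _ ((c / 2 * expR (- q)) `^ q^-1)); last first.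
  have c20 : 0 <= c / 2 * expR (- q) by rewrite mulr_ge0 ?expR_ge0// divr_ge0// ltW.
  by apply: ge0_ler_powR => //; rewrite ?nnegrE ?invr_ge0 ?(ltW q0)//.
have c2 : 0 <= c / 2 by rewrite divr_ge0// ltW.
rewrite powRM ?expR_ge0// -expRM mulNr mulfV ?gt_eqF// expRN.
have -> : c / 8 = c / 2 * 4^-1 by field.
apply: ler_pM => //.
  apply: ger1_powR; last by rewrite invf_le1.
  rewrite divr_gt0//= ler_pdivrMr// mul1r (le_trans c1)// ler1n.
  by [].
by rewrite lef_pV2 ?posrE ?expR_gt0// expR1_le4.
Qed.

Lemma expectation_top_mean_ge d (T : measurableType d) (P : probability T R)
    n N l (q t c s : R) (X : 'I_N -> {RV P >-> borel_rV R n}) (theta : 'rV[R]_n) :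
  mutually_independent X -> (0 < l)%N -> (l <= N)%N -> 1 <= q ->
  0 < c -> c <= 1 -> 0 <= s ->
  t <= Num.max q (ln (N%:R / l%:R)) -> t <= ln N%:R ->
  (forall i, ((c * expR (- t))%:E <=
     P [set omega | s <= `|dot (X i omega : 'rV[R]_n) theta|]%R)%E) ->
  ((s * (c / 8) * (c / (4 * (1 + c))))%:E <=
     \int[P]_omega (top_mean l q (fun i => X i omega) theta)%:E)%E.
Proof.
move=> indX l0 lN q1 c0 c1 s0 tq tN hP.
have NR : 0 < N%:R :> R by rewrite ltr0n (leq_trans l0).
pose B := [set x : borel_rV R n | s <= `|dot (x : 'rV[R]_n) theta|].
have mB : measurable B.
  rewrite -[X in measurable X]setTI.
  apply: (measurable_fun_le measurableT (measurable_cst _)).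
  apply: measurableT_comp => //; apply: measurable_dot; first exact: measurable_id.
  exact: measurable_cst.
pose E i : set T := X i @^-1` B.
have mE i : measurable (E i) by rewrite -[E i]setTI; exact: measurable_funP.
have indE i j : i != j -> P (E i `&` E j) = (P (E i) * P (E j))%E.
  move=> ij; have := indX (i |: [set j])%SET (fun=> B) (fun _ _ => mB).
  rewrite big_setU1 ?inE//= big_set1 => <-; congr (P _).
  apply/seteqP; split => [x [xi xj] k /=|x h]; first by rewrite !inE => /orP[]/eqP->.
  by split; apply: h; rewrite /= !inE eqxx ?orbT.
pose b := N%:R * (c * expR (- t)).
(* The bound [t <= ln N] keeps the expected number of successes above [c], so the probability from
   [count_ge] does not degenerate. *)
have cb : c <= b.
  have : 1 <= N%:R * expR (- t).
    by rewrite expRN ler_pdivlMr ?expR_gt0// mul1r -[leRHS]lnK ?posrE// ler_expR.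
  by rewrite /b; move: (expR (- t)) => e h; nra.
have b0 : 0 < b by exact: lt_le_trans cb.
have bS : b <= \sum_(i < N) fine (P (E i)).
  apply: (@le_trans _ _ (\sum_(i < N) (c * expR (- t)))).
    by rewrite sumr_const card_ord /b mulr_natl.
  apply: ler_sum => i _; rewrite -lee_fin fineK ?fin_num_measure//; exact: hP.
have := count_ge b0 mE indE bS.
set D := [set x | _] => hD.
have mD : measurable D.
  rewrite -[X in measurable X]setTI.
  apply: (measurable_fun_le measurableT (measurable_cst _)).
  by apply: measurable_sum => i; exact: measurable_indic.
have mX i : measurable_fun setT (X i : T -> borel_rV R n) by exact: measurable_funP.
have mt : measurable_fun setT (fun omega => (top_mean l q (fun i => X i omega) theta)%:E).
  by apply/measurable_EFinP; apply: measurable_top_mean => //; exact: measurable_cst.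
have sc : 0 <= s * (c / 8) by rewrite mulr_ge0// divr_ge0// ltW.
apply: (@le_trans _ _ (\int[P]_(omega in D) (s * (c / 8))%:E)%E); last first.
  apply: (@le_trans _ _ (\int[P]_(omega in D) (top_mean l q (fun i => X i omega) theta)%:E)%E).
    apply: ge0_le_integral => //.
    - exact: measurable_funTS.
    - move=> omega Dw; rewrite lee_fin.
      apply: le_trans (top_mean_ge lN q1 (fun i => X i omega) theta s0).
      rewrite ler_wpM2l//; apply: (minn_ratio_ge l0 lN q1 c0 c1 tq).
      apply: (le_trans Dw); rewrite natr_sum; apply: ler_sum => i _.
      by rewrite indicE (_ : (omega \in E i) = (s <= `|dot (X i omega : 'rV[R]_n) theta|)) //;
        apply/idP/idP; rewrite inE.
  by apply: ge0_subset_integral => // omega _; rewrite lee_fin top_mean_ge0.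
rewrite integral_cst// EFinM lee_wpmul2l ?lee_fin//.
apply: le_trans hD; rewrite lee_fin.
rewrite ler_pdivrMr ?mulr_gt0 ?addr_gt0// mulrAC ler_pdivlMr ?mulr_gt0 ?addr_gt0//.
nra.
Qed.

End lower_bound.

Section upper_bound.
Context (R : realType).

Definition level (N l : nat) (q : R) : R :=
  Num.min (Num.max q (ln (N%:R / l%:R))) (ln N%:R).

Lemma PhiE N l q : (0 < l)%N -> (l <= N)%N -> 1 <= q ->
  Phi N l q = Num.sqrt (level N l q).
Proof.
have sE (a b : R) : 0 <= a -> 0 <= b -> (Num.sqrt a <= Num.sqrt b) = (a <= b).
  by move=> a0 b0; rewrite ler_sqrt.
move=> l0 lN q1; have q0 : 0 <= q by rewrite (le_trans ler01).
have lR : 0 < l%:R :> R by rewrite ltr0n.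
have N1 : 1 <= N%:R :> R by rewrite ler1n (leq_trans l0).
have a0 : 0 <= ln (N%:R / l%:R) :> R by rewrite ln_ge0// ler_pdivlMr// mul1r ler_nat.
have b0 : 0 <= ln N%:R :> R by rewrite ln_ge0.
rewrite /Phi /level; move: (ln (N%:R / l%:R)) (ln N%:R) a0 b0 => a b a0 b0.
have -> : Num.max (Num.sqrt q) (Num.sqrt a) = Num.sqrt (Num.max q a).
  by have [h|h] := leP q a; [apply: max_r; rewrite sE | apply: max_l; rewrite sE// ltW].
have m0 : 0 <= Num.max q a by rewrite le_max q0.
by have [h|h] := leP (Num.max q a) b; [apply: min_l; rewrite sE | apply: min_r; rewrite sE// ltW].
Qed.

(** Keeps the level away from 0, so that rounding it up to an integer costs only a constant factor.
    For [N = 1] the level would be 0. *)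
Lemma level_ge N l q : (1 < N)%N -> 1 <= q -> 2^-1 <= level N l q.
Proof.
move=> N1 q1; rewrite /level le_min le_max (le_trans _ q1) ?invf_le1 ?ler1n//=.
rewrite -[leLHS]expRK ler_ln ?posrE ?expR_gt0 ?ltr0n ?(ltnW N1)//.
apply: (@le_trans _ _ 2); last by rewrite ler_nat.
have e : expR 2^-1 * expR 2^-1 = expR 1 :> R by rewrite -expRD; congr expR; field.
have := expR1_le4 R; rewrite -e; have := expR_gt0 (2^-1 : R).
by move: (expR 2^-1) => x; nra.
Qed.

Lemma level_le N n l q : (0 < N)%N -> N%:R <= expR (Num.sqrt n%:R) :> R ->
  level N l q <= Num.sqrt n%:R.
Proof.
move=> N0 Nn; rewrite /level ge_min; apply/orP; right.
by rewrite -[leRHS]expRK ler_ln ?posrE ?expR_gt0 ?ltr0n.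
Qed.

(** Merges two regimes. If the level is [max (q, ln (N/l))], then [l' = l]; if it is [ln N], the
    mean is replaced by the maximum and [l' = 1]. In both, [N / l' <= e^(2k)], which is what keeps
    the correction term bounded. *)
Lemma top_mean_le_moment n N l (q : R) : (0 < l)%N -> (l <= N)%N -> 1 <= q -> (1 < N)%N ->
  N%:R <= expR (Num.sqrt n%:R) :> R -> (0 < n)%N ->
  exists l' k, [/\ (0 < l')%N /\ (0 < k)%N, (k ^ 2 <= 16 * n)%N,
    N%:R / l'%:R <= expR (2 * k%:R) :> R, k%:R <= 3 * level N l q &
    forall (x : 'I_N -> 'rV[R]_n) theta A, 0 < A ->
      top_mean l q x theta <= A * (1 + l'%:R^-1 * \sum_i (dot (x i) theta / A) ^+ (2 * k))].
Proof.
move=> l0 lN q1 N1 Nn n0; set t := level N l q.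
have th := level_ge l N1 q1; have tn : t <= Num.sqrt n%:R by exact: level_le (ltnW N1) Nn.
have t0 : 0 <= t by rewrite (le_trans _ th)// invr_ge0.
have /andP[h1 h2] := Num.Theory.truncn_itv t0.
set j := Num.truncn t in h1 h2.
have k3 : j.+1%:R <= 3 * t by rewrite -natr1; move: th; rewrite -/t; lra.
have kn : (j.+1 ^ 2 <= 16 * n)%N.
  have s2 : Num.sqrt n%:R ^+ 2 = n%:R :> R by rewrite sqr_sqrtr.
  have : j%:R ^+ 2 <= n%:R :> R.
    by rewrite -s2 lerXn2r ?nnegrE ?sqrtr_ge0//; apply: le_trans tn.
  by rewrite -natrX ler_nat; nia.
have tk : t <= 2 * j.+1%:R by rewrite (le_trans (ltW h2))// ler_peMl// ler1n.
have NR : 0 < N%:R :> R by rewrite ltr0n ltnW.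
have lR : 0 < l%:R :> R by rewrite ltr0n.
have [hM|hM] := leP (Num.max q (ln (N%:R / l%:R))) (ln N%:R).
  have tE : t = Num.max q (ln (N%:R / l%:R)) by rewrite /t /level min_l.
  have := tk; rewrite {1}tE ge_max => /andP[qk lk].
  exists l, j.+1; split => //.
    by rewrite -[leLHS]lnK ?posrE ?divr_gt0// ler_expR.
  by move=> x theta A A0; apply: top_mean_le_pow => //; rewrite natrM.
have tE : t = ln N%:R by rewrite /t /level min_r// ltW.
exists 1%N, j.+1; split => //.
  by rewrite divr1 -[leLHS]lnK ?posrE// ler_expR -tE.
by move=> x theta A A0; rewrite invr1 mul1r; exact: top_mean_le_max.
Qed.

Context d (T : measurableType d) (P : probability T R) (n N : nat).
Variables (X : 'I_N -> {RV P >-> borel_rV R n}) (sigma : probability (borel_rV R n) R).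
Hypothesis usigma : is_uniform_on_sphere sigma.

Let mX i : measurable_fun setT (X i : T -> borel_rV R n).
Proof. exact: measurable_funP. Qed.

Lemma measurable_top_mean_prod l (q : R) : (l <= N)%N ->
  measurable_fun [set: T * borel_rV R n]
    (fun z => (top_mean l q (fun i => X i z.1) z.2)%:E).
Proof.
move=> lN; apply/measurable_EFinP; apply: measurable_top_mean => //.
by move=> i; apply: (measurableT_comp (mX i)); exact: measurable_fst.
Qed.

Lemma measurable_width l (q : R) : (l <= N)%N ->
  measurable_fun [set: T]
    (fun omega => \int[sigma]_theta (top_mean l q (fun i => X i omega) theta)%:E)%E.
Proof.
move=> lN; pose f (z : T * borel_rV R n) := (top_mean l q (fun i => X i z.1) z.2)%:E.
have f0 z : (0 <= f z)%E by rewrite lee_fin top_mean_ge0.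
exact: (@measurable_fun_fubini_tonelli_F _ _ _ _ _ sigma f (measurable_top_mean_prod q lN) f0).
Qed.

Lemma fubini_width l (q : R) : (l <= N)%N ->
  (\int[P]_omega \int[sigma]_theta (top_mean l q (fun i => X i omega) theta)%:E =
   \int[sigma]_theta \int[P]_omega (top_mean l q (fun i => X i omega) theta)%:E)%E.
Proof.
move=> lN; pose f (z : T * borel_rV R n) := (top_mean l q (fun i => X i z.1) z.2)%:E.
have f0 z : (0 <= f z)%E by rewrite lee_fin top_mean_ge0.
exact: (@fubini_tonelli _ _ _ _ _ P sigma f (measurable_top_mean_prod q lN) f0).
Qed.

Lemma measurable_sphere_dot_pow k : measurable_fun [set: borel_rV R n]
  (fun x : borel_rV R n => \int[sigma]_theta (dot (x : 'rV[R]_n) theta ^+ (2 * k))%:E)%E.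
Proof.
pose f (z : borel_rV R n * borel_rV R n) := (dot (z.1 : 'rV[R]_n) z.2 ^+ (2 * k))%:E.
have mf : measurable_fun [set: borel_rV R n * borel_rV R n] f.
  by apply: measurable_dot_pow; [exact: measurable_fst | exact: measurable_snd].
have f0 z : (0 <= f z)%E by rewrite lee_fin even_power_ge0.
exact: (@measurable_fun_fubini_tonelli_F _ _ _ _ _ sigma f mf f0).
Qed.

Lemma width_le l l' k (q A : R) omega : (l <= N)%N -> 0 < A ->
  (forall theta, top_mean l q (fun i => X i omega) theta <=
     A * (1 + l'%:R^-1 * \sum_i (dot (X i omega : 'rV[R]_n) theta / A) ^+ (2 * k))) ->
  (\int[sigma]_theta (top_mean l q (fun i => X i omega) theta)%:E <=
   A%:E + (A / l'%:R / A ^+ (2 * k))%:E *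
     \sum_i \int[sigma]_theta (dot (X i omega : 'rV[R]_n) theta ^+ (2 * k))%:E)%E.
Proof.
move=> lN A0 hA.
have c0 : 0 <= A / l'%:R / A ^+ (2 * k) by rewrite !divr_ge0 ?even_power_ge0// ltW.
have md i : measurable_fun [set: borel_rV R n]
    (fun theta : borel_rV R n => (dot (X i omega : 'rV[R]_n) theta ^+ (2 * k))%:E).
  by apply: measurable_dot_pow; [exact: measurable_cst | exact: measurable_id].
have ms : measurable_fun [set: borel_rV R n]
    (fun theta : borel_rV R n => \sum_i (dot (X i omega : 'rV[R]_n) theta ^+ (2 * k))%:E)%E.
  exact: emeasurable_sum.
have d0 i (theta : borel_rV R n) : setT theta ->
    (0 <= (dot (X i omega : 'rV[R]_n) theta ^+ (2 * k))%:E)%E.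
  by move=> _; rewrite lee_fin even_power_ge0.
have s0 (theta : borel_rV R n) : setT theta ->
    (0 <= \sum_i (dot (X i omega : 'rV[R]_n) theta ^+ (2 * k))%:E)%E.
  by move=> _; apply: sume_ge0 => i _; exact: d0.
apply: (@le_trans _ _ (\int[sigma]_theta (A%:E + (A / l'%:R / A ^+ (2 * k))%:E *
    \sum_i (dot (X i omega : 'rV[R]_n) theta ^+ (2 * k))%:E))%E).
  apply: ge0_le_integral => //.
  - by move=> theta _; rewrite lee_fin top_mean_ge0.
  - apply/measurable_EFinP; apply: measurable_top_mean => //; exact: measurable_id.
  - by apply: emeasurable_funD => //; exact: measurable_funeM.
  move=> theta _; rewrite sumEFin -EFinM -EFinD lee_fin; apply: (le_trans (hA theta)).
  rewrite mulrDr mulr1 lerD2l le_eqVlt; apply/orP; left; apply/eqP.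
  rewrite !mulr_sumr; apply: eq_bigr => i _.
  by rewrite expr_div_n; ring.
have p1 (theta : borel_rV R n) : setT theta -> (0 <= A%:E)%E by rewrite lee_fin ltW.
have p2 (theta : borel_rV R n) : setT theta -> (0 <= (A / l'%:R / A ^+ (2 * k))%:E *
    \sum_i (dot (X i omega : 'rV[R]_n) theta ^+ (2 * k))%:E)%E.
  by move=> _; rewrite mule_ge0// s0.
rewrite (ge0_integralD sigma measurableT p1 (measurable_cst _) p2); last exact: measurable_funeM.
apply: leeD.
  rewrite integral_cst// -[leRHS]mule1; apply: lee_wpmul2l; first by rewrite lee_fin ltW.
  exact: (probability_le1 sigma measurableT).
rewrite ge0_integralZl//; apply: lee_wpmul2l; first by rewrite lee_fin.
by rewrite ge0_integral_sum.
Qed.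

(** Only finiteness matters, so that the real-valued integral in [mean_width] loses nothing; second
    moments with [A = 1] suffice. *)
Lemma width_fin l (q : R) omega : (0 < n)%N -> (0 < l)%N -> (l <= N)%N -> 1 <= q ->
  (\int[sigma]_theta (top_mean l q (fun i => X i omega) theta)%:E < +oo)%E.
Proof.
move=> n0 l0 lN q1.
apply: (@le_lt_trans _ _ _ _ _ (@width_le l 1 1 q 1 omega lN ltr01 _)).
  move=> theta; rewrite [X in X * \sum_i _]invr1 [X in _ * (_ + X)]mul1r.
  exact: (@top_mean_le_max R n N l q l0 lN q1 (fun i => X i omega) theta 1 1 ltr01 isT).
rewrite lte_add_pinfty ?ltry// lte_mul_pinfty// ?lee_fin ?divr_ge0//.
apply: lte_sum_pinfty => i _.
exact: le_lt_trans (integral_sphere_dot_even usigma (X i omega : 'rV[R]_n) n0 _) (ltry _).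
Qed.

End upper_bound.

Section expected_width.
Context (R : realType).

Lemma expected_width_le : exists2 c : R, 0 < c &
  forall (p : R) n N d (T : measurableType d) (P : probability T R)
    (X : 'I_N -> {RV P >-> borel_rV R n}) (sigma : probability (borel_rV R n) R) l q,
  1 <= p -> (0 < n)%N -> (1 < N)%N -> N%:R <= expR (Num.sqrt n%:R) :> R ->
  (forall i, is_cone_law p (distribution P (X i))) -> is_uniform_on_sphere sigma ->
  (0 < l)%N -> (l <= N)%N -> 1 <= q ->
  (\int[P]_omega \int[sigma]_theta (top_mean l q (fun i => X i omega) theta)%:E <=
   (c * n%:R `^ (- p^-1) * Num.sqrt (level N l q))%:E)%E.
Proof.
have [C C1 hC] := double_moment_le R.
have C0 : 0 < C by rewrite (lt_le_trans ltr01).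
exists (8 * Num.sqrt (3 * C)); first by rewrite mulr_gt0// sqrtr_gt0 mulr_gt0.
move=> p n N d T P X sigma l q p1 n0 N1 Nn QE us l0 lN q1.
have [l' [k [[l'0 k0] kn Nl kt hA]]] := top_mean_le_moment l0 lN q1 N1 Nn n0.
have nR : 0 < n%:R :> R by rewrite ltr0n.
have kR : 0 < k%:R :> R by rewrite ltr0n.
have l'R : 0 < l'%:R :> R by rewrite ltr0n.
have nu0 : 0 < n%:R `^ p^-1 :> R by rewrite powR_gt0.
set nu := n%:R `^ p^-1 in nu0.
pose D : R := C * (k%:R / nu ^+ 2).
have D0 : 0 < D by rewrite mulr_gt0// divr_gt0// exprn_gt0.
(* The factor [e] makes [A^(2k) = e^(2k) D^k]: the first factor absorbs [N / l'] and the second the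
   moment bound, so the whole correction is at most [A]. *)
pose A : R := expR 1 * Num.sqrt D.
have A0 : 0 < A by rewrite mulr_gt0 ?expR_gt0// sqrtr_gt0.
have AE : A ^+ (2 * k) = expR (2 * k%:R) * D ^+ k.
  have A2 : A ^+ 2 = expR 1 ^+ 2 * D by rewrite /A [LHS]exprMn sqr_sqrtr// ltW.
  rewrite exprM A2 exprMn -exprM -expRM_natl.
  by congr (expR _ * _); rewrite natrM mulr1.
pose B : R := A / l'%:R / A ^+ (2 * k).
have B0 : 0 <= B by rewrite !divr_ge0 ?even_power_ge0// ltW.
pose g (x : borel_rV R n) := (\int[sigma]_theta (dot (x : 'rV[R]_n) theta ^+ (2 * k))%:E)%E.
have mg : measurable_fun setT g by exact: measurable_sphere_dot_pow.
have g0 x : (0 <= g x)%E.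
  by apply: integral_ge0 => theta _; rewrite lee_fin even_power_ge0.
have mX i : measurable_fun setT (X i : T -> borel_rV R n) by exact: measurable_funP.
have mgX i : measurable_fun setT (fun omega => g (X i omega)).
  exact: (measurableT_comp mg (mX i)).
have Ig i : (\int[P]_omega g (X i omega) <= (D ^+ k)%:E)%E.
  apply: le_trans (hC n p (distribution P (X i)) sigma k n0 p1 (QE i) us k0 kn).
  by rewrite fubini_dot_pow (ge0_integral_distribution (X i) mg g0).
have p1' (omega : T) : setT omega -> (0 <= A%:E)%E by rewrite lee_fin ltW.
have s0 (omega : T) : setT omega -> (0 <= \sum_i g (X i omega))%E.
  by move=> _; apply: sume_ge0.
have ms : measurable_fun setT (fun omega => \sum_i g (X i omega))%E by exact: emeasurable_sum.
have p2 (omega : T) : setT omega -> (0 <= B%:E * \sum_i g (X i omega))%E.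
  by move=> wT; rewrite mule_ge0// s0.
apply: (@le_trans _ _ (\int[P]_omega (A%:E + B%:E * \sum_i g (X i omega)))%E).
  apply: ge0_le_integral => //.
  - by move=> omega _; apply: integral_ge0 => theta _; rewrite lee_fin top_mean_ge0.
  - exact: measurable_width.
  - by apply: emeasurable_funD => //; exact: measurable_funeM.
  by move=> omega _; apply: width_le => // theta; exact: hA.
rewrite (ge0_integralD P measurableT p1' (measurable_cst _) p2); last exact: measurable_funeM.
rewrite ge0_integralZl// ge0_integral_sum//.
apply: (@le_trans _ _ (A%:E + B%:E * (D ^+ k *+ N)%:E)%E).
  apply: leeD.
    rewrite integral_cst// -[leRHS]mule1; apply: lee_wpmul2l; first by rewrite lee_fin ltW.
    exact: (probability_le1 P measurableT).
  apply: lee_wpmul2l; first by rewrite lee_fin.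
  apply: (@le_trans _ _ (\sum_(i < N) (D ^+ k)%:E)%E); first exact: lee_sum.
  by rewrite sumEFin lee_fin sumr_const card_ord.
rewrite -EFinM -EFinD lee_fin.
have BE : B * (D ^+ k *+ N) <= A.
  have -> : B * (D ^+ k *+ N) = A * (N%:R / l'%:R / expR (2 * k%:R)).
    rewrite /B AE -[D ^+ k *+ N]mulr_natr; have Dk := exprn_gt0 k D0.
    have := expR_gt0 (2 * k%:R : R).
    move: (expR (2 * k%:R)) (D ^+ k) Dk => e u u0 e0.
    by field; rewrite !gt_eqF.
  rewrite ler_piMr ?(ltW A0)//.
  by rewrite ler_pdivrMr ?expR_gt0// mul1r.
apply: (@le_trans _ _ (2 * A)); first by lra.
have DE : Num.sqrt D <= nu^-1 * (Num.sqrt (3 * C) * Num.sqrt (level N l q)).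
  have L0 : 0 <= level N l q.
    by rewrite (le_trans _ (level_ge l N1 q1))// invr_ge0.
  rewrite -sqrtrM ?mulr_ge0 ?(ltW C0)// -[nu^-1]ger0_norm ?invr_ge0 ?(ltW nu0)//.
  rewrite -sqrtr_sqr -sqrtrM ?sqr_ge0// ler_wsqrtr// /D exprVn.
  have -> : nu ^- 2 * (3 * C * level N l q) = (C / nu ^+ 2) * (3 * level N l q).
    by field; rewrite gt_eqF.
  have -> : C * (k%:R / nu ^+ 2) = (C / nu ^+ 2) * k%:R by field; rewrite gt_eqF.
  by rewrite ler_wpM2l// divr_ge0 ?(ltW C0)// sqr_ge0.
rewrite powRN -/nu /A.
have -> : 8 * Num.sqrt (3 * C) / nu * Num.sqrt (level N l q) =
  2 * (4 * (nu^-1 * (Num.sqrt (3 * C) * Num.sqrt (level N l q)))) by ring.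
by rewrite ler_wpM2l// ler_pM ?expR_ge0 ?sqrtr_ge0// expR1_le4.
Qed.

Lemma expected_width_ge : exists2 c : R, 0 < c &
  forall (p : R) n N d (T : measurableType d) (P : probability T R)
    (X : 'I_N -> {RV P >-> borel_rV R n}) (sigma : probability (borel_rV R n) R) l q,
  1 <= p -> (0 < n)%N -> (1 < N)%N -> N%:R <= expR (Num.sqrt n%:R) :> R ->
  mutually_independent X ->
  (forall i, is_cone_law p (distribution P (X i))) -> is_uniform_on_sphere sigma ->
  (0 < l)%N -> (l <= N)%N -> 1 <= q ->
  ((c * n%:R `^ (- p^-1) * Num.sqrt (level N l q))%:E <=
   \int[P]_omega \int[sigma]_theta (top_mean l q (fun i => X i omega) theta)%:E)%E.
Proof.
have [a [b0 [a0 b00 hT]]] := tail_ge R.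
pose b := Num.min b0 1.
have bp : 0 < b by rewrite lt_min b00 ltr01.
have b1 : b <= 1 by rewrite ge_min lexx orbT.
have bb : b <= b0 by rewrite ge_min lexx.
pose L := b / 8 * (b / (4 * (1 + b))).
have L0 : 0 < L by rewrite mulr_gt0 ?divr_gt0// mulr_gt0// addr_gt0.
exists (a * L / 2); first by rewrite divr_gt0// mulr_gt0.
move=> p n N d T P X sigma l q p1 n0 N1 Nn indX QE us l0 lN q1.
have nu0 : 0 < n%:R `^ p^-1 :> R by rewrite powR_gt0// ltr0n.
set t := level N l q.
have tn : t <= Num.sqrt n%:R by exact: level_le (ltnW N1) Nn.
have t0 : 0 <= t by rewrite (le_trans _ (level_ge l N1 q1))// invr_ge0.
have tq : t <= Num.max q (ln (N%:R / l%:R)) by rewrite /t /level ge_min lexx.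
have tN : t <= ln N%:R by rewrite /t /level ge_min lexx orbT.
pose i0 : 'I_N := Ordinal (ltnW N1).
have [G [mG GS sG hG]] := hT n p (distribution P (X i0)) sigma t n0 p1 (QE i0) us t0 tn.
pose s := a * Num.sqrt t / n%:R `^ p^-1.
have s0 : 0 <= s by rewrite divr_ge0 ?(ltW nu0)// mulr_ge0 ?sqrtr_ge0// ltW.
have sL : 0 <= s * L by rewrite mulr_ge0// ltW.
have mB (theta : 'rV[R]_n) : measurable [set x : borel_rV R n | s <= `|dot (x : 'rV[R]_n) theta|].
  rewrite -[X in measurable X]setTI.
  apply: (measurable_fun_le measurableT (measurable_cst _)).
  apply: measurableT_comp => //; apply: measurable_dot; first exact: measurable_id.
  exact: measurable_cst.
have ptw (theta : 'rV[R]_n) : G theta ->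
    ((s * L)%:E <= \int[P]_omega (top_mean l q (fun i => X i omega) theta)%:E)%E.
  move=> Gt; rewrite /L [s * _]mulrA.
  apply: (expectation_top_mean_ge indX l0 lN q1 bp b1 s0 tq tN) => i.
  have -> : P [set omega | s <= `|dot (X i omega : 'rV[R]_n) theta|] =
      distribution P (X i0) [set x : borel_rV R n | s <= `|dot (x : 'rV[R]_n) theta|].
    by rewrite (cone_law_unique n0 p1 (QE i0) (QE i) (mB theta)).
  apply: le_trans (hG theta Gt).
  by rewrite lee_fin ler_wpM2r ?expR_ge0.
have f0 z : (0 <= (fun z : T * borel_rV R n => (top_mean l q (fun i => X i z.1) z.2)%:E) z)%E.
  by rewrite lee_fin top_mean_ge0.
have mf := measurable_top_mean_prod X q lN.
have mI : measurable_fun [set: borel_rV R n]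
    (fun theta => \int[P]_omega (top_mean l q (fun i => X i omega) theta)%:E)%E.
  exact: (@measurable_fun_fubini_tonelli_G _ _ _ _ _ P _ mf f0).
have I0 (theta : borel_rV R n) :
    (0 <= \int[P]_omega (top_mean l q (fun i => X i omega) theta)%:E)%E.
  by apply: integral_ge0 => omega _; rewrite lee_fin top_mean_ge0.
rewrite fubini_width//.
apply: (@le_trans _ _ (\int[sigma]_(theta in G) (s * L)%:E)%E); last first.
  apply: (@le_trans _ _ (\int[sigma]_(theta in G)
      \int[P]_omega (top_mean l q (fun i => X i omega) theta)%:E)%E).
    apply: ge0_le_integral => //; exact: measurable_funTS.
  exact: ge0_subset_integral.
rewrite integral_cst//.
have -> : a * L / 2 * n%:R `^ (- p^-1) * Num.sqrt t = s * L * 2^-1.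
  by rewrite powRN /s; ring.
by rewrite EFinM; apply: lee_wpmul2l; rewrite ?lee_fin.
Qed.

(** The support function is prescribed on the unit sphere only, which carries [sigma]. The two
    integrands over [Omega] agree at every [omega], so measurability of the width never has to be
    checked for [K] itself. *)
Lemma expectation_mean_widthE n N l (q : R) d (T : measurableType d) (P : probability T R)
    (X : 'I_N -> {RV P >-> borel_rV R n}) (sigma : probability (borel_rV R n) R)
    (K : T -> set 'rV[R]_n) :
  is_uniform_on_sphere sigma -> (0 < n)%N -> (0 < l)%N -> (l <= N)%N -> 1 <= q ->
  (forall omega, is_body_KNlq l q (fun i => X i omega) (K omega)) ->
  ('E_P[fun omega => mean_width sigma (K omega)] =
   \int[P]_omega \int[sigma]_theta (top_mean l q (fun i => X i omega) theta)%:E)%E.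
Proof.
move=> us n0 l0 lN q1 hK; rewrite unlock; apply: eq_integral => omega _.
have [_ hs] := hK omega.
have mt : measurable_fun [set: borel_rV R n]
    (fun theta : borel_rV R n => (top_mean l q (fun i => X i omega) theta)%:E).
  apply/measurable_EFinP; apply: measurable_top_mean => //; exact: measurable_id.
have t0 theta : (0 <= (top_mean l q (fun i => X i omega) theta)%:E)%E.
  by rewrite lee_fin top_mean_ge0.
rewrite /mean_width /Rintegral.
rewrite (_ : (\int[sigma]_(theta in @unit_sphere R n) (support_fun (K omega) theta)%:E)%E =
    (\int[sigma]_theta (top_mean l q (fun i => X i omega) theta)%:E)%E); last first.
  rewrite (ge0_integral_sphereE us mt t0); apply: eq_integral => theta.
  by rewrite inE => St; rewrite hs.
rewrite fineK// ge0_fin_numE ?width_fin//.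
by apply: integral_ge0 => theta _; exact: t0.
Qed.

End expected_width.

Theorem theorem1p4 (R : realType) :
  exists c1 c2 : R, [/\ 0 < c1, 0 < c2 &
  forall (p : R) (n N : nat),
    1 <= p ->
    (1 <= n)%N -> (n <= N)%N -> (1 < N)%N ->
    N%:R <= expR (Num.sqrt (n%:R : R)) ->
  forall (d : measure_display) (Omega : measurableType d)
    (P : probability Omega R) (X : 'I_N -> {RV P >-> borel_rV R n}),
    mutually_independent X ->
    (forall i, has_cone_law p (X i)) ->
  forall sigma : probability (borel_rV R n) R,
    is_uniform_on_sphere sigma ->
  forall (l : nat) (q : R),
    (1 <= l <= N)%N -> 1 <= q ->
  forall K : Omega -> set 'rV[R]_n,
    (forall omega, is_body_KNlq l q (fun i => X i omega) (K omega)) ->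
    ((c1 * n%:R `^ (- p^-1) * Phi N l q)%:E
       <= 'E_P[fun omega => mean_width sigma (K omega)])%E /\
    ('E_P[fun omega => mean_width sigma (K omega)]
       <= (c2 * n%:R `^ (- p^-1) * Phi N l q)%:E)%E].
Proof.
have [c1 c10 hge] := expected_width_ge R.
have [c2 c20 hle] := expected_width_le R.
exists c1, c2; split => // p n N p1 n0 _ N1 Nn d Omega P X indX hX sigma us l q /andP[l0 lN] q1 K hK.
have QE i : is_cone_law p (distribution P (X i)).
  by move=> A mA; exact: (cone_lawE n0 p1 (hX i) mA).
rewrite PhiE// (expectation_mean_widthE us n0 l0 lN q1 hK); split.
  exact: hge.
exact: hle.
Qed.
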